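(* Let $c>0$ and consider $$\partial_t u=\partial_{xx}u-c\,\partial_x u\quad (x>0),\qquad \partial_x u=1+\vartheta h(u)\quad (x=0),$$ where $h$ additionally satisfies $h(u)>-1$ for all $u\not\equiv\pi \pmod{2\pi}$. Then there exists an entire solution $u_1(x,t)$ of this problem with $\vartheta=1$ such that: (i) $u_1(\cdot,t)\to\pi$ in $L^\infty(\mathbb{R}^+)$ as $t\to-\infty$ and $u_1(\cdot,t)\to-\pi$ in $L^\infty_{\mathrm{loc}}(\mathbb{R}^+)$ as $t\to+\infty$; (ii) every entire solution $U$ of the problem with $\vartheta=1$ satisfying $-\pi<U<\pi$ is a time translate $U=u_1(\cdot,\cdot+s)$ for some $s\in\mathbb{R}$. Moreover, for $\vartheta\in(-1,1)$ and $y\in(-\pi,\pi]$ let $u(x,t;\vartheta,y)$ denote the unique (up to time translation) entire solution of the problem with parameter $\vartheta$ which satisfies $u(x,t+T)=u(x,t)-2\pi$ for some minimal $T>0$, $\partial_x u>0$, $\partial_t u<0$, normalized by $u(0,0;\vartheta,y)=y$. Then: (iii) for every $y\in(-\pi,\pi)$ there exists $t_y\in\mathbb{R}$ such that $u(\cdot,\cdot;\vartheta,y)\to u_1(\cdot,\cdot+t_y)$ in $L^\infty_{\mathrm{loc}}(\mathbb{R}^+\times\mathbb{R})$ as $\vartheta\nearrow1$, and the map $y\mapsto t_y$ is a decreasing bijection from $(-\pi,\pi)$ onto $\mathbb{R}$; (iv) for $y=\pi$, $u(\cdot,\cdot;\vartheta,\pi)\to\pi$ as $\vartheta\nearrow1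$.
   Context: $h\in C^2(\mathbb{R},\mathbb{R})$ is $2\pi$-periodic with $\max h=1$ and $\min h=h(\pi)=-1$. $Y_c$ denotes the space of functions $v$ on $[0,\infty)$ such that $x\mapsto e^{-cx/2}v(x)$ is bounded and uniformly continuous. An entire solution is a classical solution defined for all $t\in\mathbb{R}$, $x\ge0$, with $u(\cdot,t)\in Y_c$ for every $t$. For $\vartheta\in(-1,1)$ such relative periodic, monotone solutions exist and are unique up to time translation among entire solutions with $\partial_t u<0$ (this is what makes the normalization $u(0,0;\vartheta,y)=y$ well defined). *)

(* Defs.v *)
From Stdlib Require Import Reals Lra ZArith.
From Coquelicot Require Import Coquelicot.
Open Scope R_scope.

Definition C2 (h : R -> R) : Prop :=
  (forall x, ex_derive h x) /\ (forall x, ex_derive (Derive h) x) /\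
  (forall x, continuous (Derive_n h 2) x).

Definition h_hyp (h : R -> R) : Prop :=
  C2 h /\ (forall u, h (u + 2 * PI) = h u) /\
  (forall u, h u <= 1) /\ (exists u, h u = 1) /\
  h PI = -1 /\ (forall u, -1 <= h u).

Definition cont_in (P : R -> Prop) (f : R -> R -> R) (x t : R) : Prop :=
  forall eps, 0 < eps -> exists delta, 0 < delta /\
    forall x' t', P x' -> Rabs (x' - x) < delta -> Rabs (t' - t) < delta ->
      Rabs (f x' t' - f x t) < eps.

Definition in_Yc (c : R) (v : R -> R) : Prop :=
  let w := fun x => exp (- c * x / 2) * v x in
  (exists M, forall x, 0 <= x -> Rabs (w x) <= M) /\
  (forall eps, 0 < eps -> exists delta, 0 < delta /\
     forall x y, 0 <= x -> 0 <= y -> Rabs (x - y) < delta ->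
       Rabs (w x - w y) < eps).

(* Entire classical solution u(x,t) (x >= 0, t in R) of
     u_t = u_xx - c u_x  (x > 0),   u_x = 1 + theta h(u)  (x = 0),
   with u in C^{2,1}((0,oo) x R) /\ C^{1,0}([0,oo) x R), u(.,t) in Y_c. *)
Definition entire_solution (c theta : R) (h : R -> R) (u : R -> R -> R) : Prop :=
  exists ux uxx ut : R -> R -> R,
    (forall x t, 0 <= x -> cont_in (fun x' => 0 <= x') u x t) /\
    (forall x t, 0 <= x -> cont_in (fun x' => 0 <= x') ux x t) /\
    (forall x t, 0 < x -> cont_in (fun x' => 0 < x') uxx x t) /\
    (forall x t, 0 < x -> cont_in (fun x' => 0 < x') ut x t) /\
    (forall x t, 0 < x -> is_derive (fun y => u y t) x (ux x t)) /\
    (forall x t, 0 < x -> is_derive (fun y => ux y t) x (uxx x t)) /\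
    (forall x t, 0 < x -> is_derive (fun s => u x s) t (ut x t)) /\
    (forall x t, 0 < x -> ut x t = uxx x t - c * ux x t) /\
    (forall t, ux 0 t = 1 + theta * h (u 0 t)) /\
    (forall t, in_Yc c (fun x => u x t)).

Definition rel_periodic_with (u : R -> R -> R) (T : R) : Prop :=
  forall x t, 0 <= x -> u x (t + T) = u x t - 2 * PI.

Definition rel_periodic_minimal (u : R -> R -> R) : Prop :=
  exists T, 0 < T /\ rel_periodic_with u T /\
    (forall T', 0 < T' < T -> ~ rel_periodic_with u T').

Definition rpm_solution (c theta : R) (h : R -> R) (y : R) (u : R -> R -> R) : Prop :=
  entire_solution c theta h u /\ rel_periodic_minimal u /\
  (forall x t, 0 < x -> 0 < Derive (fun z => u z t) x) /\
  (forall x t, 0 < x -> Derive (fun s => u x s) t < 0) /\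
  u 0 0 = y.

Definition loc_unif_cvg_to_1 (v : R -> R -> R -> R) (w : R -> R -> R) : Prop :=
  forall K eps, 0 < K -> 0 < eps -> exists delta, 0 < delta /\
    forall theta x t, 1 - delta < theta < 1 -> 0 <= x <= K -> -K <= t <= K ->
      Rabs (v theta x t - w x t) < eps.

(* Main.v *)
(** Write u(0,t) = b(t), and let g(t) = 1 + theta h(b(t)) be the boundary flux. The slope
    q = u_x of an entire solution is the solution of the Dirichlet problem with boundary data g, that is the
    convolution of g with the hitting-time density of 0 for Brownian motion with drift -c, and the
    weighted mass m(t) = int_0^oo c e^{-cx} u(x,t) dx = b(t) + J(t), with J(t) = int_0^oo e^{-cx} q(x,t) dx,
    satisfies m' = -c g. Conversely every solution b of this scalar equation with memory gives a
    classical entire solution, so that everything can be read off the boundary trace b.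

    For theta = 1 the flux vanishes quadratically at b = pi. A Lyapunov-Perron estimate, backward in
    time with the weight e^{lam s}, shows that two solutions which are close to pi in the past and have
    the same mass at some time coincide before that time, and by the comparison principle also after it;
    as the mass is monotone, solutions emanating from pi are unique up to translation. Existence
    follows by compactness from solutions of a problem with a small delay in the boundary condition.
    The traces of the relative periodic solutions are equicontinuous as theta -> 1; every limit is
    a nonincreasing solution of the limit problem through y, which the comparison with the
    equilibrium pi, Hopf's lemma and the uniqueness identify as the translate of the trace of
    u_1 through y, or as pi when y = pi. *)

Require Import Defs.
From Stdlib Require Import Reals ZArith Lra Lia Classical ClassicalEpsilon FunctionalExtensionality.
From Coquelicot Require Import Coquelicot.
From mathcomp Require classical.filter.
Open Scope R_scope.

(** * Integrals of continuous functions *)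

(** The linearization of the case theta = 1 at pi is the homogeneous Neumann problem. In the weight
    e^{-c x} it has the simple eigenvalue 0, carried by the constants and measured by the mass; the
    rest of its spectrum lies at or below -c^2/4. Hence there is no exponential rate as t -> -oo:
    solutions leave pi along a centre direction with the mass as coordinate. The exponent 3c^2/16 of
    [lam] is taken inside the gap (0, c^2/4), and smallness comes from h'(pi) = 0.

    Working with traces replaces regularity theory by explicit kernels: every x-derivative falls on
    the kernel, and the flux only has to be continuous and bounded. All moduli of continuity depend
    on the bound of the flux alone, which gives compactness. Limits are taken along one free
    ultrafilter, so that they exist at all times at once.

    Growth is compared on the scale 1, e^{c x / 2}, e^{c x}. The space Y_c allows the second; the
    decaying solution e^{c x / 2 - c^2 t / 4} removes it for entire solutions, and the stationary
    solution e^{c x} controls large x in the maximum principles. *)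

Ltac eqR := match goal with |- @eq _ ?a ?b => change (@eq R a b) end.

Ltac rabs_lra :=
  repeat match goal with
    | H : Rabs _ < _ |- _ => apply Rabs_def2 in H
    | H : Rabs _ <= _ |- _ => apply Rabs_le_between in H
  end;
  match goal with
    | |- Rabs _ < _ => apply Rabs_def1
    | |- Rabs _ <= _ => apply Rabs_le_between
    | |- _ => idtac
  end; lra.

Lemma exp_le (a b : R) : a <= b -> exp a <= exp b.
Proof. intros [H|<-]; [left; now apply exp_increasing|right; reflexivity]. Qed.

Lemma exp_ge_1 (a : R) : 0 <= a -> 1 <= exp a.
Proof. intros H. rewrite <- exp_0. now apply exp_le. Qed.

Lemma exp_le_1 (a : R) : a <= 0 -> exp a <= 1.
Proof. intros H. rewrite <- exp_0. now apply exp_le. Qed.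

Lemma Rabs_exp (a : R) : Rabs (exp a) = exp a.
Proof. apply Rabs_right, Rle_ge, Rlt_le, exp_pos. Qed.

Definition cont (f : R -> R) : Prop := forall s, continuous f s.

Lemma cont_ex_RInt (f : R -> R) (a b : R) : cont f -> ex_RInt f a b.
Proof. intros H. apply (ex_RInt_continuous (V:=R_CompleteNormedModule)). intros; apply H. Qed.

Lemma cont_mult (f g : R -> R) : cont f -> cont g -> cont (fun s => f s * g s).
Proof. intros Hf Hg s. apply (continuous_mult (K:=R_AbsRing) f g); auto. Qed.

Lemma cont_plus (f g : R -> R) : cont f -> cont g -> cont (fun s => f s + g s).
Proof. intros Hf Hg s. apply (continuous_plus (V:=R_NormedModule) f g); auto. Qed.

Lemma cont_minus (f g : R -> R) : cont f -> cont g -> cont (fun s => f s - g s).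
Proof. intros Hf Hg s. apply (continuous_minus (V:=R_NormedModule) f g); auto. Qed.

Lemma cont_scal (k : R) (f : R -> R) : cont f -> cont (fun s => k * f s).
Proof. intros Hf s. apply (continuous_scal_r (K:=R_AbsRing) (V:=R_NormedModule) k f); auto. Qed.

Lemma cont_const (k : R) : cont (fun _ => k).
Proof. intros s. apply continuous_const. Qed.

Lemma cont_comp (f g : R -> R) : cont f -> cont g -> cont (fun s => g (f s)).
Proof. intros Hf Hg s. apply (continuous_comp f g); auto. Qed.

Lemma cont_derive (f f' : R -> R) : (forall s, is_derive f s (f' s)) -> cont f.
Proof. intros H s. apply (ex_derive_continuous f). now exists (f' s). Qed.

Lemma is_derive_R_eq (f : R -> R) (x l l' : R) : is_derive f x l -> l = l' -> is_derive f x l'.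
Proof. now intros H <-. Qed.

Lemma is_derive_R_plus (f g : R -> R) (x a b : R) : is_derive f x a -> is_derive g x b ->
  is_derive (fun y => f y + g y) x (a + b).
Proof. intros Hf Hg. apply (is_derive_plus (V:=R_NormedModule) f g); auto. Qed.

Lemma is_derive_R_minus (f g : R -> R) (x a b : R) : is_derive f x a -> is_derive g x b ->
  is_derive (fun y => f y - g y) x (a - b).
Proof. intros Hf Hg. apply (is_derive_minus (V:=R_NormedModule) f g); auto. Qed.

Lemma is_derive_R_scal (k : R) (f : R -> R) (x a : R) : is_derive f x a ->
  is_derive (fun y => k * f y) x (k * a).
Proof. intros Hf. apply (is_derive_scal f x k a). exact Hf. Qed.

Lemma is_derive_R_mult (f g : R -> R) (x a b : R) : is_derive f x a -> is_derive g x b ->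
  is_derive (fun y => f y * g y) x (a * g x + f x * b).
Proof. intros Hf Hg. apply (is_derive_mult f g x a b Hf Hg). intros; apply Rmult_comm. Qed.

Lemma is_derive_R_comp (f g : R -> R) (x a b : R) : is_derive f (g x) a -> is_derive g x b ->
  is_derive (fun y => f (g y)) x (a * b).
Proof.
intros Hf Hg. eapply is_derive_R_eq; [apply (is_derive_comp f g x a b Hf Hg)|].
unfold scal; simpl; unfold mult; simpl; ring.
Qed.

Lemma is_derive_R_const (k x : R) : is_derive (fun _ => k) x 0.
Proof. apply (is_derive_const (V:=R_NormedModule) k x). Qed.

Lemma is_derive_R_id (x : R) : is_derive (fun y => y) x 1.
Proof. apply (is_derive_id x). Qed.

Lemma is_derive_R_continuous (f : R -> R) (x a : R) : is_derive f x a -> continuous f x.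
Proof. intros H. apply (ex_derive_continuous f). now exists a. Qed.

Lemma is_derive_R_shift (f : R -> R) (t s a : R) : is_derive f (t - s) a ->
  is_derive (fun s => f (t - s)) s (- a).
Proof.
intros H. eapply is_derive_R_eq; [apply (is_derive_R_comp f (fun s => t - s) s a (-1)); [exact H|]|ring].
eapply is_derive_R_eq; [apply (is_derive_R_minus _ _ _ _ _ (is_derive_R_const t s) (is_derive_R_id s))|ring].
Qed.

Lemma cont_exp_scal (k : R) : cont (fun s => exp (k * s)).
Proof.
apply (cont_derive _ (fun s => k * exp (k * s))). intros s. auto_derive; [auto|ring].
Qed.

Lemma continuous_eps (f : R -> R) (x : R) :
  continuous f x <->
  (forall eps, 0 < eps -> exists d, 0 < d /\ forall y, Rabs (y - x) < d -> Rabs (f y - f x) < eps).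
Proof.
split.
- intros H eps He. apply continuity_pt_filterlim in H.
  destruct (H eps He) as [d [Hd Hy]]. exists d. split; [exact Hd|]. intros y Hxy.
  destruct (Req_dec x y) as [->|Hn].
  + now rewrite Rminus_diag, Rabs_R0.
  + apply Hy. split; [split; [exact Logic.I | exact Hn]|exact Hxy].
- intros H. apply continuity_pt_filterlim. intros eps He.
  destruct (H eps He) as [d [Hd Hy]]. exists d. split; [exact Hd|].
  intros y [_ Hy2]. now apply Hy.
Qed.

Lemma cont_shift (g : R -> R) (t : R) : cont g -> cont (fun s => g (t - s)).
Proof.
intros Hg. apply (cont_comp (fun s => t - s) g); [|exact Hg].
apply (cont_derive _ (fun _ => -1)). intros s. auto_derive; [auto|ring].
Qed.

Lemma continuous_ext_near (f g : R -> R) (x d : R) : 0 < d ->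
  (forall y, Rabs (y - x) < d -> f y = g y) -> continuous f x -> continuous g x.
Proof.
intros Hd He Hf. apply (continuous_ext_loc g f); [|exact Hf].
exists (mkposreal d Hd). intros y Hy. apply He. exact Hy.
Qed.

Lemma is_derive_RInt_cont (f : R -> R) (a x : R) : cont f ->
  is_derive (fun x => RInt f a x) x (f x).
Proof.
intros Hf. apply (is_derive_RInt f (fun x => RInt f a x) a).
- apply filter_forall. intros y. apply (RInt_correct (V:=R_CompleteNormedModule)), cont_ex_RInt, Hf.
- apply Hf.
Qed.

Lemma RInt_FTC (F f : R -> R) (a b : R) : a <= b -> cont f ->
  (forall s, a <= s <= b -> continuous F s) ->
  (forall s, a < s < b -> is_derive F s (f s)) -> RInt f a b = F b - F a.
Proof.
intros Hab Hf HF Hd.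
destruct (Req_dec a b) as [->|Hne].
{ rewrite RInt_point, Rminus_diag. reflexivity. }
pose (G := fun x => RInt f a x - F x).
assert (HI : forall x, is_derive (fun x => RInt f a x) x (f x)) by (intros x; now apply is_derive_RInt_cont).
destruct (MVT_gen G a b (fun _ => 0)) as [z [_ Hz]].
- intros x Hx. rewrite Rmin_left, Rmax_right in Hx by lra.
  unfold G. replace 0 with (f x - f x) by ring.
  apply (is_derive_minus (V:=R_NormedModule) (fun x => RInt f a x) F); [apply HI | now apply Hd].
- intros x Hx. rewrite Rmin_left, Rmax_right in Hx by lra.
  apply continuity_pt_filterlim. unfold G.
  apply (continuous_minus (V:=R_NormedModule) (fun x => RInt f a x) F); [|now apply HF].
  apply (ex_derive_continuous (fun x => RInt f a x)). eexists; apply HI.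
- unfold G in Hz. rewrite RInt_point in Hz. unfold zero in Hz; simpl in Hz. lra.
Qed.

Lemma cont_RInt (f : R -> R) (a : R) : cont f -> cont (fun x => RInt f a x).
Proof. intros H. apply (cont_derive _ f). intros s. now apply is_derive_RInt_cont. Qed.

Lemma RInt_le_cont (f g : R -> R) (a b : R) : a <= b -> cont f -> cont g ->
  (forall s, a < s < b -> f s <= g s) -> RInt f a b <= RInt g a b.
Proof. intros Hab Hf Hg H. apply RInt_le; auto; now apply cont_ex_RInt. Qed.

Lemma RInt_const_R (k a b : R) : RInt (fun _ => k) a b = (b - a) * k.
Proof. rewrite RInt_const. reflexivity. Qed.

Lemma RInt_abs_le (f : R -> R) (a b M : R) : cont f ->
  (forall s, Rmin a b <= s <= Rmax a b -> Rabs (f s) <= M) -> Rabs (RInt f a b) <= M * Rabs (b - a).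
Proof.
assert (K : forall a b, a <= b -> cont f -> (forall s, a <= s <= b -> Rabs (f s) <= M) ->
   Rabs (RInt f a b) <= M * Rabs (b - a)).
{ clear a b. intros a b Hab Hf HM. rewrite (Rabs_right (b - a)) by lra. apply Rabs_le_between.
  assert (H1 : RInt f a b <= RInt (fun _ => M) a b).
  { apply RInt_le_cont; auto using cont_const. intros s Hs. specialize (HM s ltac:(lra)).
    apply Rabs_le_between in HM; lra. }
  assert (H2 : RInt (fun _ => -M) a b <= RInt f a b).
  { apply RInt_le_cont; auto using cont_const. intros s Hs. specialize (HM s ltac:(lra)).
    apply Rabs_le_between in HM; lra. }
  rewrite RInt_const_R in H1, H2. lra. }
intros Hf HM. destruct (Rle_dec a b) as [Hab|Hab].
- apply K; auto. intros s Hs. apply HM. rewrite Rmin_left, Rmax_right; lra.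
- rewrite <- (opp_RInt_swap f b a) by (apply cont_ex_RInt; auto). unfold opp; simpl.
  rewrite Rabs_Ropp, Rabs_minus_sym. apply K; [lra|auto|].
  intros s Hs. apply HM. rewrite Rmin_right, Rmax_left; lra.
Qed.

Lemma RInt_plus_cont (f g : R -> R) (a b : R) : cont f -> cont g ->
  RInt (fun s => f s + g s) a b = RInt f a b + RInt g a b.
Proof. intros Hf Hg. apply (RInt_plus (V:=R_CompleteNormedModule) f g); now apply cont_ex_RInt. Qed.

Lemma RInt_minus_cont (f g : R -> R) (a b : R) : cont f -> cont g ->
  RInt (fun s => f s - g s) a b = RInt f a b - RInt g a b.
Proof. intros Hf Hg. apply (RInt_minus (V:=R_CompleteNormedModule) f g); now apply cont_ex_RInt. Qed.

Lemma RInt_scal_cont (k : R) (f : R -> R) (a b : R) : cont f ->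
  RInt (fun s => k * f s) a b = k * RInt f a b.
Proof. intros Hf. apply (RInt_scal (V:=R_CompleteNormedModule) f a b k); now apply cont_ex_RInt. Qed.

Lemma RInt_Chasles_cont (f : R -> R) (a b d : R) : cont f ->
  RInt f a b + RInt f b d = RInt f a d.
Proof. intros Hf. apply (RInt_Chasles (V:=R_CompleteNormedModule) f a b d); now apply cont_ex_RInt. Qed.

Lemma RInt_swap_cont (f : R -> R) (a b : R) : cont f -> RInt f b a = - RInt f a b.
Proof.
intros Hf. rewrite <- (opp_RInt_swap f a b) by (apply cont_ex_RInt; auto). reflexivity.
Qed.

Lemma RInt_nonneg_cont (f : R -> R) (a b : R) : a <= b -> cont f ->
  (forall s, a < s < b -> 0 <= f s) -> 0 <= RInt f a b.
Proof.
intros Hab Hf H. apply Rle_trans with (RInt (fun _ => 0) a b).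
- rewrite RInt_const_R, Rmult_0_r. apply Rle_refl.
- apply RInt_le_cont; auto using cont_const.
Qed.

(** * Improper integrals over the half-line *)

Definition is_int (f : R -> R) (l : R) : Prop :=
  forall eps, 0 < eps -> exists A, 0 <= A /\ forall B, A <= B -> Rabs (RInt f 0 B - l) < eps.

(** A total function, so that potentials are written without convergence proofs. Integer upper
    limits suffice: the value is meaningful where [is_int] holds, through [is_int_unique]. *)
Definition Int (f : R -> R) : R := real (Lim_seq (fun n => RInt f 0 (INR n))).

Lemma is_int_unique (f : R -> R) (l : R) : is_int f l -> Int f = l.
Proof.
intros H. unfold Int. rewrite (is_lim_seq_unique _ l); [reflexivity|].
apply is_lim_seq_spec. intros eps. destruct (H eps (cond_pos eps)) as [A [HA HB]].
exists (Z.to_nat (up A)). intros n Hn. apply HB.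
destruct (archimed A) as [H1 _].
apply Rle_trans with (INR (Z.to_nat (up A))); [|now apply le_INR].
rewrite INR_IZR_INZ, Z2Nat.id; [lra|]. apply le_IZR. lra.
Qed.

Lemma is_int_ext (f g : R -> R) (l : R) : (forall s, 0 < s -> f s = g s) -> is_int f l -> is_int g l.
Proof.
intros He H eps Hp. destruct (H eps Hp) as [A [HA HB]]. exists A. split; [exact HA|].
intros B HAB. rewrite <- (RInt_ext f g); [now apply HB|].
intros s. rewrite Rmin_left by lra. intros [Hs _]. now apply He.
Qed.

Lemma Int_ext (f g : R -> R) : (forall s, 0 < s -> f s = g s) -> Int f = Int g.
Proof.
intros He. unfold Int. f_equal. apply Lim_seq_ext. intros n. apply RInt_ext.
intros s. rewrite Rmin_left by apply pos_INR. intros [Hs _]. now apply He.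
Qed.

Lemma is_int_plus (f g : R -> R) (l l' : R) : cont f -> cont g ->
  is_int f l -> is_int g l' -> is_int (fun s => f s + g s) (l + l').
Proof.
intros Cf Cg Hf Hg eps He.
destruct (Hf (eps/2)) as [A [HA HA']]; [lra|]. destruct (Hg (eps/2)) as [B [HB HB']]; [lra|].
exists (Rmax A B). split; [apply Rle_trans with A; auto using Rmax_l|]. intros D HD.
rewrite RInt_plus_cont by auto.
specialize (HA' D (Rle_trans _ _ _ (Rmax_l _ _) HD)). specialize (HB' D (Rle_trans _ _ _ (Rmax_r _ _) HD)).
apply Rabs_def2 in HA'; apply Rabs_def2 in HB'. apply Rabs_def1; lra.
Qed.

Lemma is_int_scal (k : R) (f : R -> R) (l : R) : cont f -> is_int f l -> is_int (fun s => k * f s) (k * l).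
Proof.
intros Cf Hf eps He.
destruct (Hf (eps / (Rabs k + 1))) as [A [HA HA']].
{ apply Rdiv_lt_0_compat; auto. generalize (Rabs_pos k); lra. }
exists A. split; [exact HA|]. intros B HB. rewrite RInt_scal_cont by auto.
replace (k * RInt f 0 B - k * l) with (k * (RInt f 0 B - l)) by ring.
rewrite Rabs_mult. specialize (HA' B HB).
generalize (Rabs_pos k); intros Hk.
apply Rle_lt_trans with (Rabs k * (eps / (Rabs k + 1))).
- apply Rmult_le_compat_l; lra.
- apply Rmult_lt_reg_r with (Rabs k + 1); [lra|]. field_simplify; lra.
Qed.

Lemma is_int_minus (f g : R -> R) (l l' : R) : cont f -> cont g ->
  is_int f l -> is_int g l' -> is_int (fun s => f s - g s) (l - l').
Proof.
intros Cf Cg Hf Hg.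
apply (is_int_ext (fun s => f s + -1 * g s)); [intros; ring|].
replace (l - l') with (l + -1 * l') by ring.
apply is_int_plus; auto using cont_scal, is_int_scal.
Qed.

Lemma is_int_le (f g : R -> R) (l l' : R) : cont f -> cont g ->
  is_int f l -> is_int g l' -> (forall s, 0 < s -> f s <= g s) -> l <= l'.
Proof.
intros Cf Cg Hf Hg Hle. apply Rnot_lt_le. intros Hlt.
destruct (Hf ((l - l')/2)) as [A [HA HA']]; [lra|]. destruct (Hg ((l-l')/2)) as [B [HB HB']]; [lra|].
specialize (HA' (Rmax A B) (Rmax_l _ _)). specialize (HB' (Rmax A B) (Rmax_r _ _)).
assert (RInt f 0 (Rmax A B) <= RInt g 0 (Rmax A B)).
{ apply RInt_le_cont; auto.
  - apply Rle_trans with A; auto using Rmax_l.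
  - intros s Hs. apply Hle. lra. }
apply Rabs_def2 in HA'; apply Rabs_def2 in HB'. lra.
Qed.

Lemma is_int_nonneg_bounded (f : R -> R) (M : R) : cont f -> (forall s, 0 <= s -> 0 <= f s) ->
  (forall A, 0 <= A -> RInt f 0 A <= M) -> exists l, is_int f l.
Proof.
intros Cf Hp HM.
destruct (completeness (fun x => exists A, 0 <= A /\ x = RInt f 0 A)) as [l [Hub Hl]].
- exists M. intros x [A [HA ->]]. now apply HM.
- exists (RInt f 0 0), 0. split; [lra|reflexivity].
- exists l. intros eps He.
  assert (Hx : exists A, 0 <= A /\ l - eps < RInt f 0 A).
  { apply NNPP. intros Hn. assert (l <= l - eps); [|lra]. apply Hl. intros x [A [HA ->]].
    apply Rnot_lt_le. intros Hlt. apply Hn. now exists A. }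
  destruct Hx as [A [HA HAl]]. exists A. split; [exact HA|]. intros B HB.
  assert (RInt f 0 B <= l) by (apply Hub; exists B; split; [lra|reflexivity]).
  assert (RInt f 0 A <= RInt f 0 B).
  { rewrite <- (RInt_Chasles_cont f 0 A B) by auto.
    assert (0 <= RInt f A B); [|lra].
    apply RInt_nonneg_cont; auto. intros s Hs. apply Hp. lra. }
  apply Rabs_def1; lra.
Qed.

(** [phi + f] lies between 0 and [2 * phi], so its integrals increase to a limit; subtracting [phi]
    recovers f. *)
Lemma is_int_dom (f phi : R -> R) (L : R) : cont f -> cont phi ->
  (forall s, 0 < s -> Rabs (f s) <= phi s) -> is_int phi L ->
  is_int f (Int f) /\ Rabs (Int f) <= L.
Proof.
intros Cf Cp Hd Hp.
(* Continuity carries the bound to s = 0, where [is_int_nonneg_bounded] needs the sign as well. *)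
assert (Hd0 : forall s, 0 <= s -> Rabs (f s) <= phi s).
{ intros s [Hs|<-]; [now apply Hd|]. apply Rnot_lt_le. intros Hlt.
  pose (e := (Rabs (f 0) - phi 0)/2). assert (He : 0 < e) by (unfold e; lra).
  destruct (proj1 (continuous_eps f 0) (Cf 0) e He) as [d1 [Hd1 H1]].
  destruct (proj1 (continuous_eps phi 0) (Cp 0) e He) as [d2 [Hd2 H2]].
  pose (s := Rmin d1 d2 / 2).
  assert (Hs : 0 < s /\ s < d1 /\ s < d2).
  { unfold s. generalize (Rmin_l d1 d2) (Rmin_r d1 d2). assert (0 < Rmin d1 d2) by now apply Rmin_pos.
    lra. }
  specialize (H1 s). specialize (H2 s). rewrite Rminus_0_r, (Rabs_right s) in H1, H2 by lra.
  specialize (H1 ltac:(lra)). specialize (H2 ltac:(lra)). specialize (Hd s ltac:(lra)).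
  generalize (Rabs_triang_inv2 (f s) (f 0)). intros H3.
  apply Rabs_def2 in H2. unfold e in *.
  assert (Rabs (Rabs (f s) - Rabs (f 0)) < (Rabs (f 0) - phi 0) / 2) by lra.
  apply Rabs_def2 in H. lra. }
assert (Hphi : forall s, 0 <= s -> 0 <= phi s).
{ intros s Hs. apply Rle_trans with (Rabs (f s)); auto using Rabs_pos. }
assert (Hmon : forall A B, 0 <= A <= B -> RInt phi 0 A <= RInt phi 0 B).
{ intros A B HAB. rewrite <- (RInt_Chasles_cont phi 0 A B) by auto.
  assert (0 <= RInt phi A B); [|lra].
  apply RInt_nonneg_cont; auto; [lra|]. intros s Hs. apply Hphi. lra. }
assert (HL : forall A, 0 <= A -> RInt phi 0 A <= L).
{ intros A HA. apply Rnot_lt_le. intros Hlt.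
  destruct (Hp (RInt phi 0 A - L)) as [B [HB HB']]; [lra|].
  specialize (HB' (Rmax A B) (Rmax_r _ _)). specialize (Hmon A (Rmax A B) (conj HA (Rmax_l _ _))).
  apply Rabs_def2 in HB'. lra. }
destruct (is_int_nonneg_bounded (fun s => phi s + f s) (2 * L)) as [l Hl].
- now apply cont_plus.
- intros s Hs. specialize (Hd0 s Hs). apply Rabs_le_between in Hd0. lra.
- intros A HA. rewrite RInt_plus_cont by auto.
  assert (RInt f 0 A <= RInt phi 0 A).
  { apply RInt_le_cont; auto. intros s Hs. specialize (Hd s ltac:(lra)). apply Rabs_le_between in Hd. lra. }
  specialize (HL A HA). lra.
- assert (Hf : is_int f (l - L)).
  { apply (is_int_ext (fun s => (phi s + f s) - phi s)); [intros; ring|].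
    apply is_int_minus; auto. now apply cont_plus. }
  rewrite (is_int_unique _ _ Hf). split; [exact Hf|]. apply Rabs_le_between. split.
  + apply (is_int_le (fun s => -1 * phi s) f); auto using cont_scal.
    * replace (-L) with (-1 * L) by ring. now apply is_int_scal.
    * intros s Hs. specialize (Hd s Hs). apply Rabs_le_between in Hd. lra.
  + apply (is_int_le f phi); auto.
    intros s Hs. specialize (Hd s Hs). apply Rabs_le_between in Hd. lra.
Qed.

Lemma is_int_FTC (F f : R -> R) (L : R) : cont f -> (forall s, 0 <= s -> continuous F s) ->
  (forall s, 0 < s -> is_derive F s (f s)) ->
  (forall eps, 0 < eps -> exists A, 0 <= A /\ forall B, A <= B -> Rabs (F B - L) < eps) ->
  is_int f (L - F 0).
Proof.
intros Cf CF HF HL eps He. destruct (HL eps He) as [A [HA HB]]. exists A. split; [exact HA|].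
intros B HAB. rewrite (RInt_FTC F f 0 B); auto; try lra.
- replace (F B - F 0 - (L - F 0)) with (F B - L) by ring. now apply HB.
- intros s Hs. apply CF; lra.
- intros s Hs. apply HF; lra.
Qed.

Lemma exp_neg_small (k mu : R) : 0 < mu -> forall eps, 0 < eps ->
  exists A, 0 <= A /\ forall B, A <= B -> Rabs (k * exp (- mu * B)) < eps.
Proof.
intros Hmu eps He. exists (Rabs k / (mu * eps)). 
assert (Hme : 0 < mu * eps) by now apply Rmult_lt_0_compat.
generalize (Rabs_pos k); intros Hk.
split; [apply Rdiv_le_0_compat; auto|].
intros B HB. rewrite Rabs_mult, (Rabs_right (exp _)) by (apply Rle_ge, Rlt_le, exp_pos).
replace (- mu * B) with (- (mu * B)) by ring. rewrite exp_Ropp.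
assert (H1 : 1 + mu * B <= exp (mu * B)) by (apply exp_ineq1_le).
assert (H2 : Rabs k <= mu * B * eps).
{ apply Rmult_le_compat_r with (r := mu * eps) in HB; [|lra].
  unfold Rdiv in HB. rewrite Rmult_assoc, Rinv_l in HB by lra. lra. }
generalize (exp_pos (mu * B)); intros Hex.
apply Rmult_lt_reg_r with (exp (mu * B)); [exact Hex|].
rewrite Rmult_assoc, Rinv_l by lra. nra.
Qed.

Lemma is_int_exp (k mu : R) : 0 < mu -> is_int (fun s => k * exp (- mu * s)) (k / mu).
Proof.
intros Hmu.
replace (k / mu) with (0 - (- (k / mu) * exp (- mu * 0))) by (rewrite Rmult_0_r, exp_0; ring).
apply (is_int_FTC (fun s => - (k / mu) * exp (- mu * s))).
- apply cont_scal, cont_exp_scal.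
- intros s _. apply (cont_scal _ _ (cont_exp_scal (- mu))).
- intros s _. auto_derive; [auto|field; lra].
- intros eps He. destruct (exp_neg_small (- (k / mu)) mu Hmu eps He) as [A [HA HB]].
  exists A. split; [exact HA|]. intros B HAB. rewrite Rminus_0_r. now apply HB.
Qed.

(** * The hitting-time kernel *)

Definition gauss (v : R) : R := exp (- (v * v)).
Definition erf0 (z : R) : R := RInt gauss 0 z.
Definition gauss_mass : R := Int gauss.

Lemma cont_gauss : cont gauss.
Proof.
apply (cont_derive _ (fun v => - (2 * v) * exp (- (v * v)))). intros s. unfold gauss.
auto_derive; [auto|ring].
Qed.

Lemma is_int_gauss : is_int gauss gauss_mass.
Proof.
apply (is_int_dom gauss (fun v => exp 1 * exp (-1 * v)) (exp 1 / 1)).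
- apply cont_gauss.
- apply cont_scal, cont_exp_scal.
- intros s _. unfold gauss. rewrite Rabs_right by (apply Rle_ge, Rlt_le, exp_pos).
  rewrite <- exp_plus. destruct (Req_dec (- (s * s)) (1 + -1 * s)) as [->|Hn]; [lra|].
  apply Rlt_le, exp_increasing. nra.
- apply (is_int_exp (exp 1) 1). lra.
Qed.

Lemma erf0_opp (z : R) : erf0 (- z) = - erf0 z.
Proof.
unfold erf0.
assert (H : forall x, is_derive (fun x => RInt gauss 0 (- x) + RInt gauss 0 x) x 0).
{ intros x. eapply is_derive_R_eq.
  - apply (is_derive_R_plus (fun x => RInt gauss 0 (- x)) (fun x => RInt gauss 0 x)).
    + apply (is_derive_R_comp (fun y => RInt gauss 0 y) (fun x => - x) x (gauss (- x)) (-1)).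
      * apply is_derive_RInt_cont, cont_gauss.
      * auto_derive; [auto|ring].
    + apply is_derive_RInt_cont, cont_gauss.
  - unfold gauss. replace (- x * - x) with (x * x) by ring. ring. }
assert (E : RInt gauss 0 (- z) + RInt gauss 0 z = RInt gauss 0 (- 0) + RInt gauss 0 0).
{ destruct (MVT_gen (fun x => RInt gauss 0 (- x) + RInt gauss 0 x) 0 z (fun _ => 0)) as [w [_ Hw]].
  - intros x _. apply H.
  - intros x _. apply continuity_pt_filterlim.
    apply (ex_derive_continuous (fun x => RInt gauss 0 (- x) + RInt gauss 0 x)). eexists; apply H.
  - lra. }
rewrite Ropp_0, RInt_point in E. unfold zero in E; simpl in E. lra.
Qed.

Lemma gauss_mass_pos : 0 < gauss_mass.
Proof.
assert (H1 : 0 < RInt gauss 0 1).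
{ apply RInt_gt_0; [lra| |]; intros; [apply exp_pos|apply cont_gauss]. }
apply Rlt_le_trans with (1 := H1). apply Rnot_lt_le. intros Hlt.
destruct (is_int_gauss (RInt gauss 0 1 - gauss_mass)) as [A [HA HB]]; [lra|].
specialize (HB (Rmax A 1) (Rmax_l _ _)).
rewrite <- (RInt_Chasles_cont gauss 0 1 (Rmax A 1)) in HB by apply cont_gauss.
assert (0 <= RInt gauss 1 (Rmax A 1)).
{ apply RInt_nonneg_cont; [apply Rmax_r|apply cont_gauss|]. intros; apply Rlt_le, exp_pos. }
rabs_lra.
Qed.

Lemma exp_INR_mult (n : nat) (z : R) : exp (INR n * z) = exp z ^ n.
Proof.
induction n as [|n IH].
- simpl. now rewrite Rmult_0_l, exp_0.
- rewrite S_INR. replace ((INR n + 1) * z) with (z + INR n * z) by ring.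
  rewrite exp_plus, IH. reflexivity.
Qed.

(** For k > 0 the product is the k-th power of y e^{-(d/k) y}, and y e^{-m y} <= 1/m because 1 + m y
    <= e^{m y}. *)
Lemma pow_exp_bounded (d : R) (k : nat) : 0 < d ->
  exists C, 0 < C /\ forall y, 0 <= y -> y ^ k * exp (- d * y) <= C.
Proof.
intros Hd.
assert (B : forall m, 0 < m -> forall y, 0 <= y -> 0 <= y * exp (- m * y) <= / m).
{ intros m Hm y Hy. split; [apply Rmult_le_pos; auto; apply Rlt_le, exp_pos|].
  replace (- m * y) with (- (m * y)) by ring. rewrite exp_Ropp.
  generalize (exp_ineq1_le (m * y)) (exp_pos (m * y)); intros H1 H2.
  apply Rmult_le_reg_r with (m * exp (m * y)); [apply Rmult_lt_0_compat; lra|].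
  field_simplify; lra. }
destruct k as [|k].
{ exists 1. split; [lra|]. intros y Hy. simpl. rewrite Rmult_1_l.
  rewrite <- exp_0. destruct Hy as [Hy|<-]; [|rewrite Rmult_0_r; lra].
  apply Rlt_le, exp_increasing. nra. }
assert (Hk : 0 < INR (S k)) by (apply lt_0_INR; lia).
exists ((/ (d / INR (S k))) ^ (S k)).
assert (Hdk : 0 < d / INR (S k)) by now apply Rdiv_lt_0_compat.
split; [apply pow_lt, Rinv_0_lt_compat, Hdk|]. intros y Hy.
replace (y ^ S k * exp (- d * y)) with ((y * exp (- (d / INR (S k)) * y)) ^ S k).
- apply pow_incr. now apply B.
- rewrite Rpow_mult_distr. f_equal. rewrite <- exp_INR_mult. f_equal. field. lra.
Qed.

Section Kernel.
Context (c : R) (Hc : 0 < c).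

(* For P = x this is the density at time s of the first hitting time of 0 by x - c s + sqrt 2 B_s;
   [gauss_mass] stands for sqrt pi / 2, whose value is never needed. *)
Definition kern (P : R -> R) (x s : R) : R :=
  if Rle_dec s 0 then 0
  else / (4 * gauss_mass) * / (s * sqrt s) * exp (- ((x - c * s) * (x - c * s)) / (4 * s)) * P s.

(* [- kw] is the logarithmic x-derivative of the Gaussian factor, so that differentiating [kern P]
   in x replaces P by P' - kw P. *)
Definition kw (x s : R) : R := (x / s - c) / 2.
Definition K0 (x : R) : R -> R := kern (fun _ => x) x.
Definition K1 (x : R) : R -> R := kern (fun s => 1 - x * kw x s) x.
Definition K2 (x : R) : R -> R := kern (fun s => -3 * kw x s - c / 2 + x * (kw x s) ^ 2) x.
Definition K3 (x : R) : R -> R :=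
  kern (fun s => -3 / (2 * s) + 6 * (kw x s) ^ 2 + 3 / 2 * c * kw x s - x * (kw x s) ^ 3) x.

Lemma kern_pos_eq (P : R -> R) (x s : R) : 0 < s ->
  kern P x s = / (4 * gauss_mass) * / (s * sqrt s) * exp (- ((x - c * s) * (x - c * s)) / (4 * s)) * P s.
Proof. intros Hs. unfold kern. destruct (Rle_dec s 0); [lra|reflexivity]. Qed.

Lemma kern_exponent (x s : R) : 0 < s ->
  - ((x - c * s) * (x - c * s)) / (4 * s) = - (x * x / 4) * / s + c * x / 2 + - (c * c / 4) * s.
Proof. intros Hs. field. lra. Qed.

(** As x stays above d, the factor e^{-x^2/(4s)} absorbs any power of 1/s. Six powers are used: two
    for the prefactor s^{-3/2}, three for P, and one to gain the factor s, which later gives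
    continuity of the kernels at s = 0. *)
Lemma kern_bound (d X C : R) : 0 < d -> 0 <= C -> exists C', 0 < C' /\
  forall (P : R -> R) (x s : R), d <= x <= X -> 0 < s -> Rabs (P s) <= C * (1 + / s) ^ 3 ->
    Rabs (kern P x s) <= C' * s * exp (- (c * c / 4) * s).
Proof.
intros Hd HC.
destruct (pow_exp_bounded (d * d / 4) 6) as [C6 [HC6 H6]]; [nra|].
generalize gauss_mass_pos; intros HG.
exists (/ (4 * gauss_mass) * (C + 1) * (C6 * exp (d * d / 4)) * exp (c * Rabs X / 2)).
assert (HC' : 0 < / (4 * gauss_mass) * (C + 1) * (C6 * exp (d * d / 4)) * exp (c * Rabs X / 2)).
{ repeat apply Rmult_lt_0_compat; auto using exp_pos; try lra. apply Rinv_0_lt_compat; lra. }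
split; [exact HC'|].
intros P x s Hx Hs HP. rewrite kern_pos_eq, kern_exponent by auto.
assert (Hy : 0 < / s) by now apply Rinv_0_lt_compat.
set (y := / s) in *.
assert (Hsy : s * y = 1) by (unfold y; field; lra).
rewrite !exp_plus.
assert (Hsq : 0 < sqrt s) by now apply sqrt_lt_R0.
assert (Ha : / (s * sqrt s) <= (1 + y) ^ 2).
{ assert (Hss : sqrt s * sqrt s = s) by (apply sqrt_sqrt; lra).
  replace (/ (s * sqrt s)) with (sqrt s * y ^ 2).
  2:{ unfold y. rewrite <- Hss at 2 3. field. lra. }
  assert (sqrt s <= 1 + s) by nra.
  apply Rle_trans with ((1 + s) * y ^ 2).
  - apply Rmult_le_compat_r; nra.
  - replace ((1 + s) * y ^ 2) with (y ^ 2 + (s * y) * y) by ring. rewrite Hsy. nra. }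
assert (Ha0 : 0 < / (s * sqrt s)) by (apply Rinv_0_lt_compat; nra).
assert (He1 : exp (- (x * x / 4) * y) <= exp (d * d / 4) * exp (- (d * d / 4) * (1 + y))).
{ rewrite <- exp_plus. replace (d * d / 4 + - (d * d / 4) * (1 + y)) with (- (d * d / 4) * y) by ring.
  destruct (Req_dec (- (x * x / 4) * y) (- (d * d / 4) * y)) as [->|Hn]; [lra|].
  apply Rlt_le, exp_increasing. assert (d * d <= x * x) by nra. nra. }
assert (He2 : exp (c * x / 2) <= exp (c * Rabs X / 2)).
{ assert (x <= Rabs X) by (apply Rle_trans with X; [lra|apply Rle_abs]).
  destruct (Req_dec x (Rabs X)) as [<-|Hn]; [lra|]. apply Rlt_le, exp_increasing. nra. }
rewrite !Rabs_mult.
rewrite (Rabs_right (/ (4 * gauss_mass))) by (apply Rle_ge, Rlt_le, Rinv_0_lt_compat; lra).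
rewrite (Rabs_right (/ (s * sqrt s))) by lra.
rewrite !Rabs_exp.
set (E3 := exp (- (c * c / 4) * s)).
assert (HE3 : 0 < E3) by apply exp_pos.
assert (Hg : 0 < / (4 * gauss_mass)) by (apply Rinv_0_lt_compat; lra).
specialize (H6 (1 + y) ltac:(lra)).
set (e1 := exp (- (x * x / 4) * y)) in *. set (e2 := exp (c * x / 2)) in *.
set (f2 := exp (c * Rabs X / 2)) in *. set (f1 := exp (- (d * d / 4) * (1 + y))) in *.
set (f0 := exp (d * d / 4)) in *.
assert (0 < e1) by apply exp_pos. assert (0 < e2) by apply exp_pos.
assert (0 < f2) by apply exp_pos. assert (0 < f1) by apply exp_pos. assert (0 < f0) by apply exp_pos.
apply Rle_trans with (/ (4 * gauss_mass) * (1 + y) ^ 2 * ((f0 * f1) * f2 * E3) * (C * (1 + y) ^ 3)).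
- apply Rmult_le_compat; auto using Rabs_pos.
  + apply Rmult_le_pos; [apply Rmult_le_pos; lra|]. apply Rmult_le_pos; [|lra]. apply Rmult_le_pos; lra.
  + apply Rmult_le_compat.
    * apply Rmult_le_pos; lra.
    * apply Rmult_le_pos; [|lra]. apply Rmult_le_pos; lra.
    * apply Rmult_le_compat_l; lra.
    * apply Rmult_le_compat_r; [lra|]. apply Rmult_le_compat; lra.
- assert (H5 : (1 + y) ^ 5 * f1 <= C6 * s).
  { replace ((1 + y) ^ 5 * f1) with ((s * y) * ((1 + y) ^ 5 * f1)) by (rewrite Hsy; ring).
    rewrite Rmult_assoc, (Rmult_comm C6). apply Rmult_le_compat_l; [lra|].
    apply Rle_trans with (2 := H6). 
    replace ((1 + y) ^ 6 * f1) with ((1 + y) * ((1 + y) ^ 5 * f1)) by ring.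
    apply Rmult_le_compat_r; [|lra]. apply Rmult_le_pos; [apply pow_le; lra|lra]. }
  replace (/ (4 * gauss_mass) * (1 + y) ^ 2 * (f0 * f1 * f2 * E3) * (C * (1 + y) ^ 3))
    with ((/ (4 * gauss_mass) * f0 * f2 * E3) * C * ((1 + y) ^ 5 * f1)) by ring.
  replace (/ (4 * gauss_mass) * (C + 1) * (C6 * f0) * f2 * s * E3)
    with ((/ (4 * gauss_mass) * f0 * f2 * E3) * (C + 1) * (C6 * s)) by ring.
  assert (0 < / (4 * gauss_mass) * f0 * f2 * E3) by (repeat apply Rmult_lt_0_compat; auto).
  apply Rmult_le_compat; [apply Rmult_le_pos; lra | | apply Rmult_le_compat_l; lra | exact H5].
  apply Rmult_le_pos; [apply pow_le; lra|lra].
Qed.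

(** With M = 1 + |X| + c one has |kw| <= M (1 + 1/s), so every monomial of the four polynomials is
    at most M^4 (1 + 1/s)^3, and the factor 20 covers their coefficients. [K3] later serves as a
    remainder bound when [K1] is differentiated under the integral. *)
Lemma K_bounds (d X : R) : 0 < d -> exists C, 0 < C /\ forall x s, d <= x <= X -> 0 < s ->
  Rabs (K0 x s) <= C * s * exp (- (c * c / 4) * s) /\
  Rabs (K1 x s) <= C * s * exp (- (c * c / 4) * s) /\
  Rabs (K2 x s) <= C * s * exp (- (c * c / 4) * s) /\
  Rabs (K3 x s) <= C * s * exp (- (c * c / 4) * s).
Proof.
intros Hd.
pose (M := 1 + Rabs X + c).
assert (HM : 1 <= M /\ Rabs X <= M /\ c <= M) by (unfold M; generalize (Rabs_pos X); lra).
destruct (kern_bound d X (20 * M ^ 4)) as [C [HC H]]; [auto|apply Rmult_le_pos; [lra|apply pow_le; lra]|].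
exists C. split; [exact HC|]. intros x s Hx Hs.
assert (Hxa : 0 < x <= M) by (generalize (Rle_abs X); lra).
assert (Hy : 0 < / s) by now apply Rinv_0_lt_compat.
assert (Hw : Rabs (kw x s) <= M * (1 + / s)).
{ unfold kw. unfold Rdiv. set (y := / s) in *. apply Rabs_le_between. nra. }
set (w := Rabs (kw x s)) in *. set (v := 1 + / s) in *.
assert (Hv : 1 <= v) by (unfold v; lra).
assert (Hw0 : 0 <= w) by apply Rabs_pos.
assert (HMv : 1 <= M * v) by nra.
assert (P1 : w <= M * v) by exact Hw.
assert (P2 : w ^ 2 <= M ^ 2 * v ^ 2) by (rewrite <- Rpow_mult_distr; apply pow_incr; lra).
assert (P3 : w ^ 3 <= M ^ 3 * v ^ 3) by (rewrite <- Rpow_mult_distr; apply pow_incr; lra).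
assert (V2 : v <= v ^ 2) by nra. 
assert (V3 : v ^ 2 <= v ^ 3) by (simpl; nra).
assert (M2 : M <= M ^ 2) by nra. 
assert (M3 : M ^ 2 <= M ^ 3) by (simpl; nra).
assert (M4 : M ^ 3 <= M ^ 4) by (replace (M^4) with (M * M ^ 3) by ring; assert (0 < M ^3) by (apply pow_lt; lra); nra).
set (T := M ^ 4 * v ^ 3).
assert (Hv3 : 1 <= v ^ 3) by lra. assert (HM4 : 1 <= M ^ 4) by lra.
assert (T0 : M <= T) by (unfold T; nra).
assert (T1 : M * w <= T).
{ apply Rle_trans with (M * (M * v)); [apply Rmult_le_compat_l; lra|].
  replace (M * (M * v)) with (M ^ 2 * v) by ring. unfold T. apply Rmult_le_compat; nra. }
assert (T2 : M * w ^ 2 <= T).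
{ apply Rle_trans with (M * (M ^ 2 * v ^ 2)); [apply Rmult_le_compat_l; lra|].
  replace (M * (M ^ 2 * v ^ 2)) with (M ^ 3 * v ^ 2) by ring. unfold T. apply Rmult_le_compat; lra. }
assert (T3 : M * w ^ 3 <= T).
{ apply Rle_trans with (M * (M ^ 3 * v ^ 3)); [apply Rmult_le_compat_l; lra|]. unfold T. nra. }
assert (Ty : / s <= T) by (apply Rle_trans with (1 * v ^ 3); [unfold v in *; lra|unfold T; apply Rmult_le_compat_r; lra]).
assert (HT : 0 < T) by (unfold T; nra).
assert (X1 : x * w <= T) by (apply Rle_trans with (M * w); [apply Rmult_le_compat_r; lra|lra]).
assert (X2 : x * w ^ 2 <= T) by (apply Rle_trans with (M * w ^ 2); [apply Rmult_le_compat_r; [apply pow_le; lra|lra]|lra]).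
assert (X3 : x * w ^ 3 <= T) by (apply Rle_trans with (M * w ^ 3); [apply Rmult_le_compat_r; [apply pow_le; lra|lra]|lra]).
assert (W1 : w <= T) by (apply Rle_trans with (M * w); [nra|lra]).
assert (W1c : c * w <= T) by (apply Rle_trans with (M * w); [nra|lra]).
assert (W2 : w ^ 2 <= T) by (apply Rle_trans with (M * w ^ 2); [assert (0 <= w ^2) by (apply pow_le; lra); nra|lra]).
assert (AX : Rabs x = x) by (apply Rabs_right; lra).
assert (Ac : Rabs c = c) by (apply Rabs_right; lra).
replace (20 * M ^ 4 * v ^ 3) with (20 * T) in * by (unfold T; ring).
assert (HH : forall P : R -> R, Rabs (P s) <= 20 * T -> Rabs (kern P x s) <= C * s * exp (- (c * c / 4) * s)).
{ intros P HP. apply H; auto. fold v. replace (20 * M ^ 4 * v ^ 3) with (20 * T) by (unfold T; ring). exact HP. }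
assert (A1 : Rabs (x * kw x s) = x * w) by (rewrite Rabs_mult, AX; reflexivity).
assert (A2 : Rabs (x * kw x s ^ 2) = x * w ^ 2) by (rewrite Rabs_mult, AX, <- RPow_abs; reflexivity).
assert (A3 : Rabs (x * kw x s ^ 3) = x * w ^ 3) by (rewrite Rabs_mult, AX, <- RPow_abs; reflexivity).
assert (A4 : Rabs (kw x s ^ 2) = w ^ 2) by (rewrite <- RPow_abs; reflexivity).
assert (A5 : Rabs (c * kw x s) = c * w) by (rewrite Rabs_mult, Ac; reflexivity).
assert (Rle4 : forall a b, Rabs a <= b -> - b <= a <= b) by (intros a b; apply Rabs_le_between).
generalize (Rle4 _ _ (Req_le _ _ A1)) (Rle4 _ _ (Req_le _ _ A2)) (Rle4 _ _ (Req_le _ _ A3))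
  (Rle4 _ _ (Req_le _ _ A4)) (Rle4 _ _ (Req_le _ _ A5)) (Rle4 (kw x s) w (Rle_refl _)).
intros B1 B2 B3 B4 B5 B6.
repeat split; apply HH; apply Rabs_le_between; try lra.
replace (-3 / (2 * s)) with (- (3/2) * / s) by (field; lra). lra.
Qed.

(** The factor s in the bound joins the kernel continuously to its value 0 for s <= 0; elsewhere it
    is a differentiable expression. *)
Lemma kern_cont (P : R -> R) (x C : R) : 0 < x ->
  (forall s, 0 < s -> ex_derive P s) ->
  (forall s, 0 < s -> Rabs (kern P x s) <= C * s * exp (- (c * c / 4) * s)) ->
  cont (kern P x).
Proof.
intros Hx HP HC s.
destruct (Rtotal_order s 0) as [Hs|[->|Hs]].
- apply (continuous_ext_near (fun _ => 0) _ s (- s)); [lra| |apply continuous_const].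
  intros y Hy. apply Rabs_def2 in Hy. unfold kern. destruct (Rle_dec y 0); [reflexivity|lra].
- apply continuous_eps. intros eps He.
  assert (HC0 : 0 <= C).
  { specialize (HC 1 Rlt_0_1). generalize (Rabs_pos (kern P x 1)) (exp_pos (- (c * c / 4) * 1)). nra. }
  exists (eps / (C + 1)). split; [apply Rdiv_lt_0_compat; lra|]. intros y Hy. rewrite Rminus_0_r in Hy.
  unfold kern at 2. destruct (Rle_dec 0 0); [|lra]. rewrite Rminus_0_r.
  destruct (Rle_dec y 0) as [Hy0|Hy0].
  + unfold kern. destruct (Rle_dec y 0); [rewrite Rabs_R0; exact He|lra].
  + apply Rle_lt_trans with (1 := HC y ltac:(lra)).
    assert (exp (- (c * c / 4) * y) <= 1).
    { rewrite <- exp_0. apply Rlt_le, exp_increasing. assert (0 < c * c) by nra. nra. }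
    rewrite Rabs_right in Hy by lra.
    assert (C * y * exp (- (c * c / 4) * y) <= C * y).
    { rewrite <- (Rmult_1_r (C * y)) at 2. apply Rmult_le_compat_l; [nra|auto]. }
    apply Rle_lt_trans with ((C + 1) * y); [nra|].
    apply Rmult_lt_compat_l with (r := C + 1) in Hy; [|lra].
    replace ((C + 1) * (eps / (C + 1))) with eps in Hy by (field; lra). exact Hy.
- apply (continuous_ext_near (fun s => / (4 * gauss_mass) * / (s * sqrt s)
      * exp (- ((x - c * s) * (x - c * s)) / (4 * s)) * P s) _ s s); [lra| |].
  + intros y Hy. apply Rabs_def2 in Hy. now rewrite kern_pos_eq by lra.
  + apply (ex_derive_continuous (V:=R_NormedModule)).
    assert (0 < sqrt s) by now apply sqrt_lt_R0.
    apply ex_derive_mult; [|now apply HP].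
    auto_derive. repeat split; auto; nra.
Qed.

Lemma kern_nonneg (x s : R) : 0 <= x -> 0 <= K0 x s.
Proof.
intros Hx. unfold K0, kern. destruct (Rle_dec s 0); [lra|].
generalize gauss_mass_pos; intros.
assert (0 < sqrt s) by (apply sqrt_lt_R0; lra).
apply Rmult_le_pos; [|exact Hx]. apply Rmult_le_pos; [|apply Rlt_le, exp_pos].
apply Rmult_le_pos; apply Rlt_le, Rinv_0_lt_compat; nra.
Qed.

Lemma K0_at_0 (x : R) : K0 x 0 = 0.
Proof. unfold K0, kern. destruct (Rle_dec 0 0); [reflexivity|lra]. Qed.

Lemma K_cont (x : R) : 0 < x -> cont (K0 x) /\ cont (K1 x) /\ cont (K2 x).
Proof.
intros Hx. destruct (K_bounds x x Hx) as [C [HC H]].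
unfold K0, K1, K2, kw in *.
split; [|split]; apply (kern_cont _ x C Hx).
- intros s Hs. auto_derive. auto.
- intros s Hs. apply (H x s (conj (Rle_refl _) (Rle_refl _)) Hs).
- intros s Hs. auto_derive. lra.
- intros s Hs. apply (H x s (conj (Rle_refl _) (Rle_refl _)) Hs).
- intros s Hs. auto_derive. lra.
- intros s Hs. apply (H x s (conj (Rle_refl _) (Rle_refl _)) Hs).
Qed.

Lemma kern_derive_x (P : R -> R -> R) (x s p : R) : 0 < s -> is_derive (fun x => P x s) x p ->
  is_derive (fun x => kern (P x) x s) x (kern (fun s => p - kw x s * P x s) x s).
Proof.
intros Hs HP. unfold kern. destruct (Rle_dec s 0); [lra|].
set (a := / (4 * gauss_mass) * / (s * sqrt s)).
eapply is_derive_R_eq.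
- apply (is_derive_R_mult (fun x => a * exp (- ((x - c * s) * (x - c * s)) / (4 * s))) (fun x => P x s)); [|exact HP].
  apply (is_derive_R_scal a (fun x => exp (- ((x - c * s) * (x - c * s)) / (4 * s)))).
  apply (is_derive_R_comp exp (fun x => - ((x - c * s) * (x - c * s)) / (4 * s)) x (exp (- ((x - c * s) * (x - c * s)) / (4 * s))) (- kw x s)).
  + apply is_derive_Reals, derivable_pt_lim_exp.
  + auto_derive; [auto|unfold kw; field; lra].
- ring.
Qed.

Lemma kern_ext (P Q : R -> R) (x s : R) : (0 < s -> P s = Q s) -> kern P x s = kern Q x s.
Proof. intros H. unfold kern. destruct (Rle_dec s 0); [reflexivity|]. rewrite H; [reflexivity|lra]. Qed.

Lemma K_derive_x (x s : R) : 0 < s ->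
  is_derive (fun x => K0 x s) x (K1 x s) /\ is_derive (fun x => K1 x s) x (K2 x s) /\
  is_derive (fun x => K2 x s) x (K3 x s).
Proof.
intros Hs. split; [|split].
- eapply is_derive_R_eq; [apply (kern_derive_x (fun x s => x) x s 1 Hs), is_derive_R_id|].
  apply kern_ext. intros _. ring.
- eapply is_derive_R_eq; [apply (kern_derive_x (fun x s => 1 - x * kw x s) x s (- kw x s - x / (2 * s)) Hs)|].
  + unfold kw. auto_derive; [lra|field; lra].
  + apply kern_ext. intros _. unfold kw. cbv beta. field. lra.
- eapply is_derive_R_eq; [apply (kern_derive_x (fun x s => -3 * kw x s - c / 2 + x * (kw x s) ^ 2) x s
    (-3 / (2 * s) + (kw x s) ^ 2 + x * kw x s / s) Hs)|].
  + unfold kw. auto_derive; [lra|field; lra].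
  + apply kern_ext. intros _. unfold kw. cbv beta. field. lra.
Qed.

Lemma K_derive_s (x s : R) : 0 < s -> is_derive (fun s => K0 x s) s (K2 x s - c * K1 x s).
Proof.
intros Hs.
assert (Hq : 0 < sqrt s) by now apply sqrt_lt_R0.
generalize gauss_mass_pos; intros HG.
apply (is_derive_ext_loc (fun s => / (4 * gauss_mass) * / (s * sqrt s) *
   exp (- ((x - c * s) * (x - c * s)) / (4 * s)) * x)).
- exists (mkposreal s Hs). intros y Hy. unfold K0.
  assert (Hy' : Rabs (y - s) < s) by exact Hy. apply Rabs_def2 in Hy'.
  now rewrite kern_pos_eq by lra.
- unfold K1, K2. rewrite !kern_pos_eq by auto. unfold kw.
  auto_derive; [repeat split; auto; nra|].
  set (E := exp (- ((x - c * s) * (x - c * s)) / (4 * s))).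
  replace (exp (- ((x + - (c * s)) * (x + - (c * s))) * / (4 * s))) with E by (unfold E; f_equal; field; lra).
  assert (Hs2 : sqrt s * sqrt s = s) by (apply sqrt_sqrt; lra).
  generalize dependent (sqrt s). intros r Hr Hs2.
  rewrite <- Hs2. field. lra.
Qed.

(** A Girsanov change of drift from c to c/2, by completing the square; 3c^2/16 is c^2/4 -
    (c/2)^2/4. *)
Lemma K0_shift_exp (x s : R) : 0 < s ->
  K0 x s * exp (3 * c * c / 16 * s) =
  exp (c * x / 4) * (/ (4 * gauss_mass) * / (s * sqrt s) * exp (- ((x - c / 2 * s) * (x - c / 2 * s)) / (4 * s)) * x).
Proof.
intros Hs. unfold K0. rewrite kern_pos_eq by auto.
set (a := / (4 * gauss_mass) * / (s * sqrt s)).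
transitivity (a * x * (exp (- ((x - c * s) * (x - c * s)) / (4 * s)) * exp (3 * c * c / 16 * s))); [ring|].
transitivity (a * x * (exp (c * x / 4) * exp (- ((x - c / 2 * s) * (x - c / 2 * s)) / (4 * s)))); [|ring].
rewrite <- !exp_plus. f_equal. f_equal. field. lra.
Qed.

(** Linear in x: started close to the boundary, the process rarely survives up to time d. This is
    the source of the boundary continuity of the potential. *)
Lemma K0_small_x (d x s : R) : 0 < d -> 0 < x -> d <= s ->
  K0 x s <= / (4 * gauss_mass) * / (d * sqrt d) * x * exp (c * x / 2) * exp (- (c * c / 4) * s).
Proof.
intros Hd Hx Hs. unfold K0. rewrite kern_pos_eq, kern_exponent by lra. rewrite !exp_plus.
generalize gauss_mass_pos; intros HG.
assert (Hg : 0 < / (4 * gauss_mass)) by (apply Rinv_0_lt_compat; lra).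
assert (Hqd : 0 < sqrt d) by now apply sqrt_lt_R0.
assert (Hq : sqrt d <= sqrt s) by (apply sqrt_le_1; lra).
assert (H1 : / (s * sqrt s) <= / (d * sqrt d)) by (apply Rinv_le_contravar; nra).
assert (H0 : 0 < / (s * sqrt s)) by (apply Rinv_0_lt_compat; nra).
assert (H2 : exp (- (x * x / 4) * / s) <= 1).
{ rewrite <- exp_0. apply Rlt_le, exp_increasing.
  assert (0 < / s) by (apply Rinv_0_lt_compat; lra). assert (0 < x * x) by nra. nra. }
set (e1 := exp (- (x * x / 4) * / s)) in *. set (e2 := exp (c * x / 2)). set (e3 := exp (- (c * c / 4) * s)).
assert (0 < e1) by apply exp_pos. assert (0 < e2) by apply exp_pos. assert (0 < e3) by apply exp_pos.
replace (/ (4 * gauss_mass) * / (s * sqrt s) * (e1 * e2 * e3) * x)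
  with ((/ (s * sqrt s) * e1) * (/ (4 * gauss_mass) * e2 * e3 * x)) by ring.
replace (/ (4 * gauss_mass) * / (d * sqrt d) * x * e2 * e3)
  with ((/ (d * sqrt d) * 1) * (/ (4 * gauss_mass) * e2 * e3 * x)) by ring.
apply Rmult_le_compat_r.
- repeat apply Rmult_le_pos; lra.
- apply Rmult_le_compat; lra.
Qed.

(** The inverse Gaussian distribution function, that is the probability of hitting 0 before time s;
    [erf0] divided by [gauss_mass] is the usual error function. *)
Definition hit_cdf (x s : R) : R :=
  if Rle_dec s 0 then 0 else
  ((erf0 ((c * s - x) / (2 * sqrt s)) + gauss_mass)
    + exp (c * x) * (gauss_mass - erf0 ((x + c * s) / (2 * sqrt s)))) / (2 * gauss_mass).

Lemma erf0_lim (eps : R) : 0 < eps -> exists A, 0 <= A /\ forall z, A <= z -> Rabs (erf0 z - gauss_mass) < eps.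
Proof. intros He. destruct (is_int_gauss eps He) as [A [HA HB]]. exists A. split; auto. Qed.

Lemma hit_cdf_derive (x s : R) : 0 < x -> 0 < s -> is_derive (hit_cdf x) s (K0 x s).
Proof.
intros Hx Hs.
assert (Hq : 0 < sqrt s) by now apply sqrt_lt_R0.
generalize gauss_mass_pos; intros HG.
assert (Hs2 : sqrt s * sqrt s = s) by (apply sqrt_sqrt; lra).
apply (is_derive_ext_loc (fun s => / (2 * gauss_mass) * ((erf0 ((c * s - x) / (2 * sqrt s)) + gauss_mass)
    + exp (c * x) * (gauss_mass - erf0 ((x + c * s) / (2 * sqrt s)))))).
- exists (mkposreal s Hs). intros y Hy.
  assert (Hy' : Rabs (y - s) < s) by exact Hy. apply Rabs_def2 in Hy'.
  unfold hit_cdf. destruct (Rle_dec y 0); [lra|]. eqR. field. lra.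
- eapply is_derive_R_eq.
  + apply is_derive_R_scal. apply is_derive_R_plus.
    * apply is_derive_R_plus; [|apply is_derive_R_const].
      apply (is_derive_R_comp erf0 (fun s => (c * s - x) / (2 * sqrt s)) s (gauss ((c * s - x) / (2 * sqrt s))) (c / (4 * sqrt s) + x / (4 * (s * sqrt s)))).
      -- apply is_derive_RInt_cont, cont_gauss.
      -- auto_derive; [repeat split; auto; nra|].
         generalize dependent (sqrt s). intros r Hr Hs2. rewrite <- Hs2. field. lra.
    * apply is_derive_R_scal. apply is_derive_R_minus; [apply is_derive_R_const|].
      apply (is_derive_R_comp erf0 (fun s => (x + c * s) / (2 * sqrt s)) s (gauss ((x + c * s) / (2 * sqrt s))) (c / (4 * sqrt s) - x / (4 * (s * sqrt s)))).
      -- apply is_derive_RInt_cont, cont_gauss.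
      -- auto_derive; [repeat split; auto; nra|].
         generalize dependent (sqrt s). intros r Hr Hs2. rewrite <- Hs2. field. lra.
  + unfold K0. rewrite kern_pos_eq by auto. unfold gauss.
    set (E := exp (- ((x - c * s) * (x - c * s)) / (4 * s))).
    replace (exp (- ((c * s - x) / (2 * sqrt s) * ((c * s - x) / (2 * sqrt s))))) with E.
    2:{ unfold E. f_equal. generalize dependent (sqrt s). intros r Hr Hs2. rewrite <- Hs2. field. lra. }
    assert (HE : exp (c * x) * exp (- ((x + c * s) / (2 * sqrt s) * ((x + c * s) / (2 * sqrt s)))) = E).
    { rewrite <- exp_plus. unfold E. f_equal. generalize dependent (sqrt s). intros r Hr Hs2. rewrite <- Hs2. field. lra. }
    set (F := exp (- ((x + c * s) / (2 * sqrt s) * ((x + c * s) / (2 * sqrt s))))) in *.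
    transitivity (/ (2 * gauss_mass) * (E * (c / (4 * sqrt s) + x / (4 * (s * sqrt s))) - (exp (c * x) * F) * (c / (4 * sqrt s) - x / (4 * (s * sqrt s))))); [ring|].
    rewrite HE. field. lra.
Qed.

(** The drift points towards 0, so the boundary is reached almost surely: as s grows both arguments
    of [erf0] tend to +oo, and as s -> 0 the first tends to -oo and the second to +oo. *)
Lemma is_int_K0 (x : R) : 0 < x -> is_int (K0 x) 1.
Proof.
intros Hx.
generalize gauss_mass_pos; intros HG.
assert (HF0 : hit_cdf x 0 = 0) by (unfold hit_cdf; destruct (Rle_dec 0 0); [reflexivity|lra]).
replace 1 with (1 - hit_cdf x 0) by (rewrite HF0; ring).
assert (Hest : forall eps, 0 < eps -> exists A, 0 <= A /\ forall z, A <= z ->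
   Rabs (erf0 z - gauss_mass) < eps /\ Rabs (erf0 (-z) + gauss_mass) < eps).
{ intros eps He. destruct (erf0_lim eps He) as [A [HA HB]]. exists A. split; [exact HA|]. intros z Hz.
  split; [now apply HB|]. rewrite erf0_opp. replace (- erf0 z + gauss_mass) with (-(erf0 z - gauss_mass)) by ring.
  rewrite Rabs_Ropp. now apply HB. }
apply (is_int_FTC (hit_cdf x)).
- apply (K_cont x Hx).
- intros s [Hs|<-]; [eapply is_derive_R_continuous; now apply hit_cdf_derive|].
  apply continuous_eps. intros eps He. rewrite HF0.
  pose (e := eps * (2 * gauss_mass) / (2 + exp (c * x))).
  generalize (exp_pos (c * x)); intros Hex.
  assert (Hee : 0 < e) by (unfold e; apply Rdiv_lt_0_compat; [nra|lra]).
  destruct (Hest e Hee) as [A [HA HB]].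
  (* The first entry gives c y < x/2, the second 4 (A + 1) sqrt y < x; together they push x - c y
     and x + c y, divided by 2 sqrt y, beyond A. *)
  exists (Rmin (x / (2 * c)) (x * x / (16 * ((A + 1) * (A + 1))))).
  split. { apply Rmin_pos; apply Rdiv_lt_0_compat; nra. }
  intros y Hy. rewrite Rminus_0_r in *. unfold hit_cdf. destruct (Rle_dec y 0); [now rewrite Rabs_R0|].
  rewrite Rabs_right in Hy by lra.
  assert (Hy1 : y < x / (2 * c)) by (apply Rlt_le_trans with (1 := Hy); apply Rmin_l).
  assert (Hy2 : y < x * x / (16 * ((A + 1) * (A + 1)))) by (apply Rlt_le_trans with (1 := Hy); apply Rmin_r).
  assert (Hcy : c * y < x / 2).
  { apply Rmult_lt_compat_l with (r := c) in Hy1; [|lra]. replace (c * (x / (2 * c))) with (x / 2) in Hy1 by (field; lra). lra. }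
  assert (Hq : 0 < sqrt y) by (apply sqrt_lt_R0; lra).
  assert (Hs2 : sqrt y * sqrt y = y) by (apply sqrt_sqrt; lra).
  assert (HqA : sqrt y * (4 * (A + 1)) < x).
  { apply Rsqr_incrst_0; [|nra|lra]. unfold Rsqr.
    replace (sqrt y * (4 * (A + 1)) * (sqrt y * (4 * (A + 1)))) with ((sqrt y * sqrt y) * (16 * ((A + 1) * (A + 1)))) by ring.
    rewrite Hs2. apply Rmult_lt_compat_r with (r := 16 * ((A + 1) * (A + 1))) in Hy2; [|nra].
    replace (x * x / (16 * ((A + 1) * (A + 1))) * (16 * ((A + 1) * (A + 1)))) with (x * x) in Hy2 by (field; nra). exact Hy2. }
  assert (Hz1 : A <= (x - c * y) / (2 * sqrt y)).
  { apply Rmult_le_reg_r with (2 * sqrt y); [lra|]. unfold Rdiv. rewrite Rmult_assoc, Rinv_l by lra. nra. }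
  assert (Hz2 : A <= (x + c * y) / (2 * sqrt y)).
  { apply Rmult_le_reg_r with (2 * sqrt y); [lra|]. unfold Rdiv. rewrite Rmult_assoc, Rinv_l by lra. nra. }
  destruct (HB _ Hz1) as [_ E1]. destruct (HB _ Hz2) as [E2 _].
  replace (- ((x - c * y) / (2 * sqrt y))) with ((c * y - x) / (2 * sqrt y)) in E1 by (field; lra).
  set (a := erf0 ((c * y - x) / (2 * sqrt y))) in *. set (b := erf0 ((x + c * y) / (2 * sqrt y))) in *.
  unfold Rdiv. rewrite Rabs_mult, (Rabs_right (/ (2 * gauss_mass))) by (apply Rle_ge, Rlt_le, Rinv_0_lt_compat; lra).
  apply Rmult_lt_reg_r with (2 * gauss_mass); [lra|]. rewrite Rmult_assoc, Rinv_l by lra. rewrite Rmult_1_r.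
  assert (Heq : e * (2 + exp (c * x)) = eps * (2 * gauss_mass)) by (unfold e; field; lra).
  apply Rabs_def2 in E1. apply Rabs_def2 in E2. rewrite <- Heq.
  apply Rabs_def1; nra.
- intros s Hs. now apply hit_cdf_derive.
- intros eps He. 
  pose (e := eps * (2 * gauss_mass) / (2 + exp (c * x))).
  generalize (exp_pos (c * x)); intros Hex.
  assert (Hee : 0 < e) by (unfold e; apply Rdiv_lt_0_compat; [nra|lra]).
  destruct (Hest e Hee) as [A [HA HB]].
  (* Beyond this time c y >= 2 x and c sqrt y > 4 (A + 1), so that c y - x >= c y / 2 exceeds 2 A
     sqrt y. *)
  exists (2 * x / c + 1 + (4 * (A + 1) / c) * (4 * (A + 1) / c)).
  assert (0 < x / c) by (apply Rdiv_lt_0_compat; lra).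
  split; [nra|]. intros y Hy.
  assert (Hy0 : 0 < y) by nra.
  unfold hit_cdf. destruct (Rle_dec y 0); [lra|].
  assert (Hq : 0 < sqrt y) by (apply sqrt_lt_R0; lra).
  assert (Hs2 : sqrt y * sqrt y = y) by (apply sqrt_sqrt; lra).
  assert (HA4 : 0 < 4 * (A + 1) / c) by (apply Rdiv_lt_0_compat; lra).
  assert (HqA : 4 * (A + 1) / c < sqrt y).
  { apply Rsqr_incrst_0; [|lra|lra]. unfold Rsqr. rewrite Hs2. nra. }
  assert (HqA' : 4 * (A + 1) < c * sqrt y).
  { apply Rmult_lt_compat_l with (r := c) in HqA; [|lra].
    replace (c * (4 * (A + 1) / c)) with (4 * (A + 1)) in HqA by (field; lra). exact HqA. }
  assert (Hcy : 2 * x <= c * y).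
  { apply Rle_trans with (c * (2 * x / c)); [right; field; lra|]. apply Rmult_le_compat_l; nra. }
  assert (Hz1 : A <= (c * y - x) / (2 * sqrt y)).
  { apply Rmult_le_reg_r with (2 * sqrt y); [lra|]. unfold Rdiv. rewrite Rmult_assoc, Rinv_l by lra. nra. }
  assert (Hz2 : A <= (x + c * y) / (2 * sqrt y)).
  { apply Rmult_le_reg_r with (2 * sqrt y); [lra|]. unfold Rdiv. rewrite Rmult_assoc, Rinv_l by lra. nra. }
  destruct (HB _ Hz1) as [E1 _]. destruct (HB _ Hz2) as [E2 _].
  set (a := erf0 ((c * y - x) / (2 * sqrt y))) in *. set (b := erf0 ((x + c * y) / (2 * sqrt y))) in *.
  replace ((a + gauss_mass + exp (c * x) * (gauss_mass - b)) / (2 * gauss_mass) - 1)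
    with (((a - gauss_mass) + exp (c * x) * (gauss_mass - b)) * / (2 * gauss_mass)) by (field; lra).
  rewrite Rabs_mult, (Rabs_right (/ (2 * gauss_mass))) by (apply Rle_ge, Rlt_le, Rinv_0_lt_compat; lra).
  apply Rmult_lt_reg_r with (2 * gauss_mass); [lra|]. rewrite Rmult_assoc, Rinv_l by lra. rewrite Rmult_1_r.
  assert (Heq : e * (2 + exp (c * x)) = eps * (2 * gauss_mass)) by (unfold e; field; lra).
  apply Rabs_def2 in E1. apply Rabs_def2 in E2. rewrite <- Heq.
  apply Rabs_def1; nra.
Qed.
End Kernel.

Lemma K0_exp (c x s : R) : 0 < s ->
  K0 c x s * exp (3 * c * c / 16 * s) = exp (c * x / 4) * K0 (c / 2) x s.
Proof. intros Hs. rewrite K0_shift_exp by auto. unfold K0. now rewrite kern_pos_eq. Qed.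

(** * Potentials of the boundary flux *)

Opaque K0 K1 K2 K3.

Definition bdd (B : R) (g : R -> R) : Prop := cont g /\ forall t, Rabs (g t) <= B.

Lemma bdd_pos (B : R) (g : R -> R) : bdd B g -> 0 <= B.
Proof. intros [_ H]. apply Rle_trans with (2 := H 0). apply Rabs_pos. Qed.

Lemma bdd_minus (B B' : R) (g g' : R -> R) : bdd B g -> bdd B' g' -> bdd (B + B') (fun t => g t - g' t).
Proof.
intros [C H] [C' H']. split; [now apply cont_minus|]. intros t.
apply Rle_trans with (Rabs (g t) + Rabs (g' t)); [|specialize (H t); specialize (H' t); lra].
unfold Rminus. rewrite <- (Rabs_Ropp (g' t)). apply Rabs_triang.
Qed.

Lemma bdd_const (k : R) : bdd (Rabs k) (fun _ => k).
Proof. split; [apply cont_const|intros; lra]. Qed.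

Lemma cont_shift_add (g : R -> R) (h : R) : cont g -> cont (fun t => g (t + h)).
Proof.
intros H. apply (cont_comp (fun t => t + h) g); [|exact H].
apply (cont_derive _ (fun _ => 1)). intros s. auto_derive; [auto|ring].
Qed.

Section Potential.
Context (c : R) (Hc : 0 < c).

(* For this exponent K_c(x,s) e^{lam s} = e^{c x / 4} K_{c/2}(x,s), which has finite mass. *)
Definition lam : R := 3 * c * c / 16.

Lemma lam_pos : 0 < lam. Proof. unfold lam. nra. Qed.

(* The bounded solution of the Dirichlet problem on x > 0 with boundary data g; the value g t for x <= 0
   makes it continuous on the whole plane. *)
Definition q (g : R -> R) (x t : R) : R :=
  if Rle_dec x 0 then g t else Int (fun s => K0 c x s * g (t - s)).
Definition q1 (g : R -> R) (x t : R) : R := Int (fun s => K1 c x s * g (t - s)).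
Definition q2 (g : R -> R) (x t : R) : R := Int (fun s => K2 c x s * g (t - s)).

Lemma q_pos_eq (g : R -> R) (x t : R) : 0 < x -> q g x t = Int (fun s => K0 c x s * g (t - s)).
Proof. intros Hx. unfold q. destruct (Rle_dec x 0); [lra|reflexivity]. Qed.

Lemma q_0 (g : R -> R) (t : R) : q g 0 t = g t.
Proof. unfold q. destruct (Rle_dec 0 0); [reflexivity|lra]. Qed.

Lemma conv_dom (k g : R -> R) (t C mu Z : R) : cont k -> cont g -> 0 < mu ->
  (forall s, 0 < s -> Rabs (k s) * exp (lam * s) <= C * exp (- mu * s)) ->
  (forall s, 0 < s -> Rabs (g (t - s)) <= Z * exp (lam * s)) ->
  is_int (fun s => k s * g (t - s)) (Int (fun s => k s * g (t - s))) /\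
  Rabs (Int (fun s => k s * g (t - s))) <= Z * C / mu.
Proof.
intros Ck Cg Hmu Hk Hg.
apply (is_int_dom _ (fun s => (Z * C) * exp (- mu * s))).
- apply cont_mult; auto. now apply cont_shift.
- apply cont_scal, cont_exp_scal.
- intros s Hs. rewrite Rabs_mult. specialize (Hk s Hs). specialize (Hg s Hs).
  generalize (exp_pos (lam * s)) (Rabs_pos (k s)) (Rabs_pos (g (t - s))). intros E1 E2 E3.
  assert (HZ : 0 <= Z) by nra.
  apply Rle_trans with (Rabs (k s) * (Z * exp (lam * s))); [apply Rmult_le_compat_l; auto|].
  replace (Rabs (k s) * (Z * exp (lam * s))) with (Z * (Rabs (k s) * exp (lam * s))) by ring.
  rewrite Rmult_assoc. now apply Rmult_le_compat_l.
- now apply is_int_exp.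
Qed.

(** The decay rate c^2/4 exceeds [lam] by c^2/16; one half of this surplus absorbs the factor s, the
    other half remains. *)
Lemma K_weighted_bounds (d X : R) : 0 < d -> exists C, 0 < C /\ forall x s, d <= x <= X -> 0 < s ->
  Rabs (K0 c x s) * exp (lam * s) <= C * exp (- (c * c / 32) * s) /\
  Rabs (K1 c x s) * exp (lam * s) <= C * exp (- (c * c / 32) * s) /\
  Rabs (K2 c x s) * exp (lam * s) <= C * exp (- (c * c / 32) * s) /\
  Rabs (K3 c x s) * exp (lam * s) <= C * exp (- (c * c / 32) * s).
Proof.
intros Hd. destruct (K_bounds c Hc d X Hd) as [C [HC H]].
destruct (pow_exp_bounded (c * c / 32) 1) as [C1 [HC1 H1]]; [nra|].
exists (C * C1). split; [nra|]. intros x s Hx Hs. specialize (H x s Hx Hs).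
assert (G : forall v, v <= C * s * exp (- (c * c / 4) * s) ->
   v * exp (lam * s) <= C * C1 * exp (- (c * c / 32) * s)).
{ intros v Hv. generalize (exp_pos (lam * s)); intros He.
  apply Rle_trans with (C * s * exp (- (c * c / 4) * s) * exp (lam * s)).
  - apply Rmult_le_compat_r; lra.
  - rewrite Rmult_assoc, <- exp_plus.
    replace (- (c * c / 4) * s + lam * s) with (- (c * c / 32) * s + - (c * c / 32) * s) by (unfold lam; field).
    rewrite exp_plus. specialize (H1 s ltac:(lra)). rewrite pow_1 in H1.
    generalize (exp_pos (- (c * c / 32) * s)); intros He2.
    replace (C * s * (exp (- (c * c / 32) * s) * exp (- (c * c / 32) * s))) with
      (C * (s * exp (- (c * c / 32) * s)) * exp (- (c * c / 32) * s)) by ring.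
    apply Rmult_le_compat_r; [lra|]. apply Rmult_le_compat_l; lra. }
destruct H as [H0 [H2 [H3 H4]]]. repeat split; now apply G.
Qed.

Lemma c32 : 0 < c * c / 32. Proof. nra. Qed.

Lemma bdd_weight (B t : R) (g : R -> R) : bdd B g ->
  forall s, 0 < s -> Rabs (g (t - s)) <= B * exp (lam * s).
Proof.
intros Hg s Hs. generalize (bdd_pos _ _ Hg) (proj2 Hg (t - s)). intros HB H.
assert (1 <= exp (lam * s)) by (apply exp_ge_1; generalize lam_pos; nra). nra.
Qed.

Lemma q_int (B : R) (g : R -> R) (x t : R) : bdd B g -> 0 < x ->
  is_int (fun s => K0 c x s * g (t - s)) (q g x t) /\
  is_int (fun s => K1 c x s * g (t - s)) (q1 g x t) /\
  is_int (fun s => K2 c x s * g (t - s)) (q2 g x t).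
Proof.
intros Hg Hx. destruct (K_weighted_bounds x x Hx) as [C [HC H]].
rewrite q_pos_eq by auto. destruct (K_cont c Hc x Hx) as [C0 [C1 C2]].
repeat split; (eapply conv_dom with (C := C) (mu := c * c / 32) (Z := B);
 [auto|apply Hg|apply c32| |now apply bdd_weight]); intros s Hs; now apply (H x s).
Qed.

Lemma q0_int (B : R) (g : R -> R) (x t : R) : bdd B g -> 0 < x ->
  is_int (fun s => K0 c x s * g (t - s)) (q g x t).
Proof. intros Hg Hx. exact (proj1 (q_int B g x t Hg Hx)). Qed.

Lemma q1_int (B : R) (g : R -> R) (x t : R) : bdd B g -> 0 < x ->
  is_int (fun s => K1 c x s * g (t - s)) (q1 g x t).
Proof. intros Hg Hx. exact (proj1 (proj2 (q_int B g x t Hg Hx))). Qed.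

Lemma q2_int (B : R) (g : R -> R) (x t : R) : bdd B g -> 0 < x ->
  is_int (fun s => K2 c x s * g (t - s)) (q2 g x t).
Proof. intros Hg Hx. exact (proj2 (proj2 (q_int B g x t Hg Hx))). Qed.

(** By [K0_exp] the kernel times e^{lam s} has total mass exactly e^{c x / 4}. This factor is
    harmless against the weight e^{-c x} in which the mass is measured. *)
Lemma q_weighted (g : R -> R) (x t Z : R) : cont g -> 0 <= x ->
  (forall s, 0 <= s -> Rabs (g (t - s)) <= Z * exp (lam * s)) ->
  Rabs (q g x t) <= Z * exp (c * x / 4).
Proof.
intros Cg Hx Hg.
destruct Hx as [Hx|<-].
2:{ rewrite q_0. specialize (Hg 0 (Rle_refl 0)). rewrite Rminus_0_r, Rmult_0_r, exp_0 in Hg.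
    replace (c * 0 / 4) with 0 by field. now rewrite exp_0. }
rewrite q_pos_eq by auto.
assert (Hc2 : 0 < c / 2) by lra.
destruct (is_int_dom (fun s => K0 c x s * g (t - s)) (fun s => (Z * exp (c * x / 4)) * K0 (c / 2) x s) (Z * exp (c * x / 4) * 1)) as [_ H].
- apply cont_mult; [apply (K_cont c Hc x Hx)|now apply cont_shift].
- apply cont_scal, (K_cont (c / 2) Hc2 x Hx).
- intros s Hs. rewrite Rabs_mult, (Rabs_right (K0 c x s)) by (apply Rle_ge, kern_nonneg; lra).
  rewrite Rmult_assoc, <- K0_exp by auto. specialize (Hg s ltac:(lra)).
  generalize (kern_nonneg c x s ltac:(lra)); intros HK. fold lam.
  replace (Z * (K0 c x s * exp (lam * s))) with (K0 c x s * (Z * exp (lam * s))) by ring.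
  now apply Rmult_le_compat_l.
- apply is_int_scal; [apply (K_cont (c / 2) Hc2 x Hx)|now apply is_int_K0].
- rewrite Rmult_1_r in H. exact H.
Qed.

Lemma q12_weighted (d X : R) : 0 < d -> exists C, 0 < C /\ forall g x t Z, cont g -> d <= x <= X ->
  (forall s, 0 <= s -> Rabs (g (t - s)) <= Z * exp (lam * s)) ->
  Rabs (q1 g x t) <= C * Z /\ Rabs (q2 g x t) <= C * Z.
Proof.
intros Hd. destruct (K_weighted_bounds d X Hd) as [C [HC H]].
exists (C / (c * c / 32)). generalize c32; intros H32. split; [now apply Rdiv_lt_0_compat|].
intros g x t Z Cg Hx Hg. destruct (K_cont c Hc x) as [C0 [C1 C2]]; [lra|].
split; (replace (C / (c * c / 32) * Z) with (Z * C / (c * c / 32)) by (field; lra));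
 (eapply conv_dom; [auto|auto|exact H32| |]).
- intros s Hs; now apply (H x s).
- intros s Hs; apply Hg; lra.
- intros s Hs; now apply (H x s).
- intros s Hs; apply Hg; lra.
Qed.

Lemma q_minus (B B' : R) (g g' : R -> R) (x t : R) : bdd B g -> bdd B' g' ->
  q (fun t => g t - g' t) x t = q g x t - q g' x t.
Proof.
intros Hg Hg'. destruct (Rle_dec x 0) as [Hx|Hx].
- unfold q. destruct (Rle_dec x 0); [reflexivity|contradiction].
- assert (H0 : 0 < x) by lra. rewrite q_pos_eq by auto. apply is_int_unique.
  apply (is_int_ext (fun s => K0 c x s * g (t - s) - K0 c x s * g' (t - s))); [intros; ring|].
  apply is_int_minus; try (apply cont_mult; [apply (K_cont c Hc x H0)|apply cont_shift; (apply Hg || apply Hg')]).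
  + apply (q0_int B); auto.
  + apply (q0_int B'); auto.
Qed.

Lemma q1_minus (B B' : R) (g g' : R -> R) (x t : R) : 0 < x -> bdd B g -> bdd B' g' ->
  q1 (fun t => g t - g' t) x t = q1 g x t - q1 g' x t.
Proof.
intros H0 Hg Hg'. apply is_int_unique.
apply (is_int_ext (fun s => K1 c x s * g (t - s) - K1 c x s * g' (t - s))); [intros; ring|].
apply is_int_minus; try (apply cont_mult; [apply (K_cont c Hc x H0)|apply cont_shift; (apply Hg || apply Hg')]).
- apply (q1_int B); auto.
- apply (q1_int B'); auto.
Qed.

Lemma q_scal (B k : R) (g : R -> R) (x t : R) : bdd B g -> q (fun t => k * g t) x t = k * q g x t.
Proof.
intros Hg. destruct (Rle_dec x 0) as [Hx|Hx].
- unfold q. destruct (Rle_dec x 0); [reflexivity|contradiction].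
- assert (H0 : 0 < x) by lra. rewrite q_pos_eq by auto. apply is_int_unique.
  apply (is_int_ext (fun s => k * (K0 c x s * g (t - s)))); [intros; ring|].
  apply is_int_scal; [apply cont_mult; [apply (K_cont c Hc x H0)|apply cont_shift, Hg]|].
  apply (q0_int B); auto.
Qed.

Lemma q1_scal (B k : R) (g : R -> R) (x t : R) : 0 < x -> bdd B g ->
  q1 (fun t => k * g t) x t = k * q1 g x t.
Proof.
intros H0 Hg. apply is_int_unique.
apply (is_int_ext (fun s => k * (K1 c x s * g (t - s)))); [intros; ring|].
apply is_int_scal; [apply cont_mult; [apply (K_cont c Hc x H0)|apply cont_shift, Hg]|].
apply (q1_int B); auto.
Qed.

Lemma q_const (k x t : R) : q (fun _ => k) x t = k.
Proof.
destruct (Rle_dec x 0) as [Hx|Hx].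
- unfold q. destruct (Rle_dec x 0); [reflexivity|contradiction].
- rewrite q_pos_eq by lra. apply is_int_unique.
  apply (is_int_ext (fun s => k * K0 c x s)); [intros; ring|].
  assert (E : is_int (fun s => k * K0 c x s) (k * 1)).
  { apply is_int_scal; [apply K_cont; lra|apply is_int_K0; lra]. }
  rewrite Rmult_1_r in E. exact E.
Qed.

Lemma q_le (B B' : R) (g g' : R -> R) (x t : R) : bdd B g -> bdd B' g' ->
  (forall s, s <= t -> g s <= g' s) -> q g x t <= q g' x t.
Proof.
intros Hg Hg' Hle. destruct (Rle_dec x 0) as [Hx|Hx].
- unfold q. destruct (Rle_dec x 0); [apply Hle; lra|contradiction].
- assert (H0 : 0 < x) by lra.
  apply (is_int_le (fun s => K0 c x s * g (t - s)) (fun s => K0 c x s * g' (t - s)));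
   try (apply cont_mult; [apply (K_cont c Hc x H0)|apply cont_shift; (apply Hg || apply Hg')]).
  + apply (q0_int B); auto.
  + apply (q0_int B'); auto.
  + intros s Hs. apply Rmult_le_compat_l; [apply kern_nonneg; lra|apply Hle; lra].
Qed.

Lemma q_ge0 (B : R) (g : R -> R) (x t : R) : bdd B g -> (forall s, s <= t -> 0 <= g s) -> 0 <= q g x t.
Proof.
intros Hg H. rewrite <- (q_const 0 x t). apply (q_le (Rabs 0) B); auto using bdd_const.
Qed.

Lemma q_abs_le (B : R) (g : R -> R) (x t : R) : bdd B g -> Rabs (q g x t) <= B.
Proof.
intros Hg. apply Rabs_le_between. split.
- rewrite <- (q_const (- B) x t). apply (q_le (Rabs (- B)) B); auto using bdd_const.
  intros s _. destruct (proj1 (Rabs_le_between _ _) (proj2 Hg s)); lra.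
- rewrite <- (q_const B x t). apply (q_le B (Rabs B)); auto using bdd_const.
  intros s _. destruct (proj1 (Rabs_le_between _ _) (proj2 Hg s)); lra.
Qed.

Lemma q_past (g g' : R -> R) (x t : R) : (forall s, s <= t -> g s = g' s) -> q g x t = q g' x t.
Proof.
intros H. unfold q. destruct (Rle_dec x 0); [apply H; lra|].
apply Int_ext. intros s Hs. rewrite H; [reflexivity|lra].
Qed.

Lemma q_shift (g : R -> R) (h x t : R) : q (fun t => g (t + h)) x t = q g x (t + h).
Proof.
unfold q. destruct (Rle_dec x 0); [reflexivity|]. apply Int_ext. intros s _.
do 2 f_equal. ring.
Qed.

(** On a bounded piece of the past g is uniformly continuous; beyond it the weight e^{lam s} exceeds
    2 B / eta. In this form the time continuity of bounded data passes to all potentials. *)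
Lemma shift_small (B : R) (g : R -> R) (t eta : R) : bdd B g -> 0 < eta ->
  exists d, 0 < d /\ forall t', Rabs (t' - t) < d ->
    forall s, 0 <= s -> Rabs (g (t' - s) - g (t - s)) <= eta * exp (lam * s).
Proof.
intros Hg He. generalize (bdd_pos _ _ Hg) lam_pos. intros HB Hl.
destruct (exp_neg_small (2 * B) lam Hl eta He) as [S [HS HS']].
destruct (Heine_cor2 (f := g) (a := t - S - 1) (b := t + 1)) with (eps := mkposreal eta He) as [d Hd].
{ intros x _. apply continuity_pt_filterlim. apply Hg. }
exists (Rmin d 1). split; [apply Rmin_pos; [apply cond_pos|lra]|].
intros t' Ht' s Hs.
assert (H1 : Rabs (t' - t) < d) by (apply Rlt_le_trans with (1 := Ht'); apply Rmin_l).
assert (H2 : Rabs (t' - t) < 1) by (apply Rlt_le_trans with (1 := Ht'); apply Rmin_r).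
apply Rabs_def2 in H2.
destruct (Rle_dec s S) as [HsS|HsS].
- assert (Rabs (g (t' - s) - g (t - s)) < eta).
  { apply (Hd (t' - s) (t - s)); try lra. replace (t' - s - (t - s)) with (t' - t) by ring. exact H1. }
  assert (1 <= exp (lam * s)) by (apply exp_ge_1; nra). nra.
- specialize (HS' s ltac:(lra)).
  rewrite Rabs_mult, (Rabs_right (2 * B)), (Rabs_right (exp _)) in HS' by (try (apply Rle_ge, Rlt_le, exp_pos); lra).
  assert (E : exp (- lam * s) * exp (lam * s) = 1) by (rewrite <- exp_plus; replace (- lam * s + lam * s) with 0 by ring; apply exp_0).
  apply Rle_trans with (2 * B).
  + generalize (proj2 Hg (t' - s)) (proj2 Hg (t - s)). intros G1 G2.
    rabs_lra.
  + generalize (exp_pos (lam * s)). intros Ep. 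
    replace (2 * B) with (2 * B * exp (- lam * s) * exp (lam * s)) by (rewrite Rmult_assoc, E; ring).
    apply Rmult_le_compat_r; lra.
Qed.

Lemma taylor2 (f f1 f2 : R -> R) (x h M : R) :
  (forall y, Rmin x (x + h) <= y <= Rmax x (x + h) -> is_derive f y (f1 y)) ->
  (forall y, Rmin x (x + h) <= y <= Rmax x (x + h) -> is_derive f1 y (f2 y)) ->
  (forall y, Rmin x (x + h) <= y <= Rmax x (x + h) -> Rabs (f2 y) <= M) ->
  Rabs (f (x + h) - f x - h * f1 x) <= M * h ^ 2.
Proof.
intros H1 H2 HM.
destruct (MVT_gen f x (x + h) f1) as [z [Hz Hz']].
- intros y Hy. apply H1. lra.
- intros y Hy. apply continuity_pt_filterlim. eapply is_derive_R_continuous. now apply H1.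
- assert (Hin : forall y, Rmin x z <= y <= Rmax x z -> Rmin x (x + h) <= y <= Rmax x (x + h)).
  { intros y. unfold Rmin, Rmax in *. repeat destruct (Rle_dec _ _); lra. }
  destruct (MVT_gen f1 x z f2) as [w [Hw Hw']].
  + intros y Hy. apply H2, Hin. lra.
  + intros y Hy. apply continuity_pt_filterlim. eapply is_derive_R_continuous. now apply H2, Hin.
  + replace (f (x + h) - f x - h * f1 x) with (f2 w * (z - x) * h) by (rewrite Hz', <- Hw'; ring).
    rewrite !Rabs_mult. specialize (HM w (Hin w Hw)).
    assert (Hzx : Rabs (z - x) <= Rabs h).
    { unfold Rmin, Rmax in Hz. repeat destruct (Rle_dec _ _); unfold Rabs; repeat destruct (Rcase_abs _); lra. }
    rewrite <- (pow2_abs h). generalize (Rabs_pos (f2 w)) (Rabs_pos (z - x)) (Rabs_pos h). intros.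
    replace (M * Rabs h ^ 2) with (M * Rabs h * Rabs h) by ring.
    apply Rmult_le_compat_r; [auto|]. apply Rmult_le_compat; auto.
Qed.

Lemma is_derive_quadratic (f : R -> R) (x l M d : R) : 0 < d ->
  (forall h, Rabs h < d -> Rabs (f (x + h) - f x - h * l) <= M * h ^ 2) -> is_derive f x l.
Proof.
intros Hd H. apply is_derive_Reals. intros eps He.
assert (HM : 0 < Rabs M + 1) by (generalize (Rabs_pos M); lra).
assert (Hdd : 0 < Rmin d (eps / (Rabs M + 1))) by (apply Rmin_pos; auto; now apply Rdiv_lt_0_compat).
exists (mkposreal _ Hdd). intros h Hh0 Hh. simpl in Hh.
assert (H1 : Rabs h < d) by (apply Rlt_le_trans with (1 := Hh); apply Rmin_l).
assert (H2 : Rabs h < eps / (Rabs M + 1)) by (apply Rlt_le_trans with (1 := Hh); apply Rmin_r).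
specialize (H h H1).
replace ((f (x + h) - f x) / h - l) with ((f (x + h) - f x - h * l) / h) by (field; auto).
unfold Rdiv. rewrite Rabs_mult, Rabs_inv.
assert (Hha : 0 < Rabs h) by now apply Rabs_pos_lt.
apply Rmult_lt_reg_r with (Rabs h); [auto|]. rewrite Rmult_assoc, Rinv_l, Rmult_1_r by lra.
apply Rle_lt_trans with (1 := H). rewrite <- (pow2_abs h).
apply Rle_lt_trans with ((Rabs M + 1) * Rabs h * Rabs h).
- generalize (Rle_abs M). nra.
- apply Rmult_lt_compat_r; [auto|]. apply Rmult_lt_compat_l with (r := Rabs M + 1) in H2; [|lra].
  replace ((Rabs M + 1) * (eps / (Rabs M + 1))) with eps in H2 by (field; lra). exact H2.
Qed.

(** Differentiation under the integral sign by a second-order Taylor estimate: an integrable bound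
    on the second x-derivative controls the remainder by a multiple of h^2. *)
Lemma conv_derive (k0 k1 k2 : R -> R -> R) (g : R -> R) (B x t C mu d : R) : 0 < d -> 0 < mu -> bdd B g ->
  (forall y, Rabs (y - x) < d -> cont (k0 y)) -> cont (k1 x) ->
  (forall y s, Rabs (y - x) < d -> 0 < s -> is_derive (fun y => k0 y s) y (k1 y s)) ->
  (forall y s, Rabs (y - x) < d -> 0 < s -> is_derive (fun y => k1 y s) y (k2 y s)) ->
  (forall y s, Rabs (y - x) < d -> 0 < s -> Rabs (k2 y s) <= C * exp (- mu * s)) ->
  (forall y, Rabs (y - x) < d -> is_int (fun s => k0 y s * g (t - s)) (Int (fun s => k0 y s * g (t - s)))) ->
  is_int (fun s => k1 x s * g (t - s)) (Int (fun s => k1 x s * g (t - s))) ->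
  is_derive (fun y => Int (fun s => k0 y s * g (t - s))) x (Int (fun s => k1 x s * g (t - s))).
Proof.
intros Hd Hmu Hg C0 C1 D0 D1 B2 I0 I1.
generalize (bdd_pos _ _ Hg); intros HB.
apply (is_derive_quadratic _ _ _ (C * B / mu) d Hd). intros h Hh.
assert (Hxh : Rabs (x + h - x) < d) by (replace (x + h - x) with h by ring; exact Hh).
assert (Hxx : Rabs (x - x) < d) by (rewrite Rminus_diag, Rabs_R0; exact Hd).
assert (Hr : forall y, Rmin x (x + h) <= y <= Rmax x (x + h) -> Rabs (y - x) < d).
{ intros y Hy. apply Rabs_def2 in Hh. apply Rabs_def1;
  unfold Rmin, Rmax in Hy; destruct (Rle_dec x (x + h)); lra. }
assert (Cg : cont (fun s => g (t - s))) by apply cont_shift, Hg.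
assert (HI : is_int (fun s => (k0 (x + h) s * g (t - s) - k0 x s * g (t - s)) - h * (k1 x s * g (t - s)))
   (Int (fun s => k0 (x + h) s * g (t - s)) - Int (fun s => k0 x s * g (t - s)) - h * Int (fun s => k1 x s * g (t - s)))).
{ apply is_int_minus; [| | |apply is_int_scal; auto].
  - apply cont_minus; apply cont_mult; auto.
  - apply cont_scal, cont_mult; auto.
  - apply is_int_minus; auto; apply cont_mult; auto.
  - apply cont_mult; auto. }
rewrite <- (is_int_unique _ _ HI).
replace (C * B / mu * h ^ 2) with (h ^ 2 * C * B / mu) by (field; lra).
apply (is_int_dom _ (fun s => (h ^ 2 * C * B) * exp (- mu * s))).
- apply cont_minus; [apply cont_minus; apply cont_mult; auto|apply cont_scal, cont_mult; auto].
- apply cont_scal, cont_exp_scal.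
- intros s Hs.
  replace (k0 (x + h) s * g (t - s) - k0 x s * g (t - s) - h * (k1 x s * g (t - s)))
    with ((k0 (x + h) s - k0 x s - h * k1 x s) * g (t - s)) by ring.
  rewrite Rabs_mult.
  replace (h ^ 2 * C * B * exp (- mu * s)) with ((C * exp (- mu * s) * h ^ 2) * B) by ring.
  apply Rmult_le_compat; auto using Rabs_pos; [|apply Hg].
  apply (taylor2 (fun y => k0 y s) (fun y => k1 y s) (fun y => k2 y s)); auto.
- apply is_int_exp; auto.
Qed.

Lemma q_derive_x (B : R) (g : R -> R) (x t : R) : bdd B g -> 0 < x ->
  is_derive (fun x => q g x t) x (q1 g x t) /\ is_derive (fun x => q1 g x t) x (q2 g x t).
Proof.
intros Hg Hx.
destruct (K_weighted_bounds (x / 2) (2 * x)) as [C [HC H]]; [lra|].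
assert (Hb : forall y s, Rabs (y - x) < x / 2 -> 0 < s ->
   Rabs (K2 c y s) <= C * exp (- (c * c / 32) * s) /\ Rabs (K3 c y s) <= C * exp (- (c * c / 32) * s)).
{ intros y s Hy Hs. apply Rabs_def2 in Hy. destruct (H y s ltac:(lra) Hs) as [_ [_ [H2 H3]]].
  assert (1 <= exp (lam * s)) by (apply exp_ge_1; generalize lam_pos; nra).
  generalize (Rabs_pos (K2 c y s)) (Rabs_pos (K3 c y s)); intros. split; nra. }
split.
- apply (is_derive_ext_loc (fun y => Int (fun s => K0 c y s * g (t - s)))).
  + exists (mkposreal x Hx). intros y Hy. assert (Hy' : Rabs (y - x) < x) by exact Hy.
    apply Rabs_def2 in Hy'. now rewrite q_pos_eq by lra.
  + apply (conv_derive (K0 c) (K1 c) (K2 c) g B x t C (c * c / 32) (x / 2)); auto using c32; try lra.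
    * intros y Hy. apply Rabs_def2 in Hy. apply K_cont; lra.
    * apply K_cont; lra.
    * intros y s _ Hs. now apply K_derive_x.
    * intros y s _ Hs. now apply K_derive_x.
    * intros y s Hy Hs. now apply Hb.
    * intros y Hy. apply Rabs_def2 in Hy. rewrite <- q_pos_eq by lra. apply (q0_int B); auto; lra.
    * apply (q1_int B); auto.
- apply (conv_derive (K1 c) (K2 c) (K3 c) g B x t C (c * c / 32) (x / 2)); auto using c32; try lra.
  + intros y Hy. apply Rabs_def2 in Hy. apply K_cont; lra.
  + apply K_cont; lra.
  + intros y s _ Hs. now apply K_derive_x.
  + intros y s _ Hs. now apply K_derive_x.
  + intros y s Hy Hs. now apply Hb.
  + intros y Hy. apply Rabs_def2 in Hy. apply (q1_int B); auto; lra.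
  + apply (q2_int B); auto.
Qed.

(** Integration by parts in s, the kernel satisfying K_s = K_xx - c K_x. The boundary term at s = 0
    vanishes because [K0] does, the one at infinity by decay. *)
Lemma q_ibp (B : R) (g g' : R -> R) (x t : R) : 0 < x -> bdd B g -> bdd B g' ->
  (forall t, is_derive g t (g' t)) -> q g' x t = q2 g x t - c * q1 g x t.
Proof.
intros Hx Hg Hg' Hd.
destruct (q_int B g' x t Hg' Hx) as [I0 _]. destruct (q_int B g x t Hg Hx) as [_ [I1 I2]].
destruct (K_cont c Hc x Hx) as [C0 [C1 C2]].
assert (Cg : cont (fun s => g (t - s))) by apply cont_shift, Hg.
assert (Cg' : cont (fun s => g' (t - s))) by apply cont_shift, Hg'.
assert (J1 : is_int (fun s => (K2 c x s * g (t - s) - c * (K1 c x s * g (t - s))) - K0 c x s * g' (t - s))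
   ((q2 g x t - c * q1 g x t) - q g' x t)).
{ apply is_int_minus; auto.
  - apply cont_minus; [|apply cont_scal]; now apply cont_mult.
  - now apply cont_mult.
  - apply is_int_minus; auto; [now apply cont_mult|apply cont_scal; now apply cont_mult|].
    apply is_int_scal; auto. now apply cont_mult. }
assert (J2 : is_int (fun s => (K2 c x s * g (t - s) - c * (K1 c x s * g (t - s))) - K0 c x s * g' (t - s))
   (0 - K0 c x 0 * g (t - 0))).
{ apply (is_int_FTC (fun s => K0 c x s * g (t - s))).
  - apply cont_minus; [apply cont_minus; [|apply cont_scal]|]; now apply cont_mult.
  - intros s _. now apply cont_mult.
  - intros s Hs. eapply is_derive_R_eq.
    + apply (is_derive_R_mult (fun s => K0 c x s) (fun s => g (t - s))); [now apply K_derive_s|].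
      apply is_derive_R_shift, Hd.
    + ring.
  - intros eps He. destruct (K_weighted_bounds x x Hx) as [C [HC H]].
    destruct (exp_neg_small (C * B) (c * c / 32) c32 eps He) as [A [HA HA']].
    exists (A + 1). split; [lra|]. intros s Hs. specialize (HA' s ltac:(lra)).
    rewrite Rminus_0_r. apply Rle_lt_trans with (2 := HA'). rewrite Rabs_mult.
    generalize (bdd_pos _ _ Hg); intros HB.
    rewrite (Rabs_right (C * B * _)).
    2:{ apply Rle_ge, Rmult_le_pos; [nra|apply Rlt_le, exp_pos]. }
    replace (C * B * exp (- (c * c / 32) * s)) with (C * exp (- (c * c / 32) * s) * B) by ring.
    apply Rmult_le_compat; auto using Rabs_pos; [|apply Hg].
    destruct (H x s ltac:(lra) ltac:(lra)) as [H0 _].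
    assert (1 <= exp (lam * s)) by (apply exp_ge_1; generalize lam_pos; nra).
    generalize (Rabs_pos (K0 c x s)); nra. }
generalize (is_int_unique _ _ J1) (is_int_unique _ _ J2). intros E1 E2. rewrite E1 in E2.
rewrite K0_at_0 in E2. lra.
Qed.

(** By the mean value theorem the difference quotients of g converge to g' in the weighted sense of
    [shift_small], and [q_weighted] passes this to the potential. *)
Lemma q_derive_t (B B' : R) (g g' : R -> R) (x t : R) : 0 < x -> bdd B g -> bdd B' g' ->
  (forall t, is_derive g t (g' t)) -> is_derive (fun t => q g x t) t (q g' x t).
Proof.
intros Hx Hg Hg' Hd. apply is_derive_Reals. intros eps He.
generalize (exp_pos (c * x / 4)); intros Hex.
destruct (shift_small B' g' t (eps / 2 / exp (c * x / 4))) as [d [Hd0 Hs]]; auto.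
{ apply Rdiv_lt_0_compat; lra. }
exists (mkposreal d Hd0). intros h Hh0 Hh. simpl in Hh.
pose (phi := fun r => / h * (g (r + h) - g r) - g' r).
assert (Bsh : bdd B (fun r => g (r + h))).
{ split; [apply cont_shift_add, Hg|intros; apply Hg]. }
assert (Bdg : bdd (B + B) (fun r => g (r + h) - g r)) by now apply bdd_minus.
assert (Bsc : bdd (Rabs (/ h) * (B + B)) (fun r => / h * (g (r + h) - g r))).
{ split; [apply cont_scal, Bdg|]. intros r. rewrite Rabs_mult. apply Rmult_le_compat_l; [apply Rabs_pos|apply Bdg]. }
assert (E : q phi x t = (q g x (t + h) - q g x t) / h - q g' x t).
{ unfold phi. rewrite (q_minus _ _ _ _ x t Bsc Hg'), (q_scal _ (/ h) _ x t Bdg), (q_minus _ _ _ _ x t Bsh Hg), q_shift.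
  field. auto. }
rewrite <- E. apply Rle_lt_trans with (eps / 2 / exp (c * x / 4) * exp (c * x / 4)).
- apply q_weighted; [|lra|].
  + apply cont_minus; [apply Bsc|apply Hg'].
  + intros s Hs0. unfold phi.
    destruct (MVT_gen g (t - s) (t - s + h) g') as [z [Hz Hz']].
    * intros y _. apply Hd.
    * intros y _. apply continuity_pt_filterlim. eapply is_derive_R_continuous, Hd.
    * rewrite Hz'. replace (/ h * (g' z * (t - s + h - (t - s)))) with (g' z) by (field; auto).
      replace z with ((z + s) - s) by ring. apply Hs; auto.
      unfold Rmin, Rmax in Hz. apply Rabs_def2 in Hh. apply Rabs_def1; destruct (Rle_dec _ _); lra.
- unfold Rdiv at 1. rewrite Rmult_assoc, Rinv_l; lra.
Qed.

(** Hitting times below d/2 only see values of g close to [g t]; later ones have weight O(x) by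
    [K0_small_x]. *)
Lemma q_cont_0 (B : R) (g : R -> R) (t eps : R) : bdd B g -> 0 < eps -> exists d, 0 < d /\
  forall x t', x < d -> Rabs (t' - t) < d -> Rabs (q g x t' - g t) < eps.
Proof.
intros Hg He. generalize (bdd_pos _ _ Hg); intros HB.
destruct (proj1 (continuous_eps g t) (proj1 Hg t) (eps / 2)) as [d [Hd Hd']]; [lra|].
generalize gauss_mass_pos; intros HG.
assert (Hsq : 0 < sqrt (d / 2)) by (apply sqrt_lt_R0; lra).
pose (k := / (4 * gauss_mass) * / (d / 2 * sqrt (d / 2))).
assert (Hk : 0 < k).
{ apply Rmult_lt_0_compat; apply Rinv_0_lt_compat; [lra|nra]. }
pose (L := 2 * B * (k * exp (c / 2)) / (c * c / 4)).
assert (HL : 0 <= L). { unfold L. apply Rdiv_le_0_compat; [|nra]. generalize (exp_pos (c / 2)). intros; apply Rmult_le_pos; nra. }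
exists (Rmin (d / 2) (Rmin 1 (eps / 2 / (L + 1)))). split.
{ repeat apply Rmin_pos; try lra. apply Rdiv_lt_0_compat; lra. }
intros x t' Hx Ht'.
assert (Hx1 : x < 1) by (apply Rlt_le_trans with (1 := Hx); eapply Rle_trans; [apply Rmin_r|apply Rmin_l]).
assert (Hx2 : x < eps / 2 / (L + 1)) by (apply Rlt_le_trans with (1 := Hx); eapply Rle_trans; [apply Rmin_r|apply Rmin_r]).
assert (Ht : Rabs (t' - t) < d / 2) by (apply Rlt_le_trans with (1 := Ht'); apply Rmin_l).
apply Rabs_def2 in Ht.
destruct (Rle_dec x 0) as [Hx0|Hx0].
{ unfold q. destruct (Rle_dec x 0); [|contradiction]. apply Rlt_trans with (eps / 2); [|lra]. apply Hd'. apply Rabs_def1; lra. }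
assert (Hxp : 0 < x) by lra.
replace (q g x t' - g t) with (q (fun r => g r - g t) x t').
2:{ rewrite (q_minus B (Rabs (g t)) g (fun _ => g t)), q_const; auto using bdd_const. }
rewrite q_pos_eq by auto.
apply Rle_lt_trans with (eps / 2 * 1 + 2 * B * (k * x * exp (c * x / 2)) / (c * c / 4)).
- apply (is_int_dom _ (fun s => eps / 2 * K0 c x s + (2 * B * (k * x * exp (c * x / 2))) * exp (- (c * c / 4) * s))).
  + apply cont_mult; [now apply K_cont|]. apply (cont_shift (fun r => g r - g t)).
    apply cont_minus; [apply Hg|apply cont_const].
  + apply cont_plus; [apply cont_scal; now apply K_cont|apply cont_scal, cont_exp_scal].
  + intros s Hs. generalize (kern_nonneg c x s ltac:(lra)); intros HK.
    rewrite Rabs_mult, (Rabs_right (K0 c x s)) by lra.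
    assert (E0 : 0 <= 2 * B * (k * x * exp (c * x / 2)) * exp (- (c * c / 4) * s)).
    { apply Rmult_le_pos; [|apply Rlt_le, exp_pos]. apply Rmult_le_pos; [lra|].
      apply Rmult_le_pos; [nra|apply Rlt_le, exp_pos]. }
    destruct (Rlt_dec s (d / 2)) as [Hsd|Hsd].
    * assert (Rabs (g (t' - s) - g t) < eps / 2) by (apply Hd'; apply Rabs_def1; lra). nra.
    * assert (HKs := K0_small_x c (d / 2) x s ltac:(lra) Hxp ltac:(lra)). fold k in HKs.
      assert (Hg2 : Rabs (g (t' - s) - g t) <= 2 * B).
      { generalize (proj2 Hg (t' - s)) (proj2 Hg t). intros G1 G2.
        rabs_lra. }
      apply Rle_trans with (K0 c x s * (2 * B)); [apply Rmult_le_compat_l; auto|].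
      apply Rle_trans with (2 * B * (k * x * exp (c * x / 2)) * exp (- (c * c / 4) * s)).
      -- rewrite Rmult_comm, (Rmult_assoc (2 * B)). apply Rmult_le_compat_l; lra.
      -- nra.
  + apply is_int_plus; [apply cont_scal; now apply K_cont|apply cont_scal, cont_exp_scal| |].
    * apply is_int_scal; [now apply K_cont|now apply is_int_K0].
    * apply is_int_exp. nra.
- assert (exp (c * x / 2) <= exp (c / 2)) by (apply exp_le; nra).
  assert (2 * B * (k * x * exp (c * x / 2)) / (c * c / 4) <= L * x).
  { unfold L. replace (2 * B * (k * exp (c / 2)) / (c * c / 4) * x) with (2 * B * (k * x * exp (c / 2)) / (c * c / 4)) by (field; lra).
    unfold Rdiv. apply Rmult_le_compat_r; [apply Rlt_le, Rinv_0_lt_compat; nra|].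
    apply Rmult_le_compat_l; [lra|]. apply Rmult_le_compat_l; [nra|auto]. }
  assert ((L + 1) * x < eps / 2).
  { apply Rmult_lt_compat_l with (r := L + 1) in Hx2; [|lra].
    replace ((L + 1) * (eps / 2 / (L + 1))) with (eps / 2) in Hx2 by (field; lra). exact Hx2. }
  nra.
Qed.

Lemma q_cont (B : R) (g : R -> R) (x t eps : R) : bdd B g -> 0 < eps -> exists d, 0 < d /\
  forall x' t', Rabs (x' - x) < d -> Rabs (t' - t) < d -> Rabs (q g x' t' - q g x t) < eps.
Proof.
intros Hg He. destruct (Rtotal_order x 0) as [Hx|[->|Hx]].
- destruct (proj1 (continuous_eps g t) (proj1 Hg t) eps He) as [d [Hd Hd']].
  exists (Rmin d (- x)). split; [apply Rmin_pos; lra|]. intros x' t' Hx' Ht'.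
  assert (H1 : Rabs (x' - x) < - x) by (apply Rlt_le_trans with (1 := Hx'); apply Rmin_r).
  apply Rabs_def2 in H1. unfold q. destruct (Rle_dec x' 0); [|lra]. destruct (Rle_dec x 0); [|lra].
  apply Hd'. apply Rlt_le_trans with (1 := Ht'); apply Rmin_l.
- rewrite q_0. destruct (q_cont_0 B g t eps Hg He) as [d [Hd H]]. exists d. split; auto.
  intros x' t' Hx'. rewrite Rminus_0_r in Hx'. apply H. rabs_lra.
- generalize (exp_pos (c * (2 * x) / 4)); intros Hex.
  destruct (shift_small B g t (eps / 2 / exp (c * (2 * x) / 4))) as [d1 [Hd1 H1]]; auto.
  { apply Rdiv_lt_0_compat; lra. }
  destruct (proj1 (continuous_eps (fun x => q g x t) x)
     (is_derive_R_continuous _ _ _ (proj1 (q_derive_x B g x t Hg Hx))) (eps / 2)) as [d2 [Hd2 H2]]; [lra|].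
  exists (Rmin x (Rmin d1 d2)). split; [repeat apply Rmin_pos; auto|]. intros x' t' Hx' Ht'.
  assert (Hx1 : Rabs (x' - x) < x) by (apply Rlt_le_trans with (1 := Hx'); apply Rmin_l).
  assert (Hx2 : Rabs (x' - x) < d2) by (apply Rlt_le_trans with (1 := Hx'); eapply Rle_trans; [apply Rmin_r|apply Rmin_r]).
  assert (Ht1 : Rabs (t' - t) < d1) by (apply Rlt_le_trans with (1 := Ht'); eapply Rle_trans; [apply Rmin_r|apply Rmin_l]).
  specialize (H2 x' Hx2). simpl in H2. apply Rabs_def2 in Hx1.
  assert (H3 : Rabs (q g x' t' - q g x' t) <= eps / 2).
  { replace (q g x' t' - q g x' t) with (q (fun r => g (r + (t' - t)) - g r) x' t).
    2:{ rewrite (q_minus B B (fun r => g (r + (t' - t))) g); auto.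
        - rewrite q_shift. do 2 f_equal. ring.
        - split; [apply cont_shift_add, Hg|intros; apply Hg]. }
    apply Rle_trans with (eps / 2 / exp (c * (2 * x) / 4) * exp (c * x' / 4)).
    - apply q_weighted; [|lra|].
      + apply cont_minus; [apply cont_shift_add|]; apply Hg.
      + intros s Hs. replace (t - s + (t' - t)) with (t' - s) by ring. now apply H1.
    - assert (exp (c * x' / 4) <= exp (c * (2 * x) / 4)) by (apply exp_le; nra).
      apply Rle_trans with (eps / 2 / exp (c * (2 * x) / 4) * exp (c * (2 * x) / 4)).
      + apply Rmult_le_compat_l; [apply Rlt_le, Rdiv_lt_0_compat; lra|auto].
      + right. field. lra. }
  replace (q g x' t' - q g x t) with ((q g x' t' - q g x' t) + (q g x' t - q g x t)) by ring.
  apply Rle_lt_trans with (1 := Rabs_triang _ _). lra.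
Qed.

Lemma q1_cont (B : R) (g : R -> R) (x t eps : R) : bdd B g -> 0 < x -> 0 < eps -> exists d, 0 < d /\
  forall x' t', Rabs (x' - x) < d -> Rabs (t' - t) < d -> Rabs (q1 g x' t' - q1 g x t) < eps.
Proof.
intros Hg Hx He.
destruct (q12_weighted (x / 2) (2 * x)) as [C [HC HC']]; [lra|].
destruct (shift_small B g t (eps / 2 / C)) as [d1 [Hd1 H1]]; auto.
{ apply Rdiv_lt_0_compat; lra. }
destruct (proj1 (continuous_eps (fun x => q1 g x t) x)
   (is_derive_R_continuous _ _ _ (proj2 (q_derive_x B g x t Hg Hx))) (eps / 2)) as [d2 [Hd2 H2]]; [lra|].
exists (Rmin (x / 2) (Rmin d1 d2)). split; [repeat apply Rmin_pos; auto; lra|]. intros x' t' Hx' Ht'.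
assert (Hx1 : Rabs (x' - x) < x / 2) by (apply Rlt_le_trans with (1 := Hx'); apply Rmin_l).
assert (Hx2 : Rabs (x' - x) < d2) by (apply Rlt_le_trans with (1 := Hx'); eapply Rle_trans; [apply Rmin_r|apply Rmin_r]).
assert (Ht1 : Rabs (t' - t) < d1) by (apply Rlt_le_trans with (1 := Ht'); eapply Rle_trans; [apply Rmin_r|apply Rmin_l]).
specialize (H2 x' Hx2). simpl in H2. apply Rabs_def2 in Hx1.
assert (H3 : Rabs (q1 g x' t' - q1 g x' t) <= eps / 2).
{ replace (q1 g x' t' - q1 g x' t) with (q1 (fun r => g (r + (t' - t)) - g r) x' t).
  2:{ rewrite (q1_minus B B (fun r => g (r + (t' - t))) g); auto.
      - unfold q1 at 1 3. f_equal. apply Int_ext. intros s _. do 2 f_equal. ring.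
      - lra.
      - split; [apply cont_shift_add, Hg|intros; apply Hg]. }
  replace (eps / 2) with (C * (eps / 2 / C)) by (field; lra).
  refine (proj1 (HC' (fun r => g (r + (t' - t)) - g r) x' t (eps / 2 / C) _ _ _)); [|lra|].
  - apply cont_minus; [apply cont_shift_add|]; apply Hg.
  - intros s Hs. replace (t - s + (t' - t)) with (t' - s) by ring. now apply H1. }
replace (q1 g x' t' - q1 g x t) with ((q1 g x' t' - q1 g x' t) + (q1 g x' t - q1 g x t)) by ring.
apply Rle_lt_trans with (1 := Rabs_triang _ _). lra.
Qed.

End Potential.

(** * Time windows of the flux and the weighted potential *)

Lemma const_of_derive0 (f : R -> R) (a b : R) :
  (forall x, Rmin a b <= x <= Rmax a b -> is_derive f x 0) -> f a = f b.
Proof.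
intros H. destruct (MVT_gen f a b (fun _ => 0)) as [z [_ Hz]].
- intros x Hx. apply H. lra.
- intros x Hx. apply continuity_pt_filterlim. eapply is_derive_R_continuous. now apply H.
- lra.
Qed.

(** A Steklov average without its factor 1/tau. It is C^1 when g is merely continuous, so that
    [q_ibp] becomes applicable. *)
Definition window (g : R -> R) (tau t : R) : R := RInt g t (t + tau).

Lemma window_eq (g : R -> R) (tau t : R) : cont g -> window g tau t = RInt g 0 (t + tau) - RInt g 0 t.
Proof. intros H. unfold window. rewrite <- (RInt_Chasles_cont g 0 t (t + tau)) by auto. lra. Qed.

Lemma window_derive (g : R -> R) (tau t : R) : cont g -> is_derive (window g tau) t (g (t + tau) - g t).
Proof.
intros H. apply (is_derive_ext (fun t => RInt g 0 (t + tau) - RInt g 0 t)).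
{ intros s. now rewrite window_eq. }
apply is_derive_R_minus; [|now apply is_derive_RInt_cont].
eapply is_derive_R_eq; [apply (is_derive_R_comp (fun y => RInt g 0 y) (fun t => t + tau) t (g (t + tau)) 1)|].
- now apply is_derive_RInt_cont.
- auto_derive; [auto|ring].
- ring.
Qed.

Lemma window_bdd (B tau : R) (g : R -> R) : bdd B g -> bdd (B * Rabs tau) (window g tau).
Proof.
intros Hg. split.
- apply (cont_derive _ (fun t => g (t + tau) - g t)). intros s. now apply window_derive, Hg.
- intros t. unfold window. replace tau with (t + tau - t) at 2 by ring.
  apply RInt_abs_le; [apply Hg|]. intros s _. apply Hg.
Qed.

Lemma bdd_shift (B h : R) (g : R -> R) : bdd B g -> bdd B (fun t => g (t + h)).
Proof. intros Hg. split; [apply cont_shift_add, Hg|intros; apply Hg]. Qed.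

Section Pot.
Context (c : R) (Hc : 0 < c).

Lemma q_cont_x (B : R) (g : R -> R) (t : R) : bdd B g -> cont (fun x => q c g x t).
Proof.
intros Hg x. apply continuous_eps. intros eps He.
destruct (q_cont c Hc B g x t eps Hg He) as [d [Hd H]]. exists d. split; auto.
intros y Hy. apply H; auto. now rewrite Rminus_diag, Rabs_R0.
Qed.

Definition J (g : R -> R) (t : R) : R := Int (fun x => exp (- c * x) * q c g x t).
Definition V (g : R -> R) (x t : R) : R := RInt (fun z => q c g z t) 0 x.

Lemma Jf_cont (B : R) (g : R -> R) (t : R) : bdd B g -> cont (fun x => exp (- c * x) * q c g x t).
Proof. intros Hg. apply cont_mult; [apply cont_exp_scal|now apply (q_cont_x B)]. Qed.

(** The constant 4/(3c) is the integral of e^{-c x} e^{c x / 4}. *)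
Lemma J_int_weighted (B : R) (g : R -> R) (t Z : R) : bdd B g ->
  (forall s, 0 <= s -> Rabs (g (t - s)) <= Z * exp (lam c * s)) ->
  is_int (fun x => exp (- c * x) * q c g x t) (J g t) /\ Rabs (J g t) <= Z * (4 / (3 * c)).
Proof.
intros Hg HZ. unfold J. replace (Z * (4 / (3 * c))) with (Z / (3 * c / 4)) by (field; lra).
apply (is_int_dom _ (fun x => Z * exp (- (3 * c / 4) * x))).
- now apply (Jf_cont B).
- apply cont_scal, cont_exp_scal.
- intros x Hx. rewrite Rabs_mult, Rabs_exp.
  replace (- (3 * c / 4) * x) with (- c * x + c * x / 4) by field. rewrite exp_plus.
  replace (Z * (exp (- c * x) * exp (c * x / 4))) with (exp (- c * x) * (Z * exp (c * x / 4))) by ring.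
  apply Rmult_le_compat_l; [apply Rlt_le, exp_pos|].
  apply q_weighted; auto; [apply Hg|lra].
- apply is_int_exp. lra.
Qed.

Lemma weight0 (B t : R) (g : R -> R) : bdd B g -> forall s, 0 <= s -> Rabs (g (t - s)) <= B * exp (lam c * s).
Proof.
intros Hg s [Hs|<-]; [now apply bdd_weight|].
rewrite Rmult_0_r, exp_0, Rmult_1_r. apply Hg.
Qed.

Lemma J_int (B : R) (g : R -> R) (t : R) : bdd B g -> is_int (fun x => exp (- c * x) * q c g x t) (J g t).
Proof. intros Hg. apply (J_int_weighted B g t B Hg). now apply weight0. Qed.

Lemma J_weighted (B : R) (g : R -> R) (t Z : R) : bdd B g ->
  (forall s, 0 <= s -> Rabs (g (t - s)) <= Z * exp (lam c * s)) -> Rabs (J g t) <= Z * (4 / (3 * c)).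
Proof. intros Hg HZ. exact (proj2 (J_int_weighted B g t Z Hg HZ)). Qed.

Lemma J_minus (B B' : R) (g g' : R -> R) (t : R) : bdd B g -> bdd B' g' ->
  J (fun t => g t - g' t) t = J g t - J g' t.
Proof.
intros Hg Hg'. apply is_int_unique.
apply (is_int_ext (fun x => exp (- c * x) * q c g x t - exp (- c * x) * q c g' x t)).
- intros x _. rewrite (q_minus c Hc B B' g g' x t Hg Hg'). ring.
- apply is_int_minus; [now apply (Jf_cont B)|now apply (Jf_cont B')|now apply (J_int B)|now apply (J_int B')].
Qed.

Lemma J_past (g g' : R -> R) (t : R) : (forall s, s <= t -> g s = g' s) -> J g t = J g' t.
Proof. intros H. apply Int_ext. intros x _. now rewrite (q_past c g g' x t H). Qed.

Lemma J_shift (g : R -> R) (h t : R) : J (fun t => g (t + h)) t = J g (t + h).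
Proof. apply Int_ext. intros x _. now rewrite q_shift. Qed.

Lemma J_0 (t : R) : J (fun _ => 0) t = 0.
Proof.
apply is_int_unique. apply (is_int_ext (fun x => 0 * exp (- c * x))).
- intros x _. rewrite q_const by auto. ring.
- assert (H : is_int (fun x => 0 * exp (- c * x)) (0 / c)) by (apply is_int_exp; lra).
  replace (0 / c) with 0 in H by (field; lra). exact H.
Qed.

Lemma J_le (B B' : R) (g g' : R -> R) (t : R) : bdd B g -> bdd B' g' ->
  (forall s, s <= t -> g s <= g' s) -> J g t <= J g' t.
Proof.
intros Hg Hg' Hle.
apply (is_int_le (fun x => exp (- c * x) * q c g x t) (fun x => exp (- c * x) * q c g' x t));
 [now apply (Jf_cont B)|now apply (Jf_cont B')|now apply (J_int B)|now apply (J_int B')|].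
intros x _. apply Rmult_le_compat_l; [apply Rlt_le, exp_pos|]. now apply (q_le c Hc B B').
Qed.

Lemma J_ge0 (B : R) (g : R -> R) (t : R) : bdd B g -> (forall s, s <= t -> 0 <= g s) -> 0 <= J g t.
Proof. intros Hg H. rewrite <- (J_0 t). apply (J_le (Rabs 0) B); auto using bdd_const. Qed.

Lemma J_abs_le (B : R) (g : R -> R) (t : R) : bdd B g -> Rabs (J g t) <= B * (4 / (3 * c)).
Proof. intros Hg. apply (J_weighted B); auto. now apply weight0. Qed.

Lemma J_cont (B : R) (g : R -> R) : bdd B g -> cont (J g).
Proof.
intros Hg t. apply continuous_eps. intros eps He.
destruct (shift_small c Hc B g t (eps / 2 / (4 / (3 * c)))) as [d [Hd H]]; auto.
{ apply Rdiv_lt_0_compat; [lra|]. apply Rdiv_lt_0_compat; lra. }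
exists d. split; auto. intros t' Ht'.
replace (J g t' - J g t) with (J (fun r => g (r + (t' - t)) - g r) t).
2:{ rewrite (J_minus B B (fun r => g (r + (t' - t))) g t (bdd_shift _ _ _ Hg) Hg).
    rewrite J_shift. replace (t + (t' - t)) with t' by ring. reflexivity. }
apply Rle_lt_trans with (eps / 2 / (4 / (3 * c)) * (4 / (3 * c))).
- apply (J_weighted (B + B)).
  + apply bdd_minus; auto using bdd_shift.
  + intros s Hs. replace (t - s + (t' - t)) with (t' - s) by ring. now apply H.
- replace (eps / 2 / (4 / (3 * c)) * (4 / (3 * c))) with (eps / 2) by (field; lra). lra.
Qed.

Lemma V_abs_le (B : R) (g : R -> R) (x t : R) : bdd B g -> Rabs (V g x t) <= B * Rabs x.
Proof.
intros Hg. unfold V. replace x with (x - 0) at 2 by ring.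
apply RInt_abs_le; [now apply (q_cont_x B)|]. intros z _. now apply q_abs_le.
Qed.

Lemma V_derive (B : R) (g : R -> R) (x t : R) : bdd B g -> is_derive (fun x => V g x t) x (q c g x t).
Proof. intros Hg. unfold V. apply (is_derive_RInt_cont (fun z => q c g z t)). now apply (q_cont_x B). Qed.

(* The difference of both sides has zero x-derivative, by [q_ibp]; integrating against e^{- c x}
   identifies the constant. *)
Lemma potential_increment (B : R) (g : R -> R) (tau x t : R) : bdd B g -> 0 < x ->
  q1 c (window g tau) x t - c * q c (window g tau) x t =
  (V g x (t + tau) - V g x t) - c * window g tau t - (J g (t + tau) - J g t).
Proof.
intros Hg.
set (G := window g tau).
assert (HG : bdd (B * Rabs tau) G) by now apply window_bdd.
assert (HdG : bdd (B + B) (fun t => g (t + tau) - g t)) by (apply bdd_minus; auto using bdd_shift).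
assert (HqG : forall y, 0 < y -> q2 c G y t - c * q1 c G y t = q c g y (t + tau) - q c g y t).
{ intros y Hy. rewrite <- (q_ibp c Hc _ G (fun t => g (t + tau) - g t) y t Hy (conj (proj1 HG) (fun t => Rle_trans _ _ _ (proj2 HG t) (Rmax_l _ (B + B))))
    (conj (proj1 HdG) (fun t => Rle_trans _ _ _ (proj2 HdG t) (Rmax_r (B * Rabs tau) _)))).
  - rewrite (q_minus c Hc B B (fun r => g (r + tau)) g y t (bdd_shift _ _ _ Hg) Hg). now rewrite q_shift.
  - intros s. apply window_derive, Hg. }
pose (D := fun x => V g x (t + tau) - V g x t).
assert (HD : forall y, is_derive D y (q c g y (t + tau) - q c g y t)).
{ intros y. apply is_derive_R_minus; now apply (V_derive B). }
pose (Y := fun y => q1 c G y t - c * q c G y t - D y).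
assert (HY : forall y, 0 < y -> is_derive Y y 0).
{ intros y Hy. destruct (q_derive_x c Hc _ G y t HG Hy) as [E1 E2].
  eapply is_derive_R_eq; [apply is_derive_R_minus; [apply is_derive_R_minus; [exact E2|apply is_derive_R_scal, E1]|apply HD]|].
  rewrite HqG by auto. ring. }
assert (HYc : forall y, 0 < y -> Y y = Y 1).
{ intros y Hy. apply const_of_derive0. intros z Hz. apply HY.
  apply Rlt_le_trans with (Rmin y 1); [apply Rmin_pos; lra|apply Hz]. }
(* An antiderivative of e^{-c y} times the increment of [q]: replacing [Y 1] by [Y y] cancels all
   other terms. It vanishes at infinity, so its value [c * G t + Y 1] at 0 is minus the increment of
   [J]. *)
pose (Th := fun y => exp (- c * y) * (c * q c G y t + D y + Y 1)).
assert (HdTh : forall y, 0 < y -> is_derive Th y (exp (- c * y) * q c g y (t + tau) - exp (- c * y) * q c g y t)).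
{ intros y Hy. destruct (q_derive_x c Hc _ G y t HG Hy) as [E1 E2].
  eapply is_derive_R_eq.
  - apply is_derive_R_mult.
    + assert (E : is_derive (fun y => exp (- c * y)) y (- c * exp (- c * y))) by (auto_derive; [auto|ring]). exact E.
    + apply is_derive_R_plus; [apply is_derive_R_plus; [apply is_derive_R_scal, E1|apply HD]|apply is_derive_R_const].
  - rewrite <- (HYc y Hy). unfold Y. ring. }
assert (HB := bdd_pos _ _ Hg).
assert (I1 : is_int (fun y => exp (- c * y) * q c g y (t + tau) - exp (- c * y) * q c g y t) (0 - Th 0)).
{ apply is_int_FTC.
  - apply cont_minus; now apply (Jf_cont B).
  - intros y _. unfold Th. apply cont_mult; [apply cont_exp_scal|].
    apply cont_plus; [apply cont_plus|apply cont_const].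
    + apply cont_scal. now apply (q_cont_x _ _ _ HG).
    + intros z. eapply is_derive_R_continuous, HD.
  - exact HdTh.
  - intros eps He.
    destruct (pow_exp_bounded (c / 2) 1) as [C [HC H1]]; [lra|].
    pose (M := c * (B * Rabs tau) + 2 * B * C + Rabs (Y 1)).
    destruct (exp_neg_small M (c / 2) ltac:(lra) eps He) as [A [HA HA']].
    exists A. split; auto. intros y Hy. specialize (HA' y Hy). rewrite Rminus_0_r.
    apply Rle_lt_trans with (2 := HA'). unfold Th.
    assert (Hy0 : 0 <= y) by lra.
    assert (EE : exp (- c * y) = exp (- (c / 2) * y) * exp (- (c / 2) * y)) by (rewrite <- exp_plus; f_equal; field).
    rewrite EE. set (e := exp (- (c / 2) * y)) in *. specialize (H1 y Hy0). rewrite pow_1 in H1. fold e in H1.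
    assert (He0 : 0 < e) by apply exp_pos.
    assert (He1 : e <= 1). { unfold e. rewrite <- exp_0. apply exp_le. nra. }
    replace (e * e * (c * q c G y t + D y + Y 1)) with (e * (e * (c * q c G y t + D y + Y 1))) by ring.
    rewrite (Rabs_mult e), (Rmult_comm M e), (Rabs_mult e M).
    apply Rmult_le_compat_l; [apply Rabs_pos|].
    rewrite Rabs_mult, (Rabs_right e) by lra.
    assert (F1 : Rabs (c * q c G y t + D y + Y 1) <= c * (B * Rabs tau) + 2 * B * y + Rabs (Y 1)).
    { assert (F2 := q_abs_le c Hc _ G y t HG). 
      assert (F3 := V_abs_le B g y (t + tau) Hg). assert (F4 := V_abs_le B g y t Hg).
      rewrite (Rabs_right y) in F3, F4 by lra. unfold D.
      apply Rabs_le_between in F2, F3, F4. generalize (Rle_abs (Y 1)) (Rle_abs (- Y 1)). rewrite Rabs_Ropp. intros.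
      assert (- (c * (B * Rabs tau)) <= c * q c G y t <= c * (B * Rabs tau)) by (split; nra).
      apply Rabs_le_between. lra. }
    apply Rle_trans with (2 := Rle_abs _).
    apply Rle_trans with (e * (c * (B * Rabs tau) + 2 * B * y + Rabs (Y 1))); [apply Rmult_le_compat_l; lra|].
    unfold M. assert (0 <= c * (B * Rabs tau)) by (apply Rmult_le_pos; [lra|]; apply Rmult_le_pos; [lra|apply Rabs_pos]).
    generalize (Rabs_pos (Y 1)). intros.
    assert (2 * B * (y * e) <= 2 * B * C) by (apply Rmult_le_compat_l; lra).
    nra. }
assert (I2 : is_int (fun y => exp (- c * y) * q c g y (t + tau) - exp (- c * y) * q c g y t) (J g (t + tau) - J g t)).
{ apply is_int_minus; (now apply (Jf_cont B)) || now apply (J_int B). }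
assert (E0 : Th 0 = c * G t + Y 1).
{ unfold Th, D, V. rewrite !RInt_point, Rmult_0_r, exp_0, q_0. unfold zero; simpl. ring. }
generalize (is_int_unique _ _ I1) (is_int_unique _ _ I2). intros U1 U2. rewrite U1, E0 in U2.
intros Hx. generalize (HYc x Hx). unfold Y at 1. unfold D. intros E. lra.
Qed.

(** Evaluate [potential_increment] at a fixed small height x: the two terms V are at most B x each,
    and everything containing the window is O(tau). The modulus depends on B alone, hence is uniform
    over all traces. *)
Lemma equicont (B eps : R) : 0 <= B -> 0 < eps -> exists d, 0 < d /\
  forall g t tau, bdd B g -> Rabs tau < d ->
    Rabs (c * window g tau t + (J g (t + tau) - J g t)) <= eps /\ Rabs (J g (t + tau) - J g t) <= eps.
Proof.
intros HB He.
pose (x := eps / (8 * (B + 1))).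
assert (Hx : 0 < x) by (apply Rdiv_lt_0_compat; lra).
destruct (q12_weighted c Hc x x Hx) as [C [HC HC']].
pose (k := (C + 2 * c) * (B + 1)).
assert (Hk : 0 < k) by (apply Rmult_lt_0_compat; lra).
exists (eps / (4 * k)). split; [apply Rdiv_lt_0_compat; lra|].
intros g t tau Hg Ht.
assert (HW := window_bdd B tau g Hg).
assert (Hkt : k * Rabs tau <= eps / 4).
{ apply Rlt_le. apply Rmult_lt_compat_l with (r := k) in Ht; [|lra].
  replace (k * (eps / (4 * k))) with (eps / 4) in Ht by (field; lra). exact Ht. }
assert (HBx : B * x <= eps / 8).
{ apply Rle_trans with ((B + 1) * x); [nra|]. right. unfold x. field. lra. }
assert (F1 : Rabs (q1 c (window g tau) x t) <= C * (B * Rabs tau)).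
{ refine (proj1 (HC' (window g tau) x t (B * Rabs tau) _ _ _)); [apply HW|lra|].
  intros s Hs. now apply (weight0 _ t (window g tau) HW). }
assert (F2 := q_abs_le c Hc _ _ x t HW).
assert (F3 := V_abs_le B g x (t + tau) Hg). assert (F4 := V_abs_le B g x t Hg).
rewrite (Rabs_right x) in F3, F4 by lra.
assert (F5 := proj2 HW t).
generalize (potential_increment B g tau x t Hg Hx). intros E.
apply Rabs_le_between in F1, F2, F3, F4, F5.
set (r := Rabs tau) in *. assert (Hr : 0 <= r) by apply Rabs_pos.
set (qq := q c (window g tau) x t) in *. set (w := window g tau t) in *.
assert (Hcq : - (c * (B * r)) <= c * qq <= c * (B * r)) by (split; nra).
assert (Hcw : - (c * (B * r)) <= c * w <= c * (B * r)) by (split; nra).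
assert (Hk2 : C * (B * r) + 2 * (c * (B * r)) <= k * r).
{ unfold k. assert (0 <= (C + 2 * c) * r) by (apply Rmult_le_pos; lra). nra. }
assert (0 <= C * (B * r)) by (apply Rmult_le_pos; [lra|]; apply Rmult_le_pos; lra).
assert (0 <= c * (B * r)) by (apply Rmult_le_pos; [lra|]; apply Rmult_le_pos; lra).
split; apply Rabs_le_between; lra.
Qed.
End Pot.

(** * Maximum principles *)

Definition jcont (f : R -> R -> R) : Prop :=
  forall x t, 0 <= x -> cont_in (fun x' => 0 <= x') f x t.

Definition heat (c : R) (w : R -> R -> R) : Prop :=
  exists wx wxx wt : R -> R -> R, forall x t, 0 < x ->
    is_derive (fun y => w y t) x (wx x t) /\ is_derive (fun y => wx y t) x (wxx x t) /\
    is_derive (fun s => w x s) t (wt x t) /\ wt x t = wxx x t - c * wx x t.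

Definition strict_super (c : R) (w : R -> R -> R) : Prop :=
  exists wx wxx wt : R -> R -> R, forall x t, 0 < x ->
    is_derive (fun y => w y t) x (wx x t) /\ is_derive (fun y => wx y t) x (wxx x t) /\
    is_derive (fun s => w x s) t (wt x t) /\ wxx x t - c * wx x t < wt x t.

Lemma heat_comb (c a b : R) (u v : R -> R -> R) : heat c u -> heat c v ->
  heat c (fun x t => a * u x t + b * v x t).
Proof.
intros [ux [uxx [ut Hu]]] [vx [vxx [vt Hv]]].
exists (fun x t => a * ux x t + b * vx x t), (fun x t => a * uxx x t + b * vxx x t), (fun x t => a * ut x t + b * vt x t).
intros x t Hx. destruct (Hu x t Hx) as [U1 [U2 [U3 U4]]]. destruct (Hv x t Hx) as [V1 [V2 [V3 V4]]].
split; [|split; [|split]].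
- now apply is_derive_R_plus; apply is_derive_R_scal.
- now apply (is_derive_R_plus (fun y => a * ux y t) (fun y => b * vx y t)); apply is_derive_R_scal.
- now apply (is_derive_R_plus (fun s => a * u x s) (fun s => b * v x s)); apply is_derive_R_scal.
- rewrite U4, V4. ring.
Qed.

Lemma heat_const (c k : R) : heat c (fun _ _ => k).
Proof.
exists (fun _ _ => 0), (fun _ _ => 0), (fun _ _ => 0). intros x t Hx.
split; [|split; [|split]]; try apply is_derive_R_const. ring.
Qed.

Lemma heat_shift (c h : R) (u : R -> R -> R) : heat c u -> heat c (fun x t => u x (t + h)).
Proof.
intros [ux [uxx [ut Hu]]].
exists (fun x t => ux x (t + h)), (fun x t => uxx x (t + h)), (fun x t => ut x (t + h)). intros x t Hx.
destruct (Hu x (t + h) Hx) as [U1 [U2 [U3 U4]]]. split; [|split; [|split]]; auto.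
eapply is_derive_R_eq; [apply (is_derive_R_comp (fun s => u x s) (fun t => t + h) t (ut x (t + h)) 1); [exact U3|auto_derive; [auto|ring]]|ring].
Qed.

Lemma jcont_comb (a b : R) (u v : R -> R -> R) : jcont u -> jcont v ->
  jcont (fun x t => a * u x t + b * v x t).
Proof.
intros Hu Hv x t Hx eps He.
assert (Ha : 0 < Rabs a + 1) by (generalize (Rabs_pos a); lra).
assert (Hb : 0 < Rabs b + 1) by (generalize (Rabs_pos b); lra).
destruct (Hu x t Hx (eps / 2 / (Rabs a + 1))) as [d [Hd H1]]; [repeat apply Rdiv_lt_0_compat; lra|].
destruct (Hv x t Hx (eps / 2 / (Rabs b + 1))) as [d' [Hd' H2]]; [repeat apply Rdiv_lt_0_compat; lra|].
exists (Rmin d d'). split; [now apply Rmin_pos|]. intros x' t' Hx' Hxx Htt.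
assert (M1 := Rmin_l d d'). assert (M2 := Rmin_r d d').
specialize (H1 x' t' Hx' ltac:(lra) ltac:(lra)). specialize (H2 x' t' Hx' ltac:(lra) ltac:(lra)).
replace (a * u x' t' + b * v x' t' - (a * u x t + b * v x t)) with
  (a * (u x' t' - u x t) + b * (v x' t' - v x t)) by ring.
apply Rle_lt_trans with (1 := Rabs_triang _ _). rewrite !Rabs_mult.
apply Rmult_lt_compat_l with (r := Rabs a + 1) in H1; [|lra].
apply Rmult_lt_compat_l with (r := Rabs b + 1) in H2; [|lra].
replace ((Rabs a + 1) * (eps / 2 / (Rabs a + 1))) with (eps / 2) in H1 by (field; lra).
replace ((Rabs b + 1) * (eps / 2 / (Rabs b + 1))) with (eps / 2) in H2 by (field; lra).
generalize (Rabs_pos (u x' t' - u x t)) (Rabs_pos (v x' t' - v x t)). lra.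
Qed.

Lemma jcont_prod (f g : R -> R) : cont f -> cont g -> jcont (fun x t => f x * g t).
Proof.
intros Hf Hg x t _ eps He.
assert (Hg1 : 0 < Rabs (g t) + 1) by (generalize (Rabs_pos (g t)); lra).
assert (Hf1 : 0 < Rabs (f x) + 1) by (generalize (Rabs_pos (f x)); lra).
destruct (proj1 (continuous_eps f x) (Hf x) (Rmin 1 (eps / 2 / (Rabs (g t) + 1)))) as [d [Hd H1]].
{ apply Rmin_pos; [lra|repeat apply Rdiv_lt_0_compat; lra]. }
destruct (proj1 (continuous_eps g t) (Hg t) (eps / 2 / (Rabs (f x) + 1))) as [d' [Hd' H2]].
{ repeat apply Rdiv_lt_0_compat; lra. }
exists (Rmin d d'). split; [now apply Rmin_pos|]. intros x' t' Hx' Hxx Htt.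
assert (M1 := Rmin_l d d'). assert (M2 := Rmin_r d d').
specialize (H1 x' ltac:(lra)). specialize (H2 t' ltac:(lra)).
assert (H3 : Rabs (f x' - f x) < 1) by (apply Rlt_le_trans with (1 := H1); apply Rmin_l).
assert (H4 : Rabs (f x' - f x) < eps / 2 / (Rabs (g t) + 1)) by (apply Rlt_le_trans with (1 := H1); apply Rmin_r).
replace (f x' * g t' - f x * g t) with (f x' * (g t' - g t) + (f x' - f x) * g t) by ring.
apply Rle_lt_trans with (1 := Rabs_triang _ _). rewrite !Rabs_mult.
apply Rmult_lt_compat_r with (r := Rabs (g t) + 1) in H4; [|lra].
replace (eps / 2 / (Rabs (g t) + 1) * (Rabs (g t) + 1)) with (eps / 2) in H4 by (field; lra).
apply Rmult_lt_compat_l with (r := Rabs (f x) + 1) in H2; [|lra].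
replace ((Rabs (f x) + 1) * (eps / 2 / (Rabs (f x) + 1))) with (eps / 2) in H2 by (field; lra).
assert (H5 : Rabs (f x') <= Rabs (f x) + 1).
{ generalize (Rabs_triang_inv (f x') (f x)). lra. }
generalize (Rabs_pos (g t' - g t)) (Rabs_pos (f x' - f x)). nra.
Qed.

Lemma jcont_shift (h : R) (u : R -> R -> R) : jcont u -> jcont (fun x t => u x (t + h)).
Proof.
intros Hu x t Hx eps He. destruct (Hu x (t + h) Hx eps He) as [d [Hd H]]. exists d. split; auto.
intros x' t' Hx' Hxx Htt. apply H; auto. now replace (t' + h - (t + h)) with (t' - t) by ring.
Qed.

(** Minimize in x for each t, then minimize the resulting value over t. This value is continuous in
    t by uniform continuity of f, although the chosen minimizer [mx] need not be. *)
Lemma min_rect (f : R -> R -> R) (X t0 t1 : R) : jcont f -> 0 <= X -> t0 <= t1 ->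
  exists x t, 0 <= x <= X /\ t0 <= t <= t1 /\
    forall x' t', 0 <= x' <= X -> t0 <= t' <= t1 -> f x t <= f x' t'.
Proof.
intros Hf HX Ht.
pose (F := fun x t => f (Rmax 0 x) t).
assert (HF : forall x t, continuity_2d_pt F x t).
{ intros x t eps. destruct (Hf (Rmax 0 x) t (Rmax_l _ _) eps (cond_pos eps)) as [d [Hd H]].
  exists (mkposreal d Hd). intros u v Hu Hv. apply H; [apply Rmax_l| |exact Hv].
  simpl in Hu. apply Rle_lt_trans with (2 := Hu). unfold Rmax.
  destruct (Rle_dec 0 u), (Rle_dec 0 x); unfold Rabs; repeat destruct (Rcase_abs _); lra. }
assert (HF1 : forall t x, continuity_pt (fun x => F x t) x).
{ intros t x eps He. destruct (HF x t (mkposreal eps He)) as [d Hd]. exists d. split; [apply cond_pos|].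
  intros y [_ Hy]. apply Hd; [exact Hy|]. rewrite Rminus_diag, Rabs_R0. apply cond_pos. }
pose (mx := fun t => epsilon (inhabits 0) (fun x => 0 <= x <= X /\ forall y, 0 <= y <= X -> F x t <= F y t)).
assert (Hmx : forall t, 0 <= mx t <= X /\ forall y, 0 <= y <= X -> F (mx t) t <= F y t).
{ intros t. unfold mx. apply epsilon_spec.
  destruct (continuity_ab_min (fun x => F x t) 0 X HX) as [m [Hm1 Hm2]].
  - intros; apply HF1.
  - exists m. split; auto. }
assert (Hm : forall t, t0 <= t <= t1 -> continuity_pt (fun t => F (mx t) t) t).
{ intros t Htt eps He.
  destruct (uniform_continuity_2d F 0 X (t0 - 1) (t1 + 1) (fun x y _ _ => HF x y) (mkposreal eps He)) as [d Hd].
  simpl in Hd. exists (Rmin d 1). split; [apply Rmin_pos; [apply cond_pos|lra]|].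
  intros s [_ Hs]. unfold dist in *; simpl in *; unfold Rdist in *.
  assert (Hs1 : Rabs (s - t) < d) by (apply Rlt_le_trans with (1 := Hs); apply Rmin_l).
  assert (Hs2 : Rabs (s - t) < 1) by (apply Rlt_le_trans with (1 := Hs); apply Rmin_r).
  apply Rabs_def2 in Hs2.
  destruct (Hmx t) as [A1 A2]. destruct (Hmx s) as [B1 B2].
  assert (E : forall x, 0 <= x <= X -> Rabs (F x s - F x t) < eps).
  { intros x Hx. apply Hd; auto; try lra. rewrite Rminus_diag, Rabs_R0. apply cond_pos. }
  assert (E1 := E _ A1). assert (E2 := E _ B1). specialize (A2 _ B1). specialize (B2 _ A1).
  rabs_lra. }
destruct (continuity_ab_min (fun t => F (mx t) t) t0 t1 Ht Hm) as [t [Ht1 Ht2]].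
exists (mx t), t. destruct (Hmx t) as [A1 A2]. split; [exact A1|]. split; [exact Ht2|].
intros x' t' Hx' Ht'.
assert (EF : forall x s, 0 <= x -> F x s = f x s) by (intros x s Hx; unfold F; now rewrite Rmax_right).
rewrite <- !EF by lra. apply Rle_trans with (F (mx t') t'); [now apply Ht1|]. now apply Hmx.
Qed.

Lemma deriv_at_interior_min (f : R -> R) (x l d : R) : 0 < d -> is_derive f x l ->
  (forall y, Rabs (y - x) < d -> f x <= f y) -> l = 0.
Proof.
intros Hd Hf Hmin. apply is_derive_Reals in Hf.
destruct (Req_dec l 0) as [E|E]; [exact E|exfalso].
assert (Hl : 0 < Rabs l) by now apply Rabs_pos_lt.
destruct (Hf (Rabs l) Hl) as [del Hdel].
pose (k := Rmin d del / 2).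
assert (Hk : 0 < k /\ k < d /\ k < del).
{ unfold k. assert (0 < Rmin d del) by (apply Rmin_pos; [auto|apply cond_pos]).
  generalize (Rmin_l d del) (Rmin_r d del). lra. }
destruct (Rlt_dec l 0) as [Hn|Hn].
- specialize (Hdel k ltac:(lra)). rewrite (Rabs_right k) in Hdel by lra. specialize (Hdel ltac:(lra)).
  specialize (Hmin (x + k)). replace (x + k - x) with k in Hmin by ring. rewrite (Rabs_right k) in Hmin by lra.
  specialize (Hmin ltac:(lra)). rewrite (Rabs_left l) in Hdel by auto. apply Rabs_def2 in Hdel.
  assert (0 <= (f (x + k) - f x) / k) by (apply Rdiv_le_0_compat; lra). lra.
- specialize (Hdel (-k) ltac:(lra)). rewrite (Rabs_left (-k)) in Hdel by lra. specialize (Hdel ltac:(lra)).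
  specialize (Hmin (x + - k)). replace (x + - k - x) with (-k) in Hmin by ring. rewrite (Rabs_left (-k)) in Hmin by lra.
  specialize (Hmin ltac:(lra)). rewrite (Rabs_right l) in Hdel by lra. apply Rabs_def2 in Hdel.
  assert (0 <= (f (x + - k) - f x) / k) by (apply Rdiv_le_0_compat; lra).
  replace ((f (x + - k) - f x) / - k) with (- ((f (x + - k) - f x) / k)) in Hdel by (field; lra). lra.
Qed.

Lemma deriv_at_right_end_min (f : R -> R) (x l d : R) : 0 < d -> is_derive f x l ->
  (forall y, x - d < y <= x -> f x <= f y) -> l <= 0.
Proof.
intros Hd Hf Hmin. apply is_derive_Reals in Hf. apply Rnot_lt_le. intros Hl.
destruct (Hf l Hl) as [del Hdel].
pose (k := Rmin d del / 2).
assert (Hk : 0 < k /\ k < d /\ k < del).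
{ unfold k. assert (0 < Rmin d del) by (apply Rmin_pos; [auto|apply cond_pos]).
  generalize (Rmin_l d del) (Rmin_r d del). lra. }
specialize (Hdel (-k) ltac:(lra)). rewrite (Rabs_left (-k)) in Hdel by lra. specialize (Hdel ltac:(lra)).
specialize (Hmin (x + - k) ltac:(lra)). apply Rabs_def2 in Hdel.
assert (0 <= (f (x + - k) - f x) / k) by (apply Rdiv_le_0_compat; lra).
replace ((f (x + - k) - f x) / - k) with (- ((f (x + - k) - f x) / k)) in Hdel by (field; lra). lra.
Qed.

Lemma second_deriv_at_min (f f1 : R -> R) (x l d : R) : 0 < d ->
  (forall y, Rabs (y - x) < d -> is_derive f y (f1 y)) -> is_derive f1 x l ->
  (forall y, Rabs (y - x) < d -> f x <= f y) -> 0 <= l.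
Proof.
intros Hd Hf Hf1 Hmin.
assert (H0 : f1 x = 0).
{ apply (deriv_at_interior_min f x (f1 x) d Hd); auto. apply Hf. now rewrite Rminus_diag, Rabs_R0. }
apply Rnot_lt_le. intros Hl. apply is_derive_Reals in Hf1.
destruct (Hf1 (- l) ltac:(lra)) as [del Hdel].
pose (k := Rmin d del / 2).
assert (Hk : 0 < k /\ k < d /\ k < del).
{ unfold k. assert (0 < Rmin d del) by (apply Rmin_pos; [auto|apply cond_pos]).
  generalize (Rmin_l d del) (Rmin_r d del). lra. }
assert (Hneg : forall z, x < z <= x + k -> f1 z < 0).
{ intros z Hz. specialize (Hdel (z - x) ltac:(lra)). rewrite (Rabs_right (z - x)) in Hdel by lra.
  specialize (Hdel ltac:(lra)). replace (x + (z - x)) with z in Hdel by ring. rewrite H0 in Hdel.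
  apply Rabs_def2 in Hdel. apply Rnot_le_lt. intros Hz0.
  assert (0 <= (f1 z - 0) / (z - x)) by (apply Rdiv_le_0_compat; lra). lra. }
destruct (MVT_gen f x (x + k) f1) as [z [Hz Hz']].
- intros y Hy. rewrite Rmin_left, Rmax_right in Hy by lra. apply Hf. apply Rabs_def1; lra.
- intros y Hy. rewrite Rmin_left, Rmax_right in Hy by lra. apply continuity_pt_filterlim.
  eapply is_derive_R_continuous, Hf. apply Rabs_def1; lra.
- rewrite Rmin_left, Rmax_right in Hz by lra.
  assert (f (x + k) >= f x) by (apply Rle_ge, Hmin; apply Rabs_def1; lra).
  destruct (Req_dec z x) as [->|Hzx].
  + (* the mean value point may be the left end, where f1 = 0: shrink once more *)
    rewrite H0 in Hz'.
    destruct (MVT_gen f (x + k / 2) (x + k) f1) as [w [Hw Hw']].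
    * intros y Hy. rewrite Rmin_left, Rmax_right in Hy by lra. apply Hf. apply Rabs_def1; lra.
    * intros y Hy. rewrite Rmin_left, Rmax_right in Hy by lra. apply continuity_pt_filterlim.
      eapply is_derive_R_continuous, Hf. apply Rabs_def1; lra.
    * rewrite Rmin_left, Rmax_right in Hw by lra.
      destruct (MVT_gen f x (x + k / 2) f1) as [v [Hv Hv']].
      -- intros y Hy. rewrite Rmin_left, Rmax_right in Hy by lra. apply Hf. apply Rabs_def1; lra.
      -- intros y Hy. rewrite Rmin_left, Rmax_right in Hy by lra. apply continuity_pt_filterlim.
         eapply is_derive_R_continuous, Hf. apply Rabs_def1; lra.
      -- rewrite Rmin_left, Rmax_right in Hv by lra.
         assert (f1 w < 0) by (apply Hneg; lra).
         assert (f1 v <= 0) by (destruct (Req_dec v x) as [->|]; [lra|left; apply Hneg; lra]). nra.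
  + assert (f1 z < 0) by (apply Hneg; lra). nra.
Qed.

(* Comparison with a positive strict supersolution [phi]: the minimum of w / phi over the
   rectangle can only sit on the bottom, on the right side, or (excluded by hypothesis) at x = 0. *)
Lemma max_principle_rect (c X t0 t1 mu : R) (w phi : R -> R -> R) : 0 < X -> t0 <= t1 -> 0 <= mu ->
  jcont w -> jcont phi -> heat c w -> strict_super c phi ->
  (forall x t, 0 <= x <= X -> t0 <= t <= t1 -> 0 < phi x t) ->
  (forall x, 0 <= x <= X -> - mu * phi x t0 <= w x t0) ->
  (forall t, t0 <= t <= t1 -> - mu * phi X t <= w X t) ->
  (forall t nu, t0 < t <= t1 -> mu < nu -> w 0 t = - nu * phi 0 t ->
     (forall x, 0 <= x <= X -> - nu * phi x t <= w x t) -> False) ->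
  forall x t, 0 <= x <= X -> t0 <= t <= t1 -> - mu * phi x t <= w x t.
Proof.
intros HX Ht Hmu Cw Cp [wx [wxx [wt Hw]]] [px [pxx [pt Hp]]] Hpos Hbot Hright Hleft.
(* [phi] is known to be positive on the rectangle only; composing with the projection onto it makes
   the quotient continuous on the whole half-plane, as [min_rect] requires. *)
pose (clx := fun x => Rmin x X). pose (clt := fun t => Rmax t0 (Rmin t t1)).
assert (Hclx : forall x, 0 <= x -> 0 <= clx x <= X) by (intros x Hx; unfold clx, Rmin; destruct (Rle_dec x X); lra).
assert (Hclt : forall t, t0 <= clt t <= t1).
{ intros t. unfold clt, Rmax, Rmin. destruct (Rle_dec t t1); destruct (Rle_dec t0 _); lra. }
assert (Hclx1 : forall x y, Rabs (clx x - clx y) <= Rabs (x - y)).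
{ intros x y. unfold clx, Rmin. destruct (Rle_dec x X), (Rle_dec y X); unfold Rabs; repeat destruct (Rcase_abs _); lra. }
assert (Hclt1 : forall x y, Rabs (clt x - clt y) <= Rabs (x - y)).
{ intros x y. unfold clt, Rmin, Rmax. destruct (Rle_dec x t1), (Rle_dec y t1); repeat destruct (Rle_dec t0 _);
  unfold Rabs; repeat destruct (Rcase_abs _); lra. }
assert (Hom : jcont (fun x t => w (clx x) (clt t) / phi (clx x) (clt t))).
{ intros x t Hx eps He.
  set (a := clx x). set (s := clt t).
  assert (Ha := Hclx x Hx). assert (Hs := Hclt t). fold a in Ha. fold s in Hs.
  assert (Hp0 := Hpos a s Ha Hs). set (p0 := phi a s) in *. set (w0 := w a s).
  pose (k := eps * p0 / 2 / (2 + 2 * Rabs w0 / p0)).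
  assert (Hk0 : 0 <= 2 * Rabs w0 / p0) by (apply Rdiv_le_0_compat; [generalize (Rabs_pos w0); lra|auto]).
  assert (Hk : 0 < k) by (unfold k; apply Rdiv_lt_0_compat; nra).
  destruct (Cw a s (proj1 Ha) k Hk) as [d1 [Hd1 H1]].
  destruct (Cp a s (proj1 Ha) (Rmin (p0 / 2) k)) as [d2 [Hd2 H2]]; [apply Rmin_pos; lra|].
  exists (Rmin d1 d2). split; [now apply Rmin_pos|]. intros x' t' Hx' Hxx Htt.
  assert (M1 := Rmin_l d1 d2). assert (M2 := Rmin_r d1 d2).
  assert (N1 := Hclx1 x' x). assert (N2 := Hclt1 t' t). fold a in N1. fold s in N2.
  assert (Ha' := Hclx x' Hx'). assert (Hs' := Hclt t').
  set (a' := clx x') in *. set (s' := clt t') in *.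
  specialize (H1 a' s' (proj1 Ha') ltac:(lra) ltac:(lra)). specialize (H2 a' s' (proj1 Ha') ltac:(lra) ltac:(lra)).
  fold w0 in H1. fold p0 in H2. assert (Hp1 := Hpos a' s' Ha' Hs'). set (p1 := phi a' s') in *. set (w1 := w a' s') in *.
  assert (G1 : Rabs (p1 - p0) < p0 / 2) by (apply Rlt_le_trans with (1 := H2); apply Rmin_l).
  assert (G2 : Rabs (p1 - p0) < k) by (apply Rlt_le_trans with (1 := H2); apply Rmin_r).
  replace (w1 / p1 - w0 / p0) with (((w1 - w0) - w0 / p0 * (p1 - p0)) / p1) by (field; lra).
  unfold Rdiv at 1. rewrite Rabs_mult, (Rabs_right (/ p1)) by (apply Rle_ge, Rlt_le, Rinv_0_lt_compat; lra).
  apply Rmult_lt_reg_r with p1; [lra|]. rewrite Rmult_assoc, Rinv_l, Rmult_1_r by lra.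
  assert (G3 : Rabs (w1 - w0 - w0 / p0 * (p1 - p0)) <= Rabs (w1 - w0) + Rabs w0 / p0 * Rabs (p1 - p0)).
  { unfold Rminus at 1. eapply Rle_trans; [apply Rabs_triang|]. rewrite Rabs_Ropp, Rabs_mult.
    right. f_equal. unfold Rdiv. rewrite Rabs_mult, (Rabs_right (/ p0)); [reflexivity|].
    apply Rle_ge, Rlt_le, Rinv_0_lt_compat; lra. }
  assert (Hw0 : 0 <= Rabs w0 / p0) by (apply Rdiv_le_0_compat; [apply Rabs_pos|auto]).
  assert (G4 : k * (2 + 2 * Rabs w0 / p0) = eps * p0 / 2) by (unfold k; field; generalize (Rabs_pos w0); nra).
  apply Rabs_def2 in G1.
  apply Rle_lt_trans with (k + Rabs w0 / p0 * k).
  - apply Rle_trans with (1 := G3). assert (Rabs w0 / p0 * Rabs (p1 - p0) <= Rabs w0 / p0 * k) by (apply Rmult_le_compat_l; lra). lra.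
  - replace (2 * Rabs w0 / p0) with (2 * (Rabs w0 / p0)) in G4 by (field; lra).
    assert (k + Rabs w0 / p0 * k = eps * p0 / 4) by lra. nra. }
assert (Eclx : forall x, 0 <= x <= X -> clx x = x) by (intros x Hx; apply Rmin_left; lra).
assert (Eclt : forall t, t0 <= t <= t1 -> clt t = t).
{ intros t Htt. unfold clt. rewrite Rmin_left by lra. apply Rmax_right; lra. }
destruct (min_rect _ X t0 t1 Hom (Rlt_le _ _ HX) Ht) as [xm [tm [Hxm [Htm Hmin]]]].
rewrite (Eclx xm Hxm), (Eclt tm Htm) in Hmin.
assert (Hpm := Hpos xm tm Hxm Htm).
assert (Hmin' : forall x t, 0 <= x <= X -> t0 <= t <= t1 -> w xm tm / phi xm tm * phi x t <= w x t).
{ intros x t Hx Htt. specialize (Hmin x t Hx Htt). rewrite (Eclx x Hx), (Eclt t Htt) in Hmin.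
  assert (Hpx := Hpos x t Hx Htt). apply Rmult_le_compat_r with (r := phi x t) in Hmin; [|lra].
  unfold Rdiv in Hmin at 2. rewrite Rmult_assoc, Rinv_l, Rmult_1_r in Hmin by lra. exact Hmin. }
pose (nu := - (w xm tm / phi xm tm)).
assert (Hnu : forall x t, 0 <= x <= X -> t0 <= t <= t1 -> - nu * phi x t <= w x t).
{ intros x t Hx Htt. unfold nu. rewrite Ropp_involutive. now apply Hmin'. }
assert (Heq : w xm tm = - nu * phi xm tm) by (unfold nu; field; lra).
destruct (Rle_dec nu mu) as [Hle|Hgt].
{ intros x t Hx Htt. apply Rle_trans with (2 := Hnu x t Hx Htt). specialize (Hpos x t Hx Htt). nra. }
exfalso. apply Rnot_le_lt in Hgt.
assert (Htm0 : t0 < tm).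
{ destruct (Req_dec t0 tm) as [E|E]; [|lra]. rewrite <- E in *. specialize (Hbot xm Hxm). nra. }
assert (HxmX : xm < X).
{ destruct (Req_dec xm X) as [E|E]; [|lra]. rewrite E in *. specialize (Hright tm Htm). nra. }
assert (Hxm0 : 0 < xm).
{ destruct (Req_dec xm 0) as [E|E]; [|lra]. rewrite E in *. exfalso.
  apply (Hleft tm nu); auto; lra. }
destruct (Hw xm tm Hxm0) as [W1 [W2 [W3 W4]]]. destruct (Hp xm tm Hxm0) as [P1' [P2' [P3' P4']]].
pose (d := Rmin xm (X - xm)).
assert (Hd : 0 < d) by (apply Rmin_pos; lra).
assert (Hdx : forall y, Rabs (y - xm) < d -> 0 < y <= X).
{ intros y Hy. assert (M1 := Rmin_l xm (X - xm)). assert (M2 := Rmin_r xm (X - xm)). fold d in M1, M2. rabs_lra. }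
assert (D1 : wx xm tm + nu * px xm tm = 0).
{ apply (deriv_at_interior_min (fun y => w y tm + nu * phi y tm) xm _ d Hd).
  - apply is_derive_R_plus; [exact W1|apply is_derive_R_scal, P1'].
  - intros y Hy. apply Hdx in Hy. specialize (Hnu y tm ltac:(lra) Htm). lra. }
assert (D2 : 0 <= wxx xm tm + nu * pxx xm tm).
{ apply (second_deriv_at_min (fun y => w y tm + nu * phi y tm) (fun y => wx y tm + nu * px y tm) xm _ d Hd).
  - intros y Hy. apply Hdx in Hy. apply is_derive_R_plus; [apply (Hw y tm (proj1 Hy))|apply is_derive_R_scal, (Hp y tm (proj1 Hy))].
  - apply is_derive_R_plus; [exact W2|apply is_derive_R_scal, P2'].
  - intros y Hy. apply Hdx in Hy. specialize (Hnu y tm ltac:(lra) Htm). lra. }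
assert (D3 : wt xm tm + nu * pt xm tm <= 0).
{ apply (deriv_at_right_end_min (fun s => w xm s + nu * phi xm s) tm _ (tm - t0)); [lra| |].
  - apply is_derive_R_plus; [exact W3|apply is_derive_R_scal, P3'].
  - intros y Hy. specialize (Hnu xm y Hxm ltac:(lra)). lra. }
assert (Hnu0 : 0 < nu) by lra.
(* With the equation for w, [D1] to [D3] give nu (phi_t - phi_xx + c phi_x) <= 0, against the
   strictness of [phi]. *)
assert (nu * (pxx xm tm - c * px xm tm) < nu * pt xm tm) by (apply Rmult_lt_compat_l; auto). nra.
Qed.

(** * Barriers and comparison principles on the half-line *)

Lemma small_multiple_nonneg (a k : R) : (forall mu, 0 < mu -> - mu * k <= a) -> 0 <= a.
Proof.
intros H. apply Rnot_lt_le. intros Ha.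
destruct (Rle_dec k 0) as [Hk|Hk].
- specialize (H 1 Rlt_0_1). nra.
- assert (E : 0 < - a / (2 * k)) by (apply Rdiv_lt_0_compat; lra).
  specialize (H _ E). replace (- (- a / (2 * k)) * k) with (a / 2) in H by (field; lra). lra.
Qed.

(** e^{c x} is a stationary solution, and t - t0 makes the inequality strict. The factors 1 give it
    the shape expected by [jcont_comb] and [jcont_prod]. *)
Definition barrier (c t0 : R) (x t : R) : R := 1 * (exp (c * x) * 1) + 1 * (1 * (t - t0)).

Lemma barrier_jcont (c t0 : R) : jcont (barrier c t0).
Proof.
apply (jcont_comb 1 1 (fun x t => exp (c * x) * 1) (fun x t => 1 * (t - t0))).
- apply (jcont_prod (fun x => exp (c * x)) (fun _ => 1)); [apply cont_exp_scal|apply cont_const].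
- apply (jcont_prod (fun _ => 1) (fun t => t - t0)); [apply cont_const|].
  apply (cont_derive _ (fun _ => 1)). intros s. auto_derive; [auto|ring].
Qed.

Lemma barrier_super (c t0 : R) : strict_super c (barrier c t0).
Proof.
exists (fun x t => c * exp (c * x)), (fun x t => c * c * exp (c * x)), (fun x t => 1).
intros x t Hx. unfold barrier. split; [|split; [|split]].
- auto_derive; [auto|ring].
- auto_derive; [auto|ring].
- auto_derive; [auto|ring].
- lra.
Qed.

Lemma exp_dominates (c B mu x : R) : 0 < c -> 0 < mu -> exists X, 0 < X /\ x <= X /\ B * exp (c * X / 2) <= mu * exp (c * X).
Proof.
intros Hc Hmu.
exists (1 + Rabs x + Rabs B * 2 / (mu * c)).
assert (Hmc : 0 < mu * c) by nra.
generalize (Rabs_pos x) (Rabs_pos B) (Rle_abs x) (Rle_abs B). intros H1 H2 H3 H4.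
assert (0 <= Rabs B * 2 / (mu * c)) by (apply Rdiv_le_0_compat; lra).
split; [lra|]. split; [lra|].
set (X := 1 + Rabs x + Rabs B * 2 / (mu * c)).
replace (c * X) with (c * X / 2 + c * X / 2) at 2 by field. rewrite exp_plus.
generalize (exp_pos (c * X / 2)) (exp_ineq1_le (c * X / 2)). intros E1 E2.
rewrite <- Rmult_assoc. apply Rmult_le_compat_r; [lra|].
apply Rle_trans with (mu * (c * X / 2)); [|apply Rmult_le_compat_l; lra].
apply Rle_trans with (mu * (c * (Rabs B * 2 / (mu * c)) / 2)).
- replace (mu * (c * (Rabs B * 2 / (mu * c)) / 2)) with (Rabs B) by (field; lra). lra.
- apply Rmult_le_compat_l; [lra|]. unfold Rdiv at 1 3. apply Rmult_le_compat_r; [lra|].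
  apply Rmult_le_compat_l; [lra|]. unfold X. lra.
Qed.

Section MaxPrinciples.
Context (c : R) (Hc : 0 < c).

Definition decay (t0 : R) (x t : R) : R := exp (c / 2 * x) * exp (- (c * c / 4) * (t - t0)).

Lemma decay_jcont (t0 : R) : jcont (decay t0).
Proof.
apply (jcont_prod (fun x => exp (c / 2 * x)) (fun t => exp (- (c * c / 4) * (t - t0)))).
- apply cont_exp_scal.
- apply (cont_derive _ (fun s => - (c * c / 4) * exp (- (c * c / 4) * (s - t0)))). intros s. auto_derive; [auto|].
  replace (s + - t0) with (s - t0) by ring. ring.
Qed.

Lemma decay_heat (t0 : R) : heat c (decay t0).
Proof.
exists (fun x t => c / 2 * decay t0 x t), (fun x t => c / 2 * (c / 2 * decay t0 x t)), (fun x t => - (c * c / 4) * decay t0 x t).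
intros x t Hx.
assert (D : is_derive (fun y => decay t0 y t) x (c / 2 * decay t0 x t)).
{ unfold decay. auto_derive; [auto|ring]. }
split; [|split; [|split]].
- exact D.
- apply is_derive_R_scal, D.
- unfold decay. auto_derive; [auto|]. replace (t + - t0) with (t - t0) by ring. ring.
- field.
Qed.

(** Adding |B| times [decay t0] makes w nonnegative at time t0, and a small multiple of [barrier]
    takes care of large x. Then t0 -> -oo: at a fixed point the added term is O(e^{-c^2 (t - t0) /
    4}). *)
Lemma dirichlet_past (w : R -> R -> R) (B T : R) : jcont w -> heat c w ->
  (forall t, t <= T -> 0 <= w 0 t) -> (forall x t, 0 <= x -> t <= T -> - B * exp (c * x / 2) <= w x t) ->
  forall x t, 0 <= x -> t <= T -> 0 <= w x t.
Proof.
intros Cw Hw Hw0 HB x t Hx HtT.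
assert (HB' : forall x t, 0 <= x -> t <= T -> - Rabs B * exp (c * x / 2) <= w x t).
{ intros x' t' Hx' Ht'. apply Rle_trans with (2 := HB x' t' Hx' Ht'). generalize (exp_pos (c * x' / 2)) (Rle_abs B). nra. }
generalize (Rabs_pos B). set (B' := Rabs B) in *. intros HB0.
assert (K : forall t0, t0 <= t -> 0 <= w x t + B' * decay t0 x t).
{ intros t0 Ht0.
  apply (small_multiple_nonneg _ (barrier c t0 x t)). intros mu Hmu.
  destruct (exp_dominates c B' mu x Hc Hmu) as [X [HX0 [HxX HX]]].
  replace (w x t + B' * decay t0 x t) with (1 * w x t + B' * decay t0 x t) by ring.
  assert (Hbp : forall x s, 0 <= x -> t0 <= s -> 0 < barrier c t0 x s).
  { intros x' s _ Hs. unfold barrier. generalize (exp_pos (c * x')). lra. }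
  assert (Hdp : forall x s, 0 < decay t0 x s) by (intros; unfold decay; apply Rmult_lt_0_compat; apply exp_pos).
  apply (max_principle_rect c X t0 t mu (fun x t => 1 * w x t + B' * decay t0 x t) (barrier c t0)); auto; try lra.
  - apply jcont_comb; auto using decay_jcont.
  - apply barrier_jcont.
  - apply heat_comb; auto using decay_heat.
  - apply barrier_super.
  - intros x' s Hx' Hs. apply Hbp; lra.
  - intros x' Hx'. specialize (HB' x' t0 (proj1 Hx') ltac:(lra)). specialize (Hbp x' t0 (proj1 Hx') (Rle_refl _)).
    unfold decay. replace (- (c * c / 4) * (t0 - t0)) with 0 by ring. rewrite exp_0.
    replace (c / 2 * x') with (c * x' / 2) by field. nra.
  - intros s Hs. specialize (HB' X s (Rlt_le _ _ HX0) ltac:(lra)). specialize (Hdp X s).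
    assert (mu * exp (c * X) <= mu * barrier c t0 X s).
    { apply Rmult_le_compat_l; [lra|]. unfold barrier. lra. }
    nra.
  - intros s nu Hs Hnu E _. specialize (Hw0 s ltac:(lra)). specialize (Hdp 0 s). specialize (Hbp 0 s (Rle_refl _) ltac:(lra)). nra. }
apply Rnot_lt_le. intros Hlt.
destruct (exp_neg_small (B' * exp (c / 2 * x)) (c * c / 4) ltac:(nra) (- w x t) ltac:(lra)) as [A [HA HA']].
specialize (HA' A (Rle_refl _)). specialize (K (t - A) ltac:(lra)). unfold decay in K.
replace (t - (t - A)) with A in K by ring.
rabs_lra.
Qed.

Lemma dirichlet_entire (w : R -> R -> R) (B : R) : jcont w -> heat c w ->
  (forall t, 0 <= w 0 t) -> (forall x t, 0 <= x -> - B * exp (c * x / 2) <= w x t) ->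
  forall x t, 0 <= x -> 0 <= w x t.
Proof. intros Cw Hw Hw0 HB x t Hx. apply (dirichlet_past w B t); auto. lra. Qed.

Definition sine_mode (L t0 : R) (x t : R) : R :=
  (exp (c / 2 * x) * sin (PI / L * x)) * exp (- (c * c / 4 + (PI / L) * (PI / L)) * (t - t0)).

Lemma sine_mode_heat (L t0 : R) : heat c (sine_mode L t0).
Proof.
set (k := PI / L).
pose (e := fun t => exp (- (c * c / 4 + k * k) * (t - t0))).
exists (fun x t => exp (c / 2 * x) * (c / 2 * sin (k * x) + k * cos (k * x)) * e t),
  (fun x t => exp (c / 2 * x) * (c * c / 4 * sin (k * x) + c * k * cos (k * x) - k * k * sin (k * x)) * e t),
  (fun x t => - (c * c / 4 + k * k) * (exp (c / 2 * x) * sin (k * x) * e t)).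
intros x t Hx. unfold sine_mode. fold k. fold (e t). split; [|split; [|split]].
- auto_derive; [auto|]. ring.
- auto_derive; [auto|]. field.
- unfold e. auto_derive; [auto|]. replace (t + - t0) with (t - t0) by ring. ring.
- field.
Qed.

Lemma sine_mode_jcont (L t0 : R) : jcont (sine_mode L t0).
Proof.
apply (jcont_prod (fun x => exp (c / 2 * x) * sin (PI / L * x))
   (fun t => exp (- (c * c / 4 + (PI / L) * (PI / L)) * (t - t0)))).
- apply (cont_derive _ (fun x => exp (c / 2 * x) * (c / 2 * sin (PI / L * x) + PI / L * cos (PI / L * x)))).
  intros s. auto_derive; [auto|ring].
- set (k := - (c * c / 4 + (PI / L) * (PI / L))).
  apply (cont_derive _ (fun s => k * exp (k * (s - t0)))). intros s. auto_derive; [auto|].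
  replace (s + - t0) with (s - t0) by ring. ring.
Qed.

(* Hopf's lemma, with an explicit decaying Dirichlet mode of (0, L) as barrier. *)
Lemma hopf_rect (z : R -> R -> R) (L t0 t1 eps : R) : 0 < L -> t0 <= t1 -> 0 < eps ->
  jcont z -> heat c z ->
  (forall x t, 0 <= x -> t0 <= t <= t1 -> 0 <= z x t) -> (forall x, 0 <= x <= L -> eps <= z x t0) ->
  exists k, 0 < k /\ forall x, 0 <= x <= L -> k * sin (PI / L * x) <= z x t1.
Proof.
intros HL Ht He Cz Hz Hz0 Hb.
(* Chosen so that k times the mode is at most eps on [0, L] at time t0. *)
pose (k := eps * exp (- (c * L / 2))).
assert (Hk : 0 < k) by (apply Rmult_lt_0_compat; auto using exp_pos).
pose (r := exp (- (c * c / 4 + PI / L * (PI / L)) * (t1 - t0))).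
exists (k * r). split; [apply Rmult_lt_0_compat; auto; apply exp_pos|].
assert (Hsin : forall x, 0 <= x <= L -> 0 <= sin (PI / L * x)).
{ intros x Hx. generalize PI_RGT_0; intros HPI. apply sin_ge_0.
  - apply Rmult_le_pos; [apply Rdiv_le_0_compat; lra|lra].
  - apply Rmult_le_reg_r with L; [lra|]. replace (PI / L * x * L) with (PI * x) by (field; lra). nra. }
intros x Hx.
assert (K : 0 <= 1 * z x t1 + - k * sine_mode L t0 x t1).
{ apply (small_multiple_nonneg _ (barrier c t0 x t1)). intros mu Hmu.
  assert (Hbp : forall x s, 0 <= x -> t0 <= s -> 0 < barrier c t0 x s).
  { intros x' s _ Hs. unfold barrier. generalize (exp_pos (c * x')). lra. }
  apply (max_principle_rect c L t0 t1 mu (fun x t => 1 * z x t + - k * sine_mode L t0 x t) (barrier c t0)); auto; try lra.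
  - apply jcont_comb; auto using sine_mode_jcont.
  - apply barrier_jcont.
  - apply heat_comb; auto using sine_mode_heat.
  - apply barrier_super.
  - intros x' s Hx' Hs. apply Hbp; lra.
  - intros x' Hx'. specialize (Hb x' Hx'). specialize (Hbp x' t0 (proj1 Hx') (Rle_refl _)).
    unfold sine_mode. replace (t0 - t0) with 0 by ring. rewrite Rmult_0_r, exp_0.
    assert (E : k * (exp (c / 2 * x') * sin (PI / L * x') * 1) <= eps).
    { unfold k. replace (eps * exp (- (c * L / 2)) * (exp (c / 2 * x') * sin (PI / L * x') * 1))
        with (eps * ((exp (- (c * L / 2)) * exp (c / 2 * x')) * sin (PI / L * x'))) by ring.
      rewrite <- exp_plus.
      assert (exp (- (c * L / 2) + c / 2 * x') <= 1) by (apply exp_le_1; nra).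
      generalize (exp_pos (- (c * L / 2) + c / 2 * x')) (Hsin x' Hx') (SIN_bound (PI / L * x')). intros.
      assert (exp (- (c * L / 2) + c / 2 * x') * sin (PI / L * x') <= 1) by nra. nra. }
    nra.
  - intros s Hs. specialize (Hz0 L s (Rlt_le _ _ HL) Hs). specialize (Hbp L s (Rlt_le _ _ HL) (proj1 Hs)).
    unfold sine_mode. replace (PI / L * L) with PI by (field; lra). rewrite sin_PI. nra.
  - intros s nu Hs Hnu E _. specialize (Hz0 0 s (Rle_refl _) ltac:(lra)). specialize (Hbp 0 s (Rle_refl _) ltac:(lra)).
    unfold sine_mode in E. rewrite !Rmult_0_r, sin_0 in E. nra. }
unfold sine_mode in K. fold r in K.
assert (E1 : 1 <= exp (c / 2 * x)) by (apply exp_ge_1; nra).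
specialize (Hsin x Hx). assert (0 < r) by apply exp_pos.
assert (k * r * sin (PI / L * x) <= k * (exp (c / 2 * x) * sin (PI / L * x) * r)).
{ replace (k * (exp (c / 2 * x) * sin (PI / L * x) * r)) with (exp (c / 2 * x) * (k * r * sin (PI / L * x))) by ring.
  rewrite <- (Rmult_1_l (k * r * sin (PI / L * x))) at 1. apply Rmult_le_compat_r; [|exact E1].
  apply Rmult_le_pos; [apply Rmult_le_pos; lra|auto]. }
lra.
Qed.

(** The flux is constrained only at times where w is negative at the boundary; the slope bound there
    is what a Lipschitz boundary flux provides for the difference of two solutions. *)
Lemma neumann_comparison (w : R -> R -> R) (t0 t1 B Lam : R) : t0 <= t1 -> 0 <= Lam ->
  jcont w -> heat c w ->
  (forall x t, 0 <= x -> t0 <= t <= t1 -> - B * exp (c * x / 2) <= w x t) ->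
  (forall x, 0 <= x -> 0 <= w x t0) ->
  (forall t, t0 < t <= t1 -> w 0 t < 0 ->
     exists D, is_derive (fun x => w x t) 0 D /\ D <= Lam * (- w 0 t)) ->
  forall x t, 0 <= x -> t0 <= t <= t1 -> 0 <= w x t.
Proof.
intros Ht HLam Cw Hw HB Hb Hflux x t Hx Htt.
(* A and a satisfy Lam (1 + A) + c - a A = -1, so at x = 0 the slope of [phi] lies below -Lam [phi],
   which excludes a negative minimum of w / [phi] there. M exceeds by 1 the value a^2 + c a that the
   spatial operator takes on e^{-a x}. *)
pose (A := Lam + c + 1). pose (a := Lam + 1). pose (M := a * a + c * a + 1).
pose (phi := fun x t => (exp (c * x) + A * exp (- a * x)) * exp (M * (t - t0))).
assert (HA : 0 < A) by (unfold A; lra). assert (Ha : 0 < a) by (unfold a; lra).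
assert (Hphi : forall x s, exp (c * x) * exp (M * (s - t0)) < phi x s).
{ intros x' s. unfold phi. apply Rmult_lt_compat_r; [apply exp_pos|]. generalize (exp_pos (- a * x')). nra. }
assert (Hphi0 : forall x s, 0 < phi x s).
{ intros x' s. apply Rlt_trans with (2 := Hphi x' s). apply Rmult_lt_0_compat; apply exp_pos. }
assert (Dphi : forall x s, is_derive (fun y => phi y s) x ((c * exp (c * x) - a * A * exp (- a * x)) * exp (M * (s - t0)))).
{ intros x' s. unfold phi. auto_derive; [auto|]. replace (s + - t0) with (s - t0) by ring. ring. }
apply (small_multiple_nonneg _ (phi x t)). intros mu Hmu.
destruct (exp_dominates c B mu x Hc Hmu) as [X [HX0 [HxX HX]]].
apply (max_principle_rect c X t0 t1 mu w phi); auto; try lra.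
- apply (jcont_prod (fun x => exp (c * x) + A * exp (- a * x)) (fun t => exp (M * (t - t0)))).
  + apply (cont_plus (fun x => exp (c * x)) (fun x => A * exp (- a * x))); [apply (cont_exp_scal c)|apply (cont_scal A), (cont_exp_scal (- a))].
  + apply (cont_derive _ (fun s => M * exp (M * (s - t0)))). intros s. auto_derive; [auto|].
    replace (s + - t0) with (s - t0) by ring. ring.
- exists (fun x s => (c * exp (c * x) - a * A * exp (- a * x)) * exp (M * (s - t0))),
    (fun x s => (c * c * exp (c * x) + a * a * A * exp (- a * x)) * exp (M * (s - t0))),
    (fun x s => M * phi x s).
  intros x' s Hx'. split; [|split; [|split]].
  + apply Dphi.
  + auto_derive; [auto|]. replace (s + - t0) with (s - t0) by ring. ring.
  + unfold phi. auto_derive; [auto|]. replace (s + - t0) with (s - t0) by ring. ring.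
  + unfold phi. generalize (exp_pos (c * x')) (exp_pos (- a * x')) (exp_pos (M * (s - t0))).
    set (e1 := exp (c * x')). set (e2 := exp (- a * x')). set (e3 := exp (M * (s - t0))). intros P1 P2 P3.
    replace ((c * c * e1 + a * a * A * e2) * e3 - c * ((c * e1 - a * A * e2) * e3)) with ((a * a + c * a) * (A * e2) * e3) by ring.
    replace (M * ((e1 + A * e2) * e3)) with (M * (e1 + A * e2) * e3) by ring.
    apply Rmult_lt_compat_r; [auto|].
    assert (0 < A * e2) by nra. assert (0 < M) by (unfold M; nra). unfold M in *. nra.
- intros x' Hx'. specialize (Hb x' (proj1 Hx')). specialize (Hphi0 x' t0). nra.
- intros s Hs. specialize (HB X s (Rlt_le _ _ HX0) Hs). specialize (Hphi X s).
  assert (1 <= exp (M * (s - t0))) by (apply exp_ge_1; apply Rmult_le_pos; [unfold M; nra|lra]).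
  generalize (exp_pos (c * X)); intros Hex.
  assert (exp (c * X) <= phi X s) by nra.
  assert (mu * exp (c * X) <= mu * phi X s) by (apply Rmult_le_compat_l; lra). lra.
- intros s nu Hs Hnu E Hmin.
  assert (Hneg : w 0 s < 0) by (specialize (Hphi0 0 s); nra).
  destruct (Hflux s Hs Hneg) as [D [HD HD']].
  specialize (Dphi 0 s). rewrite !Rmult_0_r, exp_0, !Rmult_1_r in Dphi.
  set (e3 := exp (M * (s - t0))) in *. assert (He3 : 0 < e3) by apply exp_pos.
  assert (Ephi : phi 0 s = (1 + A) * e3) by (unfold phi; rewrite !Rmult_0_r, exp_0; fold e3; ring).
  assert (Hd : is_derive (fun x => w x s + nu * phi x s) 0 (D + nu * ((c - a * A) * e3))).
  { apply is_derive_R_plus; [exact HD|apply is_derive_R_scal, Dphi]. }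
  rewrite E in HD'. rewrite Ephi in HD', E.
  assert (Hl : D + nu * ((c - a * A) * e3) < 0).
  { apply Rle_lt_trans with (Lam * - (- nu * ((1 + A) * e3)) + nu * ((c - a * A) * e3)); [lra|].
    replace (Lam * - (- nu * ((1 + A) * e3)) + nu * ((c - a * A) * e3)) with (nu * e3 * (Lam * (1 + A) + c - a * A)) by ring.
    replace (Lam * (1 + A) + c - a * A) with (-1) by (unfold a, A; ring).
    assert (0 < nu * e3) by (apply Rmult_lt_0_compat; lra). lra. }
  apply is_derive_Reals in Hd. destruct (Hd (- (D + nu * ((c - a * A) * e3))) ltac:(lra)) as [del Hdel].
  pose (k := Rmin X del / 2).
  assert (Hk : 0 < k /\ k < X /\ k < del).
  { unfold k. assert (0 < Rmin X del) by (apply Rmin_pos; [auto|apply cond_pos]).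
    generalize (Rmin_l X del) (Rmin_r X del). lra. }
  specialize (Hdel k ltac:(lra)). rewrite (Rabs_right k) in Hdel by lra. specialize (Hdel ltac:(lra)).
  rewrite Rplus_0_l in Hdel. specialize (Hmin k ltac:(lra)). rewrite E, Ephi in Hdel.
  assert (0 <= (w k s + nu * phi k s - (- nu * ((1 + A) * e3) + nu * ((1 + A) * e3))) / k).
  { apply Rdiv_le_0_compat; lra. }
  rabs_lra.
Qed.
End MaxPrinciples.

(** * Boundary traces and fluxes *)

Lemma x_le_exp (c x : R) : 0 < c -> 0 <= x -> x <= 2 / c * exp (c * x / 2).
Proof.
intros Hc Hx. generalize (exp_ineq1_le (c * x / 2)). intros H.
apply Rle_trans with (2 / c * (c * x / 2)); [right; field; lra|].
apply Rmult_le_compat_l; [apply Rlt_le, Rdiv_lt_0_compat; lra|lra].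
Qed.

Section Bsol.
Context (c : R) (Hc : 0 < c).

(* The boundary trace [b] and flux [g] of an entire solution: b + J[g] is the weighted mass
   int_0^oo c e^{-c x} u dx, whose time derivative is - c g. *)
Record bsol (b g : R -> R) : Prop := {
  bs_b : cont b;
  bs_g : bdd 2 g;
  bs_pos : forall t, 0 <= g t;
  bs_eq : forall t1 t2, b t2 + J c g t2 = b t1 + J c g t1 - c * RInt g t1 t2 }.

Definition U (b g : R -> R) (x t : R) : R := b t + V c g x t.

Lemma V_0 (g : R -> R) (t : R) : V c g 0 t = 0.
Proof. unfold V. rewrite RInt_point. reflexivity. Qed.

Lemma U_0 (b g : R -> R) (t : R) : U b g 0 t = b t.
Proof. unfold U. rewrite V_0. ring. Qed.

Lemma V_ge0 (B : R) (g : R -> R) (x t : R) : bdd B g -> (forall s, s <= t -> 0 <= g s) -> 0 <= x -> 0 <= V c g x t.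
Proof.
intros Hg Hp Hx. apply RInt_nonneg_cont; [auto|now apply (q_cont_x c Hc B)|].
intros s _. now apply (q_ge0 c Hc B).
Qed.

(** Time increments of V are integrals of potentials of time increments of g, small by
    [shift_small]; increments in x cost at most B times the distance. *)
Lemma U_jcont (B : R) (b g : R -> R) : cont b -> bdd B g -> jcont (U b g).
Proof.
intros Hb Hg x t Hx eps He. assert (HB := bdd_pos _ _ Hg).
destruct (proj1 (continuous_eps b t) (Hb t) (eps / 4)) as [d1 [Hd1 H1]]; [lra|].
pose (eta := eps / 4 / ((x + 1) * exp (c * (x + 1) / 4))).
assert (Hden : 0 < (x + 1) * exp (c * (x + 1) / 4)) by (apply Rmult_lt_0_compat; [lra|apply exp_pos]).
assert (Heta : 0 < eta) by (apply Rdiv_lt_0_compat; lra).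
destruct (shift_small c Hc B g t eta Hg Heta) as [d2 [Hd2 H2]].
exists (Rmin (Rmin 1 (eps / 4 / (B + 1))) (Rmin d1 d2)).
assert (He4 : 0 < eps / 4 / (B + 1)) by (apply Rdiv_lt_0_compat; lra).
split; [repeat apply Rmin_pos; lra|]. intros x' t' Hx' Hxx Htt.
assert (M1 := Rmin_l (Rmin 1 (eps / 4 / (B + 1))) (Rmin d1 d2)).
assert (M2 := Rmin_r (Rmin 1 (eps / 4 / (B + 1))) (Rmin d1 d2)).
assert (M3 := Rmin_l 1 (eps / 4 / (B + 1))). assert (M4 := Rmin_r 1 (eps / 4 / (B + 1))).
assert (M5 := Rmin_l d1 d2). assert (M6 := Rmin_r d1 d2).
specialize (H1 t' ltac:(lra)).
assert (Hxl : x' <= x + 1) by (apply Rnot_lt_le; intros Hlt; assert (Rabs (x' - x) < 1) by lra; apply Rabs_def2 in H; lra).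
assert (E1 : Rabs (V c g x' t' - V c g x' t) <= eps / 4).
{ unfold V. rewrite <- RInt_minus_cont by (now apply (q_cont_x c Hc B)).
  apply Rle_trans with (eta * exp (c * (x + 1) / 4) * Rabs (x' - 0)).
  - apply RInt_abs_le; [apply cont_minus; now apply (q_cont_x c Hc B)|].
    intros z Hz. rewrite Rmin_left, Rmax_right in Hz by lra.
    replace (q c g z t' - q c g z t) with (q c (fun r => g (r + (t' - t)) - g r) z t).
    2:{ rewrite (q_minus c Hc B B (fun r => g (r + (t' - t))) g z t (bdd_shift _ _ _ Hg) Hg), q_shift.
        now replace (t + (t' - t)) with t' by ring. }
    apply Rle_trans with (eta * exp (c * z / 4)).
    + apply q_weighted; auto; [|lra|].
      * apply bdd_minus with (B := B) (B' := B); auto using bdd_shift.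
      * intros s Hs. replace (t - s + (t' - t)) with (t' - s) by ring. apply H2; auto. lra.
    + apply Rmult_le_compat_l; [lra|]. apply exp_le. unfold Rdiv. apply Rmult_le_compat_r; [lra|].
      apply Rmult_le_compat_l; lra.
  - rewrite Rminus_0_r, Rabs_right by lra.
    apply Rle_trans with (eta * exp (c * (x + 1) / 4) * (x + 1)).
    + apply Rmult_le_compat_l; [apply Rmult_le_pos; [lra|apply Rlt_le, exp_pos]|lra].
    + right. unfold eta. field. split; [apply Rgt_not_eq, exp_pos|lra]. }
assert (E2 : Rabs (V c g x' t - V c g x t) <= eps / 4).
{ unfold V. rewrite <- (RInt_Chasles_cont (fun z => q c g z t) 0 x x') by (now apply (q_cont_x c Hc B)).
  match goal with |- Rabs ?a <= _ => replace a with (RInt (fun z => q c g z t) x x') by lra end.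
  apply Rle_trans with (B * Rabs (x' - x)).
  - apply RInt_abs_le; [now apply (q_cont_x c Hc B)|]. intros; now apply q_abs_le.
  - apply Rle_trans with ((B + 1) * (eps / 4 / (B + 1))); [|right; field; lra].
    apply Rmult_le_compat; auto using Rabs_pos; lra. }
unfold U. rabs_lra.
Qed.

(** The mass law of [bsol] cancels the increments of b and J in [potential_increment]. This makes U
    differentiable in time for x > 0, although b is only continuous. *)
Lemma U_increment (b g : R -> R) (x t tau : R) : bsol b g -> 0 < x ->
  U b g x (t + tau) - U b g x t = q1 c (window g tau) x t - c * q c (window g tau) x t.
Proof.
intros Hs Hx. rewrite (potential_increment c Hc 2 g tau x t (bs_g _ _ Hs) Hx).
unfold U, window. generalize (bs_eq _ _ Hs t (t + tau)). lra.
Qed.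

Lemma window_quotient (B : R) (g : R -> R) (t eta : R) : bdd B g -> 0 < eta -> exists d, 0 < d /\
  forall h, h <> 0 -> Rabs h < d -> forall s, 0 <= s ->
    Rabs (/ h * window g h (t - s) - g (t - s)) <= eta * exp (lam c * s).
Proof.
intros Hg He. destruct (shift_small c Hc B g t eta Hg He) as [d [Hd H]].
exists d. split; auto. intros h Hh0 Hh s Hs.
destruct (MVT_gen (fun y => RInt g 0 y) (t - s) (t - s + h) g) as [z [Hz Hz']].
- intros y _. apply is_derive_RInt_cont, Hg.
- intros y _. apply continuity_pt_filterlim. eapply is_derive_R_continuous, is_derive_RInt_cont, Hg.
- rewrite window_eq by apply Hg. rewrite Hz'.
  replace (/ h * (g z * (t - s + h - (t - s)))) with (g z) by (field; auto).
  replace z with ((z + s) - s) by ring. apply H; auto.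
  unfold Rmin, Rmax in Hz. apply Rabs_def2 in Hh. apply Rabs_def1; destruct (Rle_dec _ _); lra.
Qed.

(** Divide [U_increment] by the step: the window quotient tends to g in the weighted sense. Since
    [q] is u_x and [q1] is u_xx, the limit is the right-hand side of the equation. *)
Lemma U_derive_t (b g : R -> R) (x t : R) : bsol b g -> 0 < x ->
  is_derive (fun t => U b g x t) t (q1 c g x t - c * q c g x t).
Proof.
intros Hs Hx. assert (Hg := bs_g _ _ Hs). apply is_derive_Reals. intros eps He.
destruct (q12_weighted c Hc x x Hx) as [C [HC HC']].
generalize (exp_pos (c * x / 4)); intros Hex.
pose (M := C + c * exp (c * x / 4)). assert (HM : 0 < M) by (unfold M; nra).
destruct (window_quotient 2 g t (eps / 2 / M) Hg) as [d [Hd H]]; [apply Rdiv_lt_0_compat; lra|].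
exists (mkposreal d Hd). intros h Hh0 Hh. simpl in Hh.
rewrite U_increment by auto.
assert (HW := window_bdd 2 h g Hg).
assert (HWs : bdd (Rabs (/ h) * (2 * Rabs h)) (fun r => / h * window g h r)).
{ split; [apply cont_scal, HW|]. intros r. rewrite Rabs_mult. apply Rmult_le_compat_l; [apply Rabs_pos|apply HW]. }
assert (HD : cont (fun r => / h * window g h r - g r)) by (apply cont_minus; [apply HWs|apply Hg]).
assert (E1 : q1 c (fun r => / h * window g h r - g r) x t = / h * q1 c (window g h) x t - q1 c g x t).
{ rewrite (q1_minus c Hc _ _ _ g x t Hx HWs Hg), (q1_scal c Hc _ (/ h) (window g h) x t Hx HW). reflexivity. }
assert (E0 : q c (fun r => / h * window g h r - g r) x t = / h * q c (window g h) x t - q c g x t).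
{ rewrite (q_minus c Hc _ _ _ g x t HWs Hg), (q_scal c Hc _ (/ h) (window g h) x t HW). reflexivity. }
replace ((q1 c (window g h) x t - c * q c (window g h) x t) / h - (q1 c g x t - c * q c g x t)) with
  (q1 c (fun r => / h * window g h r - g r) x t - c * q c (fun r => / h * window g h r - g r) x t)
  by (rewrite E1, E0; field; auto).
assert (F1 : Rabs (q1 c (fun r => / h * window g h r - g r) x t) <= C * (eps / 2 / M)).
{ refine (proj1 (HC' (fun r => / h * window g h r - g r) x t (eps / 2 / M) HD _ _)); [lra|].
  intros s Hss. now apply H. }
assert (F0 : Rabs (q c (fun r => / h * window g h r - g r) x t) <= eps / 2 / M * exp (c * x / 4)).
{ apply (q_weighted c Hc); [exact HD|lra|]. intros s Hss. now apply H. }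
set (a1 := q1 c (fun r => / h * window g h r - g r) x t) in *.
set (a0 := q c (fun r => / h * window g h r - g r) x t) in *.
apply Rabs_le_between in F1, F0.
assert (Heq : C * (eps / 2 / M) + c * (eps / 2 / M * exp (c * x / 4)) = eps / 2) by (unfold M; field; unfold M in HM; lra).
apply Rabs_def1; nra.
Qed.

Lemma U_derive_x (B : R) (b g : R -> R) (x t : R) : bdd B g ->
  is_derive (fun x => U b g x t) x (q c g x t).
Proof.
intros Hg. eapply is_derive_R_eq; [apply (is_derive_R_plus (fun _ => b t) (fun x => V c g x t)); [apply is_derive_R_const|now apply (V_derive c Hc B)]|ring].
Qed.

Lemma U_heat (b g : R -> R) : bsol b g -> heat c (U b g).
Proof.
intros Hs. assert (Hg := bs_g _ _ Hs).
exists (q c g), (q1 c g), (fun x t => q1 c g x t - c * q c g x t). intros x t Hx.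
split; [|split; [|split]].
- now apply (U_derive_x 2).
- exact (proj1 (q_derive_x c Hc 2 g x t Hg Hx)).
- now apply U_derive_t.
- reflexivity.
Qed.

Lemma U_bounds (b g : R -> R) (x t : R) : bsol b g -> 0 <= x -> b t <= U b g x t <= b t + 2 * x.
Proof.
intros Hs Hx. assert (Hg := bs_g _ _ Hs). unfold U.
assert (H1 := V_ge0 2 g x t Hg (fun s _ => bs_pos _ _ Hs s) Hx).
assert (H2 := V_abs_le c Hc 2 g x t Hg). rewrite (Rabs_right x) in H2 by lra.
rabs_lra.
Qed.

Lemma U_in_Yc (b g : R -> R) (t : R) : bsol b g -> in_Yc c (fun x => U b g x t).
Proof.
intros Hs. assert (Hg := bs_g _ _ Hs). unfold in_Yc.
pose (w := fun x => exp (- c * x / 2) * U b g x t).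
pose (M := Rabs (b t) + 4 / c). 
assert (H4c : 0 < 4 / c) by (apply Rdiv_lt_0_compat; lra).
assert (HM : forall x, 0 <= x -> Rabs (w x) <= M).
{ intros x Hx. unfold w, M. assert (Hb := U_bounds b g x t Hs Hx).
  rewrite Rabs_mult, Rabs_exp.
  assert (E1 : exp (- c * x / 2) * exp (c * x / 2) = 1) by (rewrite <- exp_plus; replace (- c * x / 2 + c * x / 2) with 0 by field; apply exp_0).
  assert (E2 : exp (- c * x / 2) <= 1) by (apply exp_le_1; nra).
  generalize (exp_pos (- c * x / 2)). intros E3.
  assert (E4 := x_le_exp c x Hc Hx).
  assert (E5 : Rabs (U b g x t) <= Rabs (b t) + 2 * x).
  { generalize (Rle_abs (b t)) (Rle_abs (- b t)). rewrite Rabs_Ropp. intros. apply Rabs_le_between. lra. }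
  apply Rle_trans with (exp (- c * x / 2) * (Rabs (b t) + 2 * x)); [apply Rmult_le_compat_l; lra|].
  assert (exp (- c * x / 2) * x <= 2 / c).
  { apply Rle_trans with (exp (- c * x / 2) * (2 / c * exp (c * x / 2))); [apply Rmult_le_compat_l; lra|].
    replace (exp (- c * x / 2) * (2 / c * exp (c * x / 2))) with (2 / c * (exp (- c * x / 2) * exp (c * x / 2))) by ring.
    rewrite E1. lra. }
  generalize (Rabs_pos (b t)). replace (4 / c) with (2 * (2 / c)) by (field; lra). nra. }
split; [exists M; exact HM|].
intros eps He. pose (K := c / 2 * M + 2).
assert (HM0 : 0 <= M) by (unfold M; generalize (Rabs_pos (b t)); lra).
assert (HK : 0 < K) by (unfold K; nra).
exists (eps / K). split; [now apply Rdiv_lt_0_compat|]. intros x y Hx Hy Hxy. fold (w x). fold (w y).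
destruct (MVT_gen w y x (fun z => - c / 2 * w z + exp (- c * z / 2) * q c g z t)) as [z [Hz Hz']].
- intros z _. eapply is_derive_R_eq.
  + apply (is_derive_R_mult (fun x => exp (- c * x / 2)) (fun x => U b g x t)); [|apply (U_derive_x 2 b g z t Hg)].
    assert (E : is_derive (fun x => exp (- c * x / 2)) z (- c / 2 * exp (- c * z / 2))) by (auto_derive; [auto|unfold Rdiv; field]). exact E.
  + unfold w. ring.
- intros z _. apply continuity_pt_filterlim. unfold w.
  apply (cont_mult (fun x => exp (- c * x / 2)) (fun x => U b g x t)).
  + apply (cont_derive _ (fun z => - c / 2 * exp (- c * z / 2))). intros s. auto_derive; [auto|unfold Rdiv; field].
  + apply (cont_derive _ (fun x => q c g x t)). intros s. now apply (U_derive_x 2).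
- assert (Hz0 : 0 <= z). { apply Rle_trans with (Rmin y x); [now apply Rmin_glb|lra]. }
  rewrite Hz', Rabs_mult.
  assert (E : Rabs (- c / 2 * w z + exp (- c * z / 2) * q c g z t) <= K).
  { apply Rle_trans with (1 := Rabs_triang _ _). rewrite !Rabs_mult.
    rewrite Rabs_exp.
    replace (Rabs (- c / 2)) with (c / 2).
    2:{ rewrite Rabs_left; lra. }
    assert (E2 : exp (- c * z / 2) <= 1) by (apply exp_le_1; nra).
    assert (E3 := q_abs_le c Hc 2 g z t Hg). specialize (HM z Hz0).
    generalize (exp_pos (- c * z / 2)) (Rabs_pos (q c g z t)) (Rabs_pos (w z)). unfold K. intros.
    assert (exp (- c * z / 2) * Rabs (q c g z t) <= 1 * 2) by (apply Rmult_le_compat; lra).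
    assert (c / 2 * Rabs (w z) <= c / 2 * M) by (apply Rmult_le_compat_l; lra). lra. }
  apply Rle_lt_trans with (K * Rabs (x - y)); [apply Rmult_le_compat_r; auto using Rabs_pos|].
  apply Rmult_lt_compat_l with (r := K) in Hxy; [|lra]. replace (K * (eps / K)) with eps in Hxy by (field; lra). exact Hxy.
Qed.

Lemma U_entire (theta : R) (h b g : R -> R) : bsol b g -> (forall t, g t = 1 + theta * h (b t)) ->
  entire_solution c theta h (U b g).
Proof.
intros Hs Hgb. assert (Hg := bs_g _ _ Hs).
exists (q c g), (q1 c g), (fun x t => q1 c g x t - c * q c g x t).
split; [|split; [|split; [|split; [|split; [|split; [|split; [|split; [|split]]]]]]]].
- exact (U_jcont 2 b g (bs_b _ _ Hs) Hg).
- intros x t _ eps He. destruct (q_cont c Hc 2 g x t eps Hg He) as [d [Hd H]]. exists d. split; auto.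
- intros x t Hx eps He. destruct (q1_cont c Hc 2 g x t eps Hg Hx He) as [d [Hd H]]. exists d. split; auto.
- intros x t Hx eps He.
  destruct (q1_cont c Hc 2 g x t (eps / 2) Hg Hx) as [d [Hd H]]; [lra|].
  destruct (q_cont c Hc 2 g x t (eps / 2 / c) Hg) as [d' [Hd' H']]; [repeat apply Rdiv_lt_0_compat; lra|].
  exists (Rmin d d'). split; [now apply Rmin_pos|]. intros x' t' _ Hxx Htt.
  assert (M1 := Rmin_l d d'). assert (M2 := Rmin_r d d').
  specialize (H x' t' ltac:(lra) ltac:(lra)). specialize (H' x' t' ltac:(lra) ltac:(lra)).
  apply Rabs_def2 in H. apply Rabs_def2 in H'.
  assert (E : c * (eps / 2 / c) = eps / 2) by (field; lra).
  apply Rabs_def1; nra.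
- intros x t _. now apply (U_derive_x 2).
- intros x t Hx. exact (proj1 (q_derive_x c Hc 2 g x t Hg Hx)).
- intros x t Hx. now apply U_derive_t.
- reflexivity.
- intros t. rewrite q_0, U_0. apply Hgb.
- intros t. now apply U_in_Yc.
Qed.

Lemma bsol_shift (b g : R -> R) (h : R) : bsol b g -> bsol (fun t => b (t + h)) (fun t => g (t + h)).
Proof.
intros [H1 H2 H3 H4]. split.
- now apply cont_shift_add.
- now apply bdd_shift.
- intros t. apply H3.
- intros t1 t2. rewrite !J_shift, (H4 (t1 + h) (t2 + h)). do 2 f_equal.
  apply Rplus_eq_reg_r with (- RInt g 0 (t2 + h) + RInt g 0 (t1 + h)).
  rewrite <- (RInt_Chasles_cont g (t1 + h) 0 (t2 + h)) by apply H2.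
  rewrite (RInt_swap_cont g 0 (t1 + h)) by apply H2.
  assert (E : forall y, RInt (fun t => g (t + h)) t1 y = RInt g 0 (y + h) - RInt g 0 (t1 + h)).
  { intros y. 
    assert (K : RInt (fun t => g (t + h)) t1 t1 - (RInt g 0 (t1 + h) - RInt g 0 (t1 + h)) =
                RInt (fun t => g (t + h)) t1 y - (RInt g 0 (y + h) - RInt g 0 (t1 + h))).
    { apply (const_of_derive0 (fun y => RInt (fun t => g (t + h)) t1 y - (RInt g 0 (y + h) - RInt g 0 (t1 + h)))).
      intros z _. eapply is_derive_R_eq.
      - apply is_derive_R_minus; [apply is_derive_RInt_cont, cont_shift_add, H2|].
        apply is_derive_R_minus; [|apply is_derive_R_const].
        apply (is_derive_R_comp (fun y => RInt g 0 y) (fun y => y + h) z (g (z + h)) 1).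
        + apply is_derive_RInt_cont, H2.
        + auto_derive; [auto|ring].
      - ring. }
    rewrite RInt_point in K. unfold zero in K; simpl in K. lra. }
  rewrite E. ring.
Qed.

Lemma V_shift (g : R -> R) (h x t : R) : V c (fun t => g (t + h)) x t = V c g x (t + h).
Proof. unfold V. apply RInt_ext. intros z _. apply q_shift. Qed.

Lemma U_shift (b g : R -> R) (h x t : R) : U (fun t => b (t + h)) (fun t => g (t + h)) x t = U b g x (t + h).
Proof. unfold U. now rewrite V_shift. Qed.

Lemma bsol_const (k : R) : bsol (fun _ => k) (fun _ => 0).
Proof.
split.
- apply cont_const.
- split; [apply cont_const|]. intros t. rewrite Rabs_R0. lra.
- intros; lra.
- intros t1 t2. rewrite !J_0, RInt_const_R by auto. ring.
Qed.

Lemma V_const0 (x t : R) : V c (fun _ => 0) x t = 0.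
Proof.
unfold V. rewrite (RInt_ext _ (fun _ => 0)).
- rewrite RInt_const_R. ring.
- intros z _. now apply q_const.
Qed.

Lemma U_const (k x t : R) : U (fun _ => k) (fun _ => 0) x t = k.
Proof. unfold U. rewrite V_const0. ring. Qed.
End Bsol.

(** * Classical solutions *)

Lemma incr_of_derive (f f' : R -> R) (a b : R) : a <= b ->
  (forall x, a <= x <= b -> is_derive f x (f' x)) -> (forall x, a <= x <= b -> 0 <= f' x) -> f a <= f b.
Proof.
intros Hab Hd Hp. destruct (MVT_gen f a b f') as [z [Hz Hz']].
- intros x Hx. rewrite Rmin_left, Rmax_right in Hx by lra. apply Hd; lra.
- intros x Hx. rewrite Rmin_left, Rmax_right in Hx by lra. apply continuity_pt_filterlim.
  eapply is_derive_R_continuous, Hd; lra.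
- rewrite Rmin_left, Rmax_right in Hz by lra. specialize (Hp z Hz). nra.
Qed.

(* A slope above D/c grows like e^{c x}, which is incompatible with the growth e^{c x / 2} of W. *)
Lemma slope_bound (c D M : R) (W p dl : R -> R) : 0 < c -> 0 <= D ->
  (forall x, 0 < x -> is_derive W x (p x)) -> (forall x, 0 < x -> is_derive p x (dl x + c * p x)) ->
  (forall x, 0 < x -> Rabs (dl x) <= D) -> (forall x, 0 < x -> Rabs (W x) <= M * exp (c * x / 2)) ->
  forall x, 0 < x -> p x <= D / c.
Proof.
intros Hc HD0 HW Hp Hdl HM x0 Hx0. apply Rnot_lt_le. intros Hlt.
pose (a := p x0 - D / c). assert (Ha : 0 < a) by (unfold a; lra).
assert (Hgrow : forall x, x0 <= x -> D / c + a * exp (c * (x - x0)) <= p x).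
{ intros x Hx.
  assert (K : exp (- c * x0) * (p x0 - D / c) <= exp (- c * x) * (p x - D / c)).
  { apply (incr_of_derive (fun x => exp (- c * x) * (p x - D / c)) (fun x => exp (- c * x) * (dl x + D))); auto.
    - intros y Hy. eapply is_derive_R_eq.
      + apply (is_derive_R_mult (fun x => exp (- c * x)) (fun x => p x - D / c)).
        * assert (E : is_derive (fun x => exp (- c * x)) y (- c * exp (- c * y))) by (auto_derive; [auto|ring]). exact E.
        * apply is_derive_R_minus; [apply Hp; lra|apply is_derive_R_const].
      + field. lra.
    - intros y Hy. apply Rmult_le_pos; [apply Rlt_le, exp_pos|].
      specialize (Hdl y ltac:(lra)). rabs_lra. }
  fold a in K. replace (c * (x - x0)) with (c * x + - c * x0) by ring. rewrite exp_plus.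
  assert (E1 : exp (c * x) * exp (- c * x) = 1) by (rewrite <- exp_plus; replace (c * x + - c * x) with 0 by ring; apply exp_0).
  apply Rmult_le_compat_l with (r := exp (c * x)) in K; [|apply Rlt_le, exp_pos].
  rewrite <- (Rmult_assoc (exp (c * x)) (exp (- c * x)) (p x - D / c)), E1 in K. lra. }
assert (HWg : forall x, x0 <= x -> W x0 - a / c <= W x - a / c * exp (c * (x - x0))).
{ intros x Hx. 
  assert (E0 : a / c * exp (c * (x0 - x0)) = a / c) by (replace (c * (x0 - x0)) with 0 by ring; rewrite exp_0; ring).
  rewrite <- E0 at 1.
  apply (incr_of_derive (fun x => W x - a / c * exp (c * (x - x0))) (fun x => p x - a * exp (c * (x - x0)))); auto.
  - intros y Hy. apply is_derive_R_minus; [apply HW; lra|]. 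
    eapply is_derive_R_eq; [apply (is_derive_R_scal (a / c) (fun y => exp (c * (y - x0))) y (c * exp (c * (y - x0))))|field; lra].
    auto_derive; [auto|]. replace (y + - x0) with (y - x0) by ring. ring.
  - intros y Hy. specialize (Hgrow y (proj1 Hy)).
    assert (0 <= D / c) by (apply Rdiv_le_0_compat; lra). lra. }
assert (HM0 : 0 <= M). { specialize (HM x0 Hx0). generalize (Rabs_pos (W x0)) (exp_pos (c * x0 / 2)). nra. }
assert (Hac : 0 < a / c) by now apply Rdiv_lt_0_compat.
destruct (exp_dominates c (2 * M + a / c + 1) (a / c * exp (- c * x0)) x0 Hc) as [X [HX0 [HX1 HX2]]].
{ apply Rmult_lt_0_compat; [auto|apply exp_pos]. }
specialize (HWg X HX1). assert (HA := HM X HX0). assert (HB := HM x0 Hx0).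
apply Rabs_le_between in HA, HB.
rewrite Rmult_assoc, <- exp_plus in HX2. replace (- c * x0 + c * X) with (c * (X - x0)) in HX2 by ring.
assert (exp (c * x0 / 2) <= exp (c * X / 2)) by (apply exp_le; nra).
assert (1 <= exp (c * X / 2)) by (apply exp_ge_1; nra).
nra.
Qed.

Section Classical.
Context (c : R) (Hc : 0 < c).

(** The window has the bounded derivative g (t + tau) - g t, so [q_derive_t] and [q_ibp] both apply
    to it. *)
Lemma q_window_heat (B tau : R) (g : R -> R) : bdd B g -> heat c (q c (window g tau)).
Proof.
intros Hg. assert (HW := window_bdd B tau g Hg).
assert (HD : bdd (B + B) (fun t => g (t + tau) - g t)) by (apply bdd_minus; auto using bdd_shift).
exists (q1 c (window g tau)), (q2 c (window g tau)), (q c (fun t => g (t + tau) - g t)).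
intros x t Hx. destruct (q_derive_x c Hc _ _ x t HW Hx) as [E1 E2].
assert (Hder : forall t, is_derive (window g tau) t (g (t + tau) - g t)) by (intros s; apply window_derive, Hg).
split; [exact E1|split; [exact E2|split]].
- apply (q_derive_t c Hc _ _ _ _ x t Hx HW HD Hder).
- assert (HW' : bdd (Rmax (B * Rabs tau) (B + B)) (window g tau)).
  { split; [apply HW|]. intros s. apply Rle_trans with (1 := proj2 HW s), Rmax_l. }
  assert (HD' : bdd (Rmax (B * Rabs tau) (B + B)) (fun t => g (t + tau) - g t)).
  { split; [apply HD|]. intros s. apply Rle_trans with (1 := proj2 HD s), Rmax_r. }
  apply (q_ibp c Hc _ _ _ x t Hx HW' HD' Hder).
Qed.

Lemma q_jcont (B : R) (g : R -> R) : bdd B g -> jcont (q c g).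
Proof.
intros Hg x t _ eps He. destruct (q_cont c Hc B g x t eps Hg He) as [d [Hd H]].
exists d. split; auto.
Qed.

Lemma cont_in_clamp (f : R -> R -> R) : jcont f -> forall x t, continuity_2d_pt (fun x t => f (Rmax 0 x) t) x t.
Proof.
intros Hf x t eps. destruct (Hf (Rmax 0 x) t (Rmax_l _ _) eps (cond_pos eps)) as [d [Hd H]].
exists (mkposreal d Hd). intros y s Hy Hs. apply H; [apply Rmax_l| |exact Hs].
simpl in Hy. apply Rle_lt_trans with (2 := Hy). unfold Rmax.
destruct (Rle_dec 0 y), (Rle_dec 0 x); unfold Rabs; repeat destruct (Rcase_abs _); lra.
Qed.

Lemma jcont_cont_t (f : R -> R -> R) (x : R) : jcont f -> 0 <= x -> cont (f x).
Proof.
intros Hf Hx t. apply continuous_eps. intros eps He. destruct (Hf x t Hx eps He) as [d [Hd H]].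
exists d. split; auto. intros s Hs. apply H; auto. now rewrite Rminus_diag, Rabs_R0.
Qed.

Lemma cont_in_pos_t (f : R -> R -> R) (x : R) :
  (forall x t, 0 < x -> cont_in (fun x' => 0 < x') f x t) -> 0 < x -> cont (f x).
Proof.
intros Hf Hx t. apply continuous_eps. intros eps He. destruct (Hf x t Hx eps He) as [d [Hd H]].
exists d. split; auto. intros s Hs. apply H; auto. now rewrite Rminus_diag, Rabs_R0.
Qed.

Lemma window_jcont (f : R -> R -> R) (tau : R) : 0 < tau -> jcont f -> jcont (fun x t => window (f x) tau t).
Proof.
intros Htau Hf x0 t0 Hx0 eps He.
destruct (uniform_continuity_2d (fun x t => f (Rmax 0 x) t) (x0 - 1) (x0 + 1) (t0 - 1) (t0 + tau + 1)
  (fun x t _ _ => cont_in_clamp f Hf x t) (mkposreal (eps / 2 / (tau + 1)) ltac:(repeat apply Rdiv_lt_0_compat; lra))) as [d Hd].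
simpl in Hd.
assert (HC0 : cont (f x0)) by now apply jcont_cont_t.
assert (HWc : cont (window (f x0) tau)).
{ apply (cont_derive _ (fun t => f x0 (t + tau) - f x0 t)). intros t. now apply window_derive. }
destruct (proj1 (continuous_eps _ t0) (HWc t0) (eps / 2)) as [d' [Hd' H']]; [lra|].
exists (Rmin (Rmin d 1) d'). split; [repeat apply Rmin_pos; auto; try lra; apply cond_pos|].
intros x t Hx Hxx Htt.
assert (M1 := Rmin_l (Rmin d 1) d'). assert (M2 := Rmin_r (Rmin d 1) d').
assert (M3 := Rmin_l d 1). assert (M4 := Rmin_r d 1).
specialize (H' t ltac:(lra)).
assert (HCx : cont (f x)) by now apply jcont_cont_t.
assert (Hx1 : Rabs (x - x0) < 1) by lra. assert (Ht1 : Rabs (t - t0) < 1) by lra.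
apply Rabs_def2 in Hx1. apply Rabs_def2 in Ht1.
assert (E : Rabs (window (f x) tau t - window (f x0) tau t) <= eps / 2 / (tau + 1) * Rabs (t + tau - t)).
{ unfold window. rewrite <- RInt_minus_cont by auto. apply RInt_abs_le; [now apply cont_minus|].
  intros s Hs. rewrite Rmin_left, Rmax_right in Hs by lra.
  assert (K := Hd x0 s x s). rewrite !Rmax_right in K by lra. left. apply K; try lra.
  rewrite Rminus_diag, Rabs_R0. apply cond_pos. }
replace (t + tau - t) with tau in E by ring. rewrite (Rabs_right tau) in E by lra.
assert (E2 : eps / 2 / (tau + 1) * tau <= eps / 2).
{ apply Rle_trans with (eps / 2 / (tau + 1) * (tau + 1)); [|right; field; lra].
  apply Rmult_le_compat_l; [apply Rlt_le; repeat apply Rdiv_lt_0_compat; lra|lra]. }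
rabs_lra.
Qed.

Lemma window_derive_param (f f' : R -> R -> R) (tau x t : R) :
  (forall x t, 0 < x -> is_derive (fun y => f y t) x (f' x t)) ->
  (forall x t, 0 < x -> cont_in (fun x' => 0 < x') f' x t) ->
  (forall x, 0 < x -> cont (f x)) -> 0 < x ->
  is_derive (fun x => window (f x) tau t) x (window (f' x) tau t).
Proof.
intros Hd Hc' Hcf Hx. unfold window.
assert (EL : locally x (fun y : R => 0 < y)).
{ exists (mkposreal x Hx). intros y Hy. assert (Hy' : Rabs (y - x) < x) by exact Hy. rabs_lra. }
assert (K := is_derive_RInt_param f t (t + tau) x).
eapply is_derive_R_eq; [apply K|].
- apply (filter_imp (fun y : R => 0 < y)); [|exact EL].
  intros y Hy s _. exists (f' y s). now apply Hd.
- intros s _ eps. destruct (Hc' x s Hx eps (cond_pos eps)) as [d [Hd0 H]].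
  exists (mkposreal (Rmin d x) (Rmin_pos _ _ Hd0 Hx)). simpl. intros y r Hy Hr.
  assert (M1 := Rmin_l d x). assert (M2 := Rmin_r d x).
  assert (Hy' : Rabs (y - x) < x) by lra. apply Rabs_def2 in Hy'.
  assert (E1 : Derive (fun z : R => f z r) y = f' y r) by (apply is_derive_unique, Hd; lra).
  assert (E2 : Derive (fun z : R => f z s) x = f' x s) by (apply is_derive_unique, Hd; lra).
  rewrite E1, E2.
  apply H; lra.
- apply (filter_imp (fun y : R => 0 < y)); [|exact EL]. intros y Hy. apply cont_ex_RInt. now apply Hcf.
- apply RInt_ext. intros s _. apply is_derive_unique. now apply Hd.
Qed.

(* Steklov averages in time are used because u_x itself need not have the derivatives u_xxx and u_xt. *)
Lemma classical_bsol (th tau0 D : R) (h : R -> R) (u : R -> R -> R) :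
  entire_solution c th h u -> 0 < tau0 ->
  (forall t, 0 <= 1 + th * h (u 0 t) <= 2) ->
  (forall x t tau, 0 < x -> 0 < tau <= tau0 -> Rabs (u x (t + tau) - u x t) <= D) ->
  (forall t, exists M, forall x s, 0 < x -> t <= s <= t + tau0 -> Rabs (u x s) <= M * exp (c * x / 2)) ->
  bsol c (fun t => u 0 t) (fun t => 1 + th * h (u 0 t)) /\
  forall x t, 0 <= x -> u x t = U c (fun t => u 0 t) (fun t => 1 + th * h (u 0 t)) x t.
Proof.
intros [ux [uxx [ut [C0 [C1 [C2 [C3 [D1 [D2 [D3 [PDE [BC _]]]]]]]]]]]] Htau0 Hg2 HD HM.
set (g := fun t => 1 + th * h (u 0 t)).
assert (Cux : forall x, 0 <= x -> cont (ux x)) by (intros x Hx; now apply jcont_cont_t).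
assert (Cuxx : forall x, 0 < x -> cont (uxx x)) by (intros x Hx; now apply cont_in_pos_t).
assert (Cut : forall x, 0 < x -> cont (ut x)) by (intros x Hx; now apply cont_in_pos_t).
assert (Cu : forall x, 0 <= x -> cont (u x)) by (intros x Hx; now apply jcont_cont_t).
assert (Hgux : forall t, ux 0 t = g t) by exact BC.
assert (Hg : bdd 2 g).
{ split.
  - intros t. apply (continuous_ext (ux 0) g); [exact Hgux|]. apply Cux. lra.
  - intros t. specialize (Hg2 t). fold (g t) in Hg2. apply Rabs_le_between. lra. }
assert (HD0 : 0 <= D).
{ apply Rle_trans with (2 := HD 1 0 tau0 Rlt_0_1 ltac:(lra)). apply Rabs_pos. }
(* The equation u_xx = u_t + c u_x, integrated in time, expresses the x-derivative of the averaged
   slope by u and the averaged slope itself, which can be differentiated once more. *)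
assert (Dq : forall tau x t, 0 < x -> is_derive (fun x => window (ux x) tau t) x
    ((u x (t + tau) - u x t) + c * window (ux x) tau t)).
{ intros tau x t Hx. eapply is_derive_R_eq.
  - apply (window_derive_param ux uxx tau x t D2 C2 (fun x Hx => Cux x (Rlt_le _ _ Hx)) Hx).
  - unfold window.
    assert (E1 : RInt (ut x) t (t + tau) = u x (t + tau) - u x t).
    { assert (E : forall y, RInt (ut x) t y - u x y = RInt (ut x) t t - u x t).
      { intros y. apply (const_of_derive0 (fun y => RInt (ut x) t y - u x y)). intros z _.
        eapply is_derive_R_eq; [apply is_derive_R_minus; [apply is_derive_RInt_cont; auto|apply D3; auto]|ring]. }
      specialize (E (t + tau)). rewrite RInt_point in E. unfold zero in E; simpl in E. lra. }
    rewrite <- E1, <- (RInt_scal_cont c) by (apply Cux; lra).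
    rewrite <- RInt_plus_cont by (auto; apply cont_scal, Cux; lra).
    apply RInt_ext. intros s _. rewrite PDE by auto. eqR. ring. }
(* [slope_bound] is one-sided; it is applied to the averages of u and of -u. *)
assert (Hbound : forall tau x t, 0 < tau <= tau0 -> 0 < x -> Rabs (window (ux x) tau t) <= D / c).
{ intros tau x t Htau Hx. destruct (HM t) as [M HM'].
  assert (HdW : forall x, 0 < x -> is_derive (fun x => window (u x) tau t) x (window (ux x) tau t)).
  { intros y Hy. apply (window_derive_param u ux tau y t D1); auto.
    - intros z s Hz eps He. destruct (C1 z s (Rlt_le _ _ Hz) eps He) as [d [Hd H]]. exists d. split; auto.
      intros z' s' Hz'. apply H. lra.
    - intros z Hz. apply Cu. lra. }
  assert (HWM : forall x, 0 < x -> Rabs (window (u x) tau t) <= (M * tau) * exp (c * x / 2)).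
  { intros y Hy. unfold window. replace (M * tau * exp (c * y / 2)) with (M * exp (c * y / 2) * Rabs (t + tau - t)).
    - apply RInt_abs_le; [apply Cu; lra|]. intros s Hs. rewrite Rmin_left, Rmax_right in Hs by lra. apply HM'; lra.
    - replace (t + tau - t) with tau by ring. rewrite Rabs_right by lra. ring. }
  apply Rabs_le_between. split.
  - apply Ropp_le_cancel. rewrite Ropp_involutive.
    apply (slope_bound c D (M * tau) (fun x => -1 * window (u x) tau t) (fun x => - window (ux x) tau t)
      (fun x => - (u x (t + tau) - u x t))); auto.
    + intros y Hy. eapply is_derive_R_eq; [apply is_derive_R_scal, HdW; auto|ring].
    + intros y Hy. apply (is_derive_ext (fun x => -1 * window (ux x) tau t)); [intros z; eqR; ring|].
      eapply is_derive_R_eq; [apply is_derive_R_scal, Dq; auto|ring].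
    + intros y Hy. rewrite Rabs_Ropp. apply HD; auto.
    + intros y Hy. replace (-1 * window (u y) tau t) with (- window (u y) tau t) by ring. rewrite Rabs_Ropp. now apply HWM.
  - apply (slope_bound c D (M * tau) (fun x => window (u x) tau t) (fun x => window (ux x) tau t)
      (fun x => (u x (t + tau) - u x t))); auto. }
assert (Hheat : forall tau, heat c (fun x t => window (ux x) tau t)).
{ intros tau. exists (fun x t => (u x (t + tau) - u x t) + c * window (ux x) tau t),
    (fun x t => (ux x (t + tau) - ux x t) + c * ((u x (t + tau) - u x t) + c * window (ux x) tau t)),
    (fun x t => ux x (t + tau) - ux x t).
  intros x t Hx. split; [|split; [|split]].
  - now apply Dq.
  - apply is_derive_R_plus; [apply is_derive_R_minus; now apply D1|]. apply is_derive_R_scal. now apply Dq.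
  - apply window_derive, Cux. lra.
  - ring. }
(* Both sides are bounded entire solutions with the same boundary values, so [dirichlet_entire]
   applies to their difference in both directions. *)
assert (Hqw : forall tau x t, 0 < tau <= tau0 -> 0 <= x -> window (ux x) tau t = q c (window g tau) x t).
{ intros tau x t Htau Hx.
  assert (HW := window_bdd 2 tau g Hg).
  assert (Jw : jcont (fun x t => window (ux x) tau t)) by (apply window_jcont; [lra|exact C1]).
  assert (Jq : jcont (q c (window g tau))) by now apply (q_jcont _ _ HW).
  assert (Hq := q_window_heat 2 tau g Hg).
  assert (E0 : forall t, window (ux 0) tau t = q c (window g tau) 0 t).
  { intros s. rewrite q_0. unfold window. apply RInt_ext. intros r _. apply Hgux. }
  assert (HB : forall x t, 0 <= x -> Rabs (window (ux x) tau t) <= (D / c + 2 * Rabs tau) /\ Rabs (q c (window g tau) x t) <= 2 * Rabs tau).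
  { intros y s Hy. assert (F := q_abs_le c Hc _ _ y s HW). split; [|exact F].
    assert (0 <= D / c) by (apply Rdiv_le_0_compat; lra). generalize (Rabs_pos tau). intros.
    destruct Hy as [Hy|<-].
    - specialize (Hbound tau y s Htau Hy). lra.
    - rewrite E0. assert (F' := q_abs_le c Hc _ _ 0 s HW). lra. }
  assert (HBe : forall x, 0 <= x -> 1 <= exp (c * x / 2)) by (intros y Hy; rewrite <- exp_0; apply exp_le; nra).
  pose (B := D / c + 4 * Rabs tau).
  assert (K1' : 0 <= 1 * window (ux x) tau t + -1 * q c (window g tau) x t).
  { apply (dirichlet_entire c Hc (fun x t => 1 * window (ux x) tau t + -1 * q c (window g tau) x t) B); auto.
    - now apply jcont_comb.
    - now apply heat_comb.
    - intros s. rewrite E0. lra.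
    - intros y s Hy. destruct (HB y s Hy) as [F1 F2]. apply Rabs_le_between in F1, F2. specialize (HBe y Hy).
      assert (B <= B * exp (c * y / 2)); [|unfold B in *; lra].
      assert (0 <= D / c) by (apply Rdiv_le_0_compat; lra). generalize (Rabs_pos tau). unfold B. nra. }
  assert (K2' : 0 <= -1 * window (ux x) tau t + 1 * q c (window g tau) x t).
  { apply (dirichlet_entire c Hc (fun x t => -1 * window (ux x) tau t + 1 * q c (window g tau) x t) B); auto.
    - now apply jcont_comb.
    - now apply heat_comb.
    - intros s. rewrite E0. lra.
    - intros y s Hy. destruct (HB y s Hy) as [F1 F2]. apply Rabs_le_between in F1, F2. specialize (HBe y Hy).
      assert (B <= B * exp (c * y / 2)); [|unfold B in *; lra].
      assert (0 <= D / c) by (apply Rdiv_le_0_compat; lra). generalize (Rabs_pos tau). unfold B. nra. }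
  lra. }
(* Divide [Hqw] by tau and let tau -> 0: a discrepancy eps is refuted at one sufficiently small
   tau. *)
assert (Huq : forall x t, 0 < x -> ux x t = q c g x t).
{ intros x t Hx. apply Rminus_diag_uniq. apply Rabs_eq_0. apply Rle_antisym; [|apply Rabs_pos].
  apply Rnot_lt_le. intros He. set (eps := Rabs (ux x t - q c g x t)) in *.
  generalize (exp_pos (c * x / 4)); intros Hex.
  destruct (window_quotient c Hc 2 g t (eps / 4 / exp (c * x / 4)) Hg) as [d [Hd H]]; [repeat apply Rdiv_lt_0_compat; lra|].
  destruct (proj1 (continuous_eps (ux x) t) (Cux x (Rlt_le _ _ Hx) t) (eps / 4)) as [d' [Hd' H']]; [lra|].
  pose (tau := Rmin tau0 (Rmin d d') / 2).
  assert (Htau : 0 < tau /\ tau <= tau0 /\ tau < d /\ tau < d').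
  { unfold tau. assert (0 < Rmin tau0 (Rmin d d')) by (repeat apply Rmin_pos; auto).
    generalize (Rmin_l tau0 (Rmin d d')) (Rmin_r tau0 (Rmin d d')) (Rmin_l d d') (Rmin_r d d'). lra. }
  assert (HW := window_bdd 2 tau g Hg).
  assert (HWs : bdd (Rabs (/ tau) * (2 * Rabs tau)) (fun r => / tau * window g tau r)).
  { split; [apply cont_scal, HW|]. intros r. rewrite Rabs_mult. apply Rmult_le_compat_l; [apply Rabs_pos|apply HW]. }
  assert (E0 : q c (fun r => / tau * window g tau r - g r) x t = / tau * q c (window g tau) x t - q c g x t).
  { rewrite (q_minus c Hc _ _ _ g x t HWs Hg), (q_scal c Hc _ (/ tau) (window g tau) x t HW). reflexivity. }
  assert (F1 : Rabs (q c (fun r => / tau * window g tau r - g r) x t) <= eps / 4 / exp (c * x / 4) * exp (c * x / 4)).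
  { apply (q_weighted c Hc); [apply cont_minus; [apply HWs|apply Hg]|lra|]. intros s Hs. apply H; auto; [lra|].
    rewrite Rabs_right; lra. }
  replace (eps / 4 / exp (c * x / 4) * exp (c * x / 4)) with (eps / 4) in F1 by (field; lra).
  rewrite E0, <- (Hqw tau x t ltac:(lra) (Rlt_le _ _ Hx)) in F1.
  assert (F2 : Rabs (window (ux x) tau t - tau * ux x t) <= eps / 4 * Rabs (t + tau - t)).
  { replace (tau * ux x t) with (RInt (fun _ => ux x t) t (t + tau)).
    2:{ rewrite RInt_const_R. eqR; ring. }
    unfold window. rewrite <- RInt_minus_cont by (auto using cont_const; apply Cux; lra).
    apply RInt_abs_le; [apply cont_minus; [apply Cux; lra|apply cont_const]|].
    intros s Hs. rewrite Rmin_left, Rmax_right in Hs by lra. left. apply H'. apply Rabs_def1; lra. }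
  replace (t + tau - t) with tau in F2 by ring. rewrite (Rabs_right tau) in F2 by lra.
  assert (F3 : Rabs (/ tau * window (ux x) tau t - ux x t) <= eps / 4).
  { replace (/ tau * window (ux x) tau t - ux x t) with (/ tau * (window (ux x) tau t - tau * ux x t)) by (field; lra).
    rewrite Rabs_mult, Rabs_right by (apply Rle_ge, Rlt_le, Rinv_0_lt_compat; lra).
    apply Rmult_le_reg_l with tau; [lra|]. rewrite <- Rmult_assoc, Rinv_r, Rmult_1_l by lra. lra. }
  assert (eps <= eps / 2); [|lra].
  unfold eps at 1. rabs_lra. }
assert (HuV : forall x t, 0 <= x -> u x t = u 0 t + V c g x t).
{ intros x t [Hx|<-]; [|rewrite V_0; ring].
  assert (Hcst : forall y, 0 < y -> u x t - V c g x t = u y t - V c g y t).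
  { intros y Hy. apply (const_of_derive0 (fun x => u x t - V c g x t)). intros z Hz.
    assert (0 < z) by (apply Rlt_le_trans with (Rmin x y); [now apply Rmin_pos|lra]).
    eapply is_derive_R_eq; [apply is_derive_R_minus; [apply D1; auto|now apply (V_derive c Hc 2)]|]. rewrite Huq by auto. ring. }
  apply Rminus_diag_uniq. apply Rabs_eq_0. apply Rle_antisym; [|apply Rabs_pos].
  apply Rnot_lt_le. intros He. set (eps := Rabs (u x t - (u 0 t + V c g x t))) in *.
  destruct (C0 0 t (Rle_refl 0) (eps / 2)) as [d [Hd H]]; [lra|].
  pose (y := Rmin d (eps / 4) / 2).
  assert (Hy : 0 < y /\ y < d /\ y < eps / 4).
  { unfold y. assert (0 < Rmin d (eps / 4)) by (apply Rmin_pos; lra).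
    generalize (Rmin_l d (eps / 4)) (Rmin_r d (eps / 4)). lra. }
  specialize (H y t ltac:(lra)). rewrite Rminus_0_r, (Rabs_right y), Rminus_diag, Rabs_R0 in H by lra.
  specialize (H ltac:(lra) Hd).
  assert (F := V_abs_le c Hc 2 g y t Hg). rewrite (Rabs_right y) in F by lra.
  specialize (Hcst y ltac:(lra)).
  assert (E : u x t - (u 0 t + V c g x t) = (u y t - u 0 t) - V c g y t) by lra.
  assert (eps < eps); [|lra]. unfold eps at 1. rewrite E.
  rabs_lra. }
(* [Hqw] near x = 1 identifies [q1] of the window with the x-derivative from [Dq], and
   [potential_increment] becomes the mass law over one short step. Any positive height would do. *)
assert (Hinc : forall t tau, 0 < tau <= tau0 ->
   u 0 (t + tau) + J c g (t + tau) = u 0 t + J c g t - c * RInt g t (t + tau)).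
{ intros t tau Htau.
  assert (Hth := potential_increment c Hc 2 g tau 1 t Hg Rlt_0_1).
  assert (HW := window_bdd 2 tau g Hg).
  assert (E : q1 c (window g tau) 1 t = (u 1 (t + tau) - u 1 t) + c * window (ux 1) tau t).
  { assert (A1 := proj1 (q_derive_x c Hc _ _ 1 t HW Rlt_0_1)).
    assert (A2 := Dq tau 1 t Rlt_0_1).
    apply is_derive_unique in A1. apply is_derive_unique in A2. rewrite <- A1, <- A2.
    apply Derive_ext_loc. exists (mkposreal 1 Rlt_0_1). intros y Hy.
    assert (Hy' : Rabs (y - 1) < 1) by exact Hy. apply Rabs_def2 in Hy'. symmetry. apply Hqw; lra. }
  rewrite E, <- (Hqw tau 1 t Htau Rle_0_1) in Hth.
  rewrite (HuV 1 (t + tau) Rle_0_1), (HuV 1 t Rle_0_1) in Hth.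
  change (RInt g t (t + tau)) with (window g tau t). lra. }
split; [|exact HuV].
split.
- apply Cu. lra.
- exact Hg.
- intros t. apply (Hg2 t).
- assert (K : forall t1 t2, t1 < t2 -> u 0 t2 + J c g t2 = u 0 t1 + J c g t1 - c * RInt g t1 t2).
  { intros t1 t2 Hlt.
    (* The law is known for steps up to tau0; a longer interval is cut into N equal ones. *)
    destruct (archimed_cor1 (tau0 / (t2 - t1))) as [N [HN HN0]]; [apply Rdiv_lt_0_compat; lra|].
    pose (tau := (t2 - t1) / INR N).
    assert (HNp : 0 < INR N) by (apply lt_0_INR; lia).
    assert (Htau : 0 < tau <= tau0).
    { split; [apply Rdiv_lt_0_compat; lra|]. unfold tau.
      apply Rmult_lt_compat_r with (r := t2 - t1) in HN; [|lra].
      replace (tau0 / (t2 - t1) * (t2 - t1)) with tau0 in HN by (field; lra). unfold Rdiv. lra. }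
    assert (G : forall n, u 0 (t1 + INR n * tau) + J c g (t1 + INR n * tau) = u 0 t1 + J c g t1 - c * RInt g t1 (t1 + INR n * tau)).
    { induction n as [|n IH].
      - simpl. rewrite Rmult_0_l, Rplus_0_r, RInt_point. unfold zero; simpl. ring.
      - rewrite S_INR. replace (t1 + (INR n + 1) * tau) with (t1 + INR n * tau + tau) by ring.
        rewrite (Hinc _ _ Htau), IH. rewrite <- (RInt_Chasles_cont g t1 (t1 + INR n * tau) (t1 + INR n * tau + tau)) by apply Hg. ring. }
    specialize (G N). replace (t1 + INR N * tau) with t2 in G by (unfold tau; field; lra). exact G. }
  intros t1 t2. destruct (Rtotal_order t1 t2) as [Hlt|[->|Hgt]].
  + now apply K.
  + rewrite RInt_point. unfold zero; simpl. ring.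
  + specialize (K t2 t1 Hgt). rewrite (RInt_swap_cont g t2 t1) by apply Hg. lra.
Qed.
End Classical.

(** * Comparison, strict monotonicity and long-time behaviour *)

Lemma cont_bounded (f : R -> R) (a b : R) : cont f -> exists M, 0 <= M /\ forall t, a <= t <= b -> Rabs (f t) <= M.
Proof.
intros Hf. destruct (Rle_dec a b) as [Hab|Hab].
2:{ exists 0. split; [lra|]. intros; lra. }
assert (Hc : forall t, a <= t <= b -> continuity_pt f t) by (intros t _; apply continuity_pt_filterlim, Hf).
destruct (continuity_ab_maj f a b Hab Hc) as [M1 [H1 _]].
destruct (continuity_ab_min f a b Hab Hc) as [M2 [H2 _]].
exists (Rabs (f M1) + Rabs (f M2)). split; [generalize (Rabs_pos (f M1)) (Rabs_pos (f M2)); lra|].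
intros t Ht. specialize (H1 t Ht). specialize (H2 t Ht).
generalize (Rle_abs (f M1)) (Rle_abs (- f M2)) (Rabs_pos (f M1)) (Rabs_pos (f M2)). rewrite Rabs_Ropp. intros.
apply Rabs_le_between. lra.
Qed.

Lemma right_deriv_nonneg (f : R -> R) (l d : R) : 0 < d -> is_derive f 0 l -> f 0 = 0 ->
  (forall x, 0 < x < d -> 0 <= f x) -> 0 <= l.
Proof.
intros Hd Hf H0 Hp. apply is_derive_Reals in Hf. apply Rnot_lt_le. intros Hl.
destruct (Hf (- l) ltac:(lra)) as [del Hdel].
pose (k := Rmin d del / 2).
assert (Hk : 0 < k /\ k < d /\ k < del).
{ unfold k. assert (0 < Rmin d del) by (apply Rmin_pos; [auto|apply cond_pos]).
  generalize (Rmin_l d del) (Rmin_r d del). lra. }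
specialize (Hdel k ltac:(lra)). rewrite (Rabs_right k), Rplus_0_l, H0 in Hdel by lra. specialize (Hdel ltac:(lra)).
assert (0 <= (f k - 0) / k) by (apply Rdiv_le_0_compat; [specialize (Hp k ltac:(lra)); lra|lra]).
rabs_lra.
Qed.

(* Barbalat's lemma *)
Lemma integrable_unif_cont_to_0 (f : R -> R) (C : R) : cont f -> (forall t, 0 <= t -> 0 <= f t) ->
  (forall eps, 0 < eps -> exists d, 0 < d /\ forall s t, Rabs (s - t) < d -> Rabs (f s - f t) < eps) ->
  (forall T, 0 <= T -> RInt f 0 T <= C) ->
  exists l, is_int f l /\ forall eps, 0 < eps -> exists T, 0 <= T /\ forall t, T <= t -> f t < eps.
Proof.
intros Cf Hp Huc HC.
destruct (is_int_nonneg_bounded f C Cf Hp HC) as [l Hl]. exists l. split; [exact Hl|].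
intros eps He. destruct (Huc (eps / 2)) as [d [Hd Hud]]; [lra|].
(* Were f t >= eps, f would exceed eps/2 on an interval of length d/2, of area at least eps d / 4,
   while integrals over intervals beyond A are below eps d / 8. *)
destruct (Hl (eps * d / 16)) as [A [HA HB]]; [nra|].
exists A. split; [exact HA|]. intros t Ht. apply Rnot_le_lt. intros Hge.
assert (G : eps / 2 * (d / 2) <= RInt f t (t + d / 2)).
{ replace (eps / 2 * (d / 2)) with (RInt (fun _ => eps / 2) t (t + d / 2)).
  - apply RInt_le_cont; auto using cont_const; [lra|]. intros s Hs.
    specialize (Hud s t). assert (Rabs (s - t) < d) by (apply Rabs_def1; lra).
    specialize (Hud H). rabs_lra.
  - rewrite RInt_const_R. eqR. ring. }
assert (H1 := HB t Ht). assert (H2 := HB (t + d / 2) ltac:(lra)).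
rewrite <- (RInt_Chasles_cont f 0 t (t + d / 2)) in H2 by auto.
apply Rabs_def2 in H1, H2. nra.
Qed.

Section Theory.
Context (c : R) (Hc : 0 < c).

Definition mass (b g : R -> R) (t : R) : R := b t + J c g t.

Lemma mass_eq (b g : R -> R) (t1 t2 : R) : bsol c b g -> mass b g t2 = mass b g t1 - c * RInt g t1 t2.
Proof. intros H. apply (bs_eq _ _ _ H). Qed.

Lemma mass_decr (b g : R -> R) (t1 t2 : R) : bsol c b g -> t1 <= t2 -> mass b g t2 <= mass b g t1.
Proof.
intros H Ht. rewrite (mass_eq b g t1 t2 H).
assert (0 <= RInt g t1 t2) by (apply RInt_nonneg_cont; [auto|apply H|intros; apply H]). nra.
Qed.

Lemma mass_cont (b g : R -> R) : bsol c b g -> cont (mass b g).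
Proof. intros H. apply cont_plus; [apply H|apply (J_cont c Hc 2), H]. Qed.

Lemma J_bs (b g : R -> R) (t : R) : bsol c b g -> 0 <= J c g t <= 8 / (3 * c).
Proof.
intros H. split; [apply (J_ge0 c Hc 2); [apply H|intros; apply H]|].
assert (E := J_abs_le c Hc 2 g t (bs_g _ _ _ H)). apply Rabs_le_between in E.
replace (8 / (3 * c)) with (2 * (4 / (3 * c))) by (field; lra). lra.
Qed.

Lemma bsol_unif_cont (b g : R -> R) (eps : R) : bsol c b g -> 0 < eps ->
  exists d, 0 < d /\ forall s t, Rabs (s - t) < d -> Rabs (b s - b t) < eps.
Proof.
intros H He. destruct (equicont c Hc 2 (eps / 2)) as [d [Hd Heq]]; [lra|lra|].
exists d. split; auto. intros s t Hst.
destruct (Heq g t (s - t) (bs_g _ _ _ H) Hst) as [E _].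
unfold window in E. replace (t + (s - t)) with s in E by ring.
assert (K := bs_eq _ _ _ H t s). rabs_lra.
Qed.

(** The difference solves the equation, a negative boundary value produces a slope of at most Lam
    times its size, and both U grow at most linearly, which is below e^{c x / 2}. The Lipschitz
    bound is asked along the two solutions only. *)
Lemma bsol_compare (b g b' g' : R -> R) (t0 t1 Lam : R) : bsol c b g -> bsol c b' g' -> t0 <= t1 -> 0 <= Lam ->
  (forall t, t0 <= t <= t1 -> Rabs (g t - g' t) <= Lam * Rabs (b t - b' t)) ->
  (forall x, 0 <= x -> U c b' g' x t0 <= U c b g x t0) ->
  forall x t, 0 <= x -> t0 <= t <= t1 -> U c b' g' x t <= U c b g x t.
Proof.
intros H H' Ht HL Hlip H0 x t Hx Htt.
destruct (cont_bounded (fun t => b t - b' t) t0 t1) as [M [HM0 HM]].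
{ apply cont_minus; [apply H|apply H']. }
assert (K : 0 <= 1 * U c b g x t + -1 * U c b' g' x t); [|lra].
apply (neumann_comparison c Hc (fun x t => 1 * U c b g x t + -1 * U c b' g' x t) t0 t1 (M + 4 / c) Lam); auto.
- apply jcont_comb; apply (U_jcont c Hc 2); (apply H || apply H').
- apply heat_comb; apply U_heat; auto.
- intros y s Hy Hs. specialize (HM s Hs). apply Rabs_le_between in HM.
  assert (B1 := U_bounds c Hc b g y s H Hy). assert (B2 := U_bounds c Hc b' g' y s H' Hy).
  assert (E := x_le_exp c y Hc Hy).
  assert (1 <= exp (c * y / 2)) by (apply exp_ge_1; nra).
  replace (4 / c) with (2 * (2 / c)) by (field; lra). nra.
- intros y Hy. specialize (H0 y Hy). lra.
- intros s Hs Hneg. exists (1 * g s + -1 * g' s). split.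
  + apply (is_derive_R_plus (fun x => 1 * U c b g x s) (fun x => -1 * U c b' g' x s)); apply is_derive_R_scal.
    * rewrite <- (q_0 c g s). apply (U_derive_x c Hc 2), H.
    * rewrite <- (q_0 c g' s). apply (U_derive_x c Hc 2), H'.
  + rewrite !U_0 in *. specialize (Hlip s ltac:(lra)). apply Rabs_le_between in Hlip.
    rewrite (Rabs_left (b s - b' s)) in Hlip by lra. lra.
Qed.

(** V depends on the past flux only, so a common past gives equal profiles at t0; comparison in both
    directions does the rest. *)
Lemma bsol_unique_forward (b g b' g' : R -> R) (t0 Lam : R) : bsol c b g -> bsol c b' g' -> 0 <= Lam ->
  (forall t, t0 <= t -> Rabs (g t - g' t) <= Lam * Rabs (b t - b' t)) ->
  (forall t, t <= t0 -> b t = b' t /\ g t = g' t) ->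
  forall t, b t = b' t.
Proof.
intros H H' HL Hlip Heq t. destruct (Rle_dec t t0) as [Ht|Ht]; [now apply Heq|].
assert (HU : forall x, U c b g x t0 = U c b' g' x t0).
{ intros x. unfold U. f_equal; [apply Heq; lra|]. unfold V. apply RInt_ext. intros z _. apply q_past.
  intros s Hs. now apply Heq. }
rewrite <- (U_0 c b g t), <- (U_0 c b' g' t). apply Rle_antisym.
- apply (bsol_compare b' g' b g t0 t Lam); auto; try lra.
  + intros s Hs. rewrite (Rabs_minus_sym (g' s)), (Rabs_minus_sym (b' s)). apply Hlip; lra.
  + intros x _. rewrite HU. lra.
- apply (bsol_compare b g b' g' t0 t Lam); auto; try lra.
  + intros s Hs. apply Hlip; lra.
  + intros x _. rewrite HU. lra.
Qed.

(** The monotonicity of the boundary values spreads to x > 0 through the Dirichlet principle for the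
    difference of U and its time translate. *)
Lemma U_decreasing (b g : R -> R) : bsol c b g -> (forall s t, s <= t -> b t <= b s) ->
  forall x s t, 0 <= x -> s <= t -> U c b g x t <= U c b g x s.
Proof.
intros H Hb x s t Hx Hst.
assert (K : 0 <= 1 * U c b g x s + -1 * U c b g x (s + (t - s))).
{ apply (dirichlet_entire c Hc (fun y r => 1 * U c b g y r + -1 * U c b g y (r + (t - s))) (4 / c)); auto.
  - apply jcont_comb; [apply (U_jcont c Hc 2); apply H|].
    apply (jcont_shift (t - s) (U c b g)). apply (U_jcont c Hc 2); apply H.
  - apply heat_comb; [apply U_heat; auto|]. apply (heat_shift c (t - s) (U c b g)). apply U_heat; auto.
  - intros r. rewrite !U_0. assert (K := Hb r (r + (t - s)) ltac:(lra)). lra.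
  - intros y r Hy. assert (K := Hb r (r + (t - s)) ltac:(lra)).
    assert (B1 := U_bounds c Hc b g y r H Hy). assert (B2 := U_bounds c Hc b g y (r + (t - s)) H Hy).
    assert (E := x_le_exp c y Hc Hy). replace (4 / c) with (2 * (2 / c)) by (field; lra). nra. }
replace (s + (t - s)) with t in K by ring. lra.
Qed.

(** At (0, t) the nonnegative difference of U and its translate vanishes together with its slope.
    Had it been positive on the boundary at an earlier time t0, Hopf's lemma would make this slope
    positive. *)
Lemma monotone_strict (b g : R -> R) (h t t0 : R) : bsol c b g -> (forall s t, s <= t -> b t <= b s) ->
  0 < h -> b (t + h) = b t -> g (t + h) = g t -> t0 <= t -> b (t0 + h) = b t0.
Proof.
intros H Hb Hh Eb Eg Ht.
destruct (Rle_lt_or_eq_dec _ _ Ht) as [Ht'|E0]; [|rewrite E0; exact Eb].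
apply Rle_antisym; [apply Hb; lra|]. apply Rnot_lt_le. intros Hlt.
pose (z := fun x s => 1 * U c b g x s + -1 * U c b g x (s + h)).
assert (Jz : jcont z).
{ apply jcont_comb; [apply (U_jcont c Hc 2); apply H|].
  apply (jcont_shift h (U c b g)). apply (U_jcont c Hc 2); apply H. }
assert (Hz : heat c z).
{ apply heat_comb; [apply U_heat; auto|]. apply (heat_shift c h (U c b g)). apply U_heat; auto. }
assert (Hz0 : forall x s, 0 <= x -> 0 <= z x s).
{ intros x s Hx. unfold z. assert (K := U_decreasing b g H Hb x s (s + h) Hx ltac:(lra)). lra. }
assert (Hz00 : z 0 t0 = b t0 - b (t0 + h)) by (unfold z; rewrite !U_0; ring).
destruct (Jz 0 t0 (Rle_refl 0) ((b t0 - b (t0 + h)) / 2)) as [d [Hd Hdz]]; [lra|].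
destruct (hopf_rect c Hc z (d / 2) t0 t ((b t0 - b (t0 + h)) / 2)) as [k [Hk Hkz]]; auto; try lra.
{ intros x Hx. specialize (Hdz x t0 (proj1 Hx)). rewrite Rminus_0_r, (Rabs_right x), Rminus_diag, Rabs_R0 in Hdz by lra.
  specialize (Hdz ltac:(lra) Hd). rewrite Hz00 in Hdz. rabs_lra. }
assert (E : 0 <= (1 * g t + -1 * g (t + h)) - k * (PI / (d / 2))).
{ apply (right_deriv_nonneg (fun x => z x t - k * sin (PI / (d / 2) * x)) _ (d / 2)); [lra| | |].
  - apply is_derive_R_minus.
    + apply (is_derive_R_plus (fun x => 1 * U c b g x t) (fun x => -1 * U c b g x (t + h))); apply is_derive_R_scal.
      * rewrite <- (q_0 c g t). apply (U_derive_x c Hc 2), H.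
      * rewrite <- (q_0 c g (t + h)). apply (U_derive_x c Hc 2), H.
    + apply is_derive_R_scal. eapply is_derive_R_eq; [apply (is_derive_R_comp sin (fun x => PI / (d / 2) * x) 0 (cos (PI / (d / 2) * 0)) (PI / (d / 2)))|].
      * apply is_derive_Reals, derivable_pt_lim_sin.
      * auto_derive; [auto|ring].
      * rewrite Rmult_0_r, cos_0. ring.
  - unfold z. rewrite !U_0, Rmult_0_r, sin_0, Eb. ring.
  - intros x Hx. specialize (Hkz x ltac:(lra)). lra. }
rewrite Eg in E. generalize PI_RGT_0; intros HPI.
assert (0 < k * (PI / (d / 2))) by (apply Rmult_lt_0_compat; [auto|apply Rdiv_lt_0_compat; lra]). lra.
Qed.

(** * The backward estimate near an equilibrium *)

Lemma RInt_exp_weighted (f : R -> R) (t s Z : R) : cont f -> 0 <= s ->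
  (forall r, 0 <= r <= s -> Rabs (f (t - r)) <= Z * exp (lam c * r)) ->
  Rabs (RInt f (t - s) t) <= Z / lam c * exp (lam c * s).
Proof.
intros Cf Hs Hf. assert (Hl := lam_pos c Hc).
assert (HZ : 0 <= Z).
{ specialize (Hf 0 ltac:(lra)). rewrite Rmult_0_r, exp_0 in Hf. generalize (Rabs_pos (f (t - 0))). lra. }
pose (e := fun r => Z * exp (lam c * (t - r))).
assert (Ce : cont e).
{ apply cont_scal. apply (cont_derive _ (fun r => - lam c * exp (lam c * (t - r)))). intros r. auto_derive; [auto|].
  replace (t + - r) with (t - r) by ring. ring. }
assert (I : RInt e (t - s) t = - (Z / lam c) * exp (lam c * (t - t)) - - (Z / lam c) * exp (lam c * (t - (t - s)))).
{ apply (RInt_FTC (fun r => - (Z / lam c) * exp (lam c * (t - r)))); auto; [lra| |].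
  - intros r _. eapply is_derive_R_continuous. apply is_derive_R_scal.
    apply (is_derive_R_shift (fun r => exp (lam c * r)) t r (lam c * exp (lam c * (t - r)))). auto_derive; [auto|ring].
  - intros r _. unfold e. eapply is_derive_R_eq; [apply is_derive_R_scal; apply (is_derive_R_shift (fun r => exp (lam c * r)) t r (lam c * exp (lam c * (t - r))))|field; lra].
    auto_derive; [auto|ring]. }
rewrite Rminus_diag, Rmult_0_r, exp_0 in I. replace (t - (t - s)) with s in I by ring.
assert (HZl : 0 <= Z / lam c) by (apply Rdiv_le_0_compat; lra).
assert (A1 : RInt f (t - s) t <= RInt e (t - s) t).
{ apply RInt_le_cont; auto; [lra|]. intros r Hr. specialize (Hf (t - r) ltac:(lra)).
  replace (t - (t - r)) with r in Hf by ring. apply Rabs_le_between in Hf. unfold e. lra. }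
assert (A2 : -1 * RInt e (t - s) t <= RInt f (t - s) t).
{ rewrite <- RInt_scal_cont by auto. apply RInt_le_cont; auto using cont_scal; [lra|]. intros r Hr. specialize (Hf (t - r) ltac:(lra)).
  replace (t - (t - r)) with r in Hf by ring. apply Rabs_le_between in Hf. unfold e. lra. }
apply Rabs_le_between. lra.
Qed.

(** In the weight e^{lam s}, c / lam bounds the contribution of the integrated flux to the trace and
    4/(3c) that of [J]; 1/4 is the contraction factor of the iteration. *)
Definition small_slope (eta : R) : Prop := 0 <= eta /\ eta * (c / lam c + 4 / (3 * c)) <= 1 / 4.

(* Lyapunov-Perron estimate: backwards in time two solutions whose nonlinearity has a small slope
   separate slower than e^{lam s}, so they are governed by their mass difference at time t. *)
Lemma backward_estimate (b g b' g' : R -> R) (t eta Z0 : R) : bsol c b g -> bsol c b' g' -> small_slope eta ->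
  (forall s, s <= t -> Rabs (g s - g' s) <= eta * Rabs (b s - b' s)) ->
  (forall s, s <= t -> Rabs (b s - b' s) <= Z0) ->
  let D := mass b g t - mass b' g' t in
  (forall s, 0 <= s -> Rabs (b (t - s) - b' (t - s)) <= 4 / 3 * Rabs D * exp (lam c * s)) /\
  Rabs (b t - b' t - D) <= Rabs D / 3.
Proof.
intros H H' [He0 He] Hg Hb D. assert (Hl := lam_pos c Hc).
assert (Hexp : forall s, 0 <= s -> 1 <= exp (lam c * s)) by (intros s Hs; rewrite <- exp_0; apply exp_le; nra).
assert (Bgg : bdd (2 + 2) (fun t => g t - g' t)) by (apply bdd_minus; [apply H|apply H']).
(* The mass law expresses b - b' - D by flux differences on the past, so a bound Z e^{lam s} on b -
   b' yields Z/4 e^{lam s} here. *)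
assert (step : forall Z, 0 <= Z -> (forall s, 0 <= s -> Rabs (b (t - s) - b' (t - s)) <= Z * exp (lam c * s)) ->
   forall s, 0 <= s -> Rabs (b (t - s) - b' (t - s) - D) <= Z / 4 * exp (lam c * s)).
{ intros Z HZ HbZ s Hs.
  assert (HgZ : forall s, 0 <= s -> Rabs (g (t - s) - g' (t - s)) <= eta * Z * exp (lam c * s)).
  { intros r Hr. apply Rle_trans with (1 := Hg (t - r) ltac:(lra)). specialize (HbZ r Hr). nra. }
  assert (I1 : Rabs (RInt (fun r => g r - g' r) (t - s) t) <= eta * Z / lam c * exp (lam c * s)).
  { apply RInt_exp_weighted; auto; [apply Bgg|]. intros r Hr. apply HgZ; lra. }
  rewrite RInt_minus_cont in I1 by (apply H || apply H').
  assert (I2 : Rabs (J c (fun r => g r - g' r) (t - s)) <= eta * Z * exp (lam c * s) * (4 / (3 * c))).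
  { apply (J_weighted c Hc _ _ _ _ Bgg). intros r Hr. replace (t - s - r) with (t - (s + r)) by ring.
    rewrite Rmult_assoc, <- exp_plus. replace (lam c * s + lam c * r) with (lam c * (s + r)) by ring. apply HgZ. lra. }
  rewrite (J_minus c Hc 2 2 g g' (t - s) (bs_g _ _ _ H) (bs_g _ _ _ H')) in I2.
  assert (M1 := mass_eq b g (t - s) t H). assert (M2 := mass_eq b' g' (t - s) t H').
  assert (E : b (t - s) - b' (t - s) - D = c * (RInt g (t - s) t - RInt g' (t - s) t) - (J c g (t - s) - J c g' (t - s))).
  { unfold D. unfold mass in *. lra. }
  rewrite E. generalize (exp_pos (lam c * s)). set (e := exp (lam c * s)) in *. intros Hep.
  assert (Hsum : c * (eta * Z / lam c * e) + eta * Z * e * (4 / (3 * c)) <= Z / 4 * e).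
  { replace (c * (eta * Z / lam c * e) + eta * Z * e * (4 / (3 * c))) with ((eta * (c / lam c + 4 / (3 * c))) * (Z * e)) by (field; lra).
    assert (0 <= Z * e) by (apply Rmult_le_pos; lra). nra. }
  apply Rabs_le_between in I1, I2. apply Rabs_le_between.
  set (R1 := RInt g (t - s) t - RInt g' (t - s) t) in *.
  assert (- (c * (eta * Z / lam c * e)) <= c * R1 <= c * (eta * Z / lam c * e)) by (split; nra).
  lra. }
assert (HZ0 : 0 <= Z0) by (apply Rle_trans with (2 := Hb t (Rle_refl t)); apply Rabs_pos).
(* 4/3 |D| is the fixed point of Z -> |D| + Z/4; the crude bound Z0 is divided by 4 at each step. *)
assert (iter : forall n s, 0 <= s -> Rabs (b (t - s) - b' (t - s)) <= (4 / 3 * Rabs D + Z0 / 4 ^ n) * exp (lam c * s)).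
{ induction n as [|n IH]; intros s Hs.
  - simpl. specialize (Hexp s Hs). apply Rle_trans with Z0; [apply Hb; lra|].
    generalize (Rabs_pos D). replace (Z0 / 1) with Z0 by field. nra.
  - assert (H4 : 0 < 4 ^ n) by (apply pow_lt; lra).
    assert (HZn : 0 <= Z0 / 4 ^ n) by (apply Rdiv_le_0_compat; lra).
    assert (K := step (4 / 3 * Rabs D + Z0 / 4 ^ n) ltac:(generalize (Rabs_pos D); lra) IH s Hs).
    specialize (Hexp s Hs). replace (Z0 / 4 ^ S n) with (Z0 / 4 ^ n / 4) by (simpl; field; lra).
    generalize (Rle_abs D) (Rle_abs (- D)) (Rabs_pos D). rewrite Rabs_Ropp. intros.
    assert (Rabs D <= Rabs D * exp (lam c * s)) by nra.
    rabs_lra. }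
assert (first : forall s, 0 <= s -> Rabs (b (t - s) - b' (t - s)) <= 4 / 3 * Rabs D * exp (lam c * s)).
{ intros s Hs. apply Rnot_lt_le. intros Hlt. specialize (Hexp s Hs).
  set (e := exp (lam c * s)) in *. set (a := Rabs (b (t - s) - b' (t - s))) in *.
  assert (Hgap : 0 < (a - 4 / 3 * Rabs D * e) / (Z0 * e + 1)) by (apply Rdiv_lt_0_compat; nra).
  destruct (pow_lt_1_zero (/ 4) ltac:(rewrite Rabs_right; lra) _ Hgap) as [N HN].
  specialize (HN N (Nat.le_refl N)). specialize (iter N s Hs). fold e a in iter.
  assert (H4 : 0 < (/ 4) ^ N) by (apply pow_lt; lra).
  rewrite Rabs_right in HN by lra.
  replace (Z0 / 4 ^ N) with (Z0 * (/ 4) ^ N) in iter by (rewrite pow_inv; reflexivity).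
  apply Rmult_lt_compat_r with (r := Z0 * e + 1) in HN; [|nra].
  replace ((a - 4 / 3 * Rabs D * e) / (Z0 * e + 1) * (Z0 * e + 1)) with (a - 4 / 3 * Rabs D * e) in HN by (field; nra).
  nra. }
split; [exact first|].
assert (K := step (4 / 3 * Rabs D) ltac:(generalize (Rabs_pos D); lra) first 0 (Rle_refl 0)).
rewrite Rminus_0_r, Rmult_0_r, exp_0 in K. lra.
Qed.

(** * Limits as t -> +oo and t -> -oo *)

Lemma J_to_0_plus (g : R -> R) : bdd 2 g -> (forall t, 0 <= g t) ->
  (forall eps, 0 < eps -> exists T, 0 <= T /\ forall t, T <= t -> g t < eps) ->
  forall eps, 0 < eps -> exists T, 0 <= T /\ forall t, T <= t -> J c g t < eps.
Proof.
intros Hg Hp Hlim eps He. assert (Hl := lam_pos c Hc).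
pose (k := 4 / (3 * c)). assert (Hk : 0 < k) by (apply Rdiv_lt_0_compat; lra).
destruct (Hlim (eps / (4 * k))) as [T1 [HT1 H1]]; [apply Rdiv_lt_0_compat; lra|].
destruct (exp_neg_small 2 (lam c) Hl (eps / (4 * k))) as [A [HA HA']]; [apply Rdiv_lt_0_compat; lra|].
(* The flux before T1 is only bounded by 2, but the weight discounts it by e^{-lam (t - T1)}. *)
exists (T1 + A). split; [lra|]. intros t Ht.
specialize (HA' (t - T1) ltac:(lra)).
rewrite Rabs_mult, (Rabs_right 2), (Rabs_right (exp _)) in HA' by (try (apply Rle_ge, Rlt_le, exp_pos); lra).
assert (K : Rabs (J c g t) <= (eps / (4 * k) + eps / (4 * k)) * k).
{ apply (J_weighted c Hc 2); auto. intros s Hs.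
  assert (Hex : 1 <= exp (lam c * s)) by (apply exp_ge_1; nra).
  assert (He4 : 0 < eps / (4 * k)) by (apply Rdiv_lt_0_compat; lra).
  rewrite Rabs_right by (apply Rle_ge, Hp).
  destruct (Rle_dec T1 (t - s)) as [Hts|Hts].
  - specialize (H1 _ Hts). nra.
  - assert (E : exp (- lam c * (t - T1)) * exp (lam c * s) = exp (lam c * (s - (t - T1)))) by (rewrite <- exp_plus; f_equal; ring).
    assert (1 <= exp (lam c * (s - (t - T1)))) by (apply exp_ge_1; nra).
    assert (g (t - s) <= 2) by (assert (Q := proj2 Hg (t - s)); apply Rabs_le_between in Q; lra).
    nra. }
replace ((eps / (4 * k) + eps / (4 * k)) * k) with (eps / 2) in K by (field; lra).
rabs_lra.
Qed.

Lemma J_to_0_minus (g : R -> R) (t eps : R) : bdd 2 g ->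
  (forall s, s <= t -> Rabs (g s) <= eps) -> J c g t <= eps * (4 / (3 * c)).
Proof.
intros Hg H. assert (Hl := lam_pos c Hc).
assert (K := J_weighted c Hc 2 g t eps Hg).
assert (E : Rabs (J c g t) <= eps * (4 / (3 * c))); [apply K|apply Rabs_le_between in E; lra].
intros s Hs. specialize (H (t - s) ltac:(lra)).
assert (1 <= exp (lam c * s)) by (apply exp_ge_1; nra).
generalize (Rabs_pos (g (t - s))). nra.
Qed.

Definition lip (Lam : R) (F : R -> R) : Prop := 0 <= Lam /\ forall a b, Rabs (F a - F b) <= Lam * Rabs (a - b).

Lemma lip_unif_cont (Lam : R) (F b : R -> R) : lip Lam F ->
  (forall eps, 0 < eps -> exists d, 0 < d /\ forall s t, Rabs (s - t) < d -> Rabs (b s - b t) < eps) ->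
  (forall eps, 0 < eps -> exists d, 0 < d /\ forall s t, Rabs (s - t) < d -> Rabs (F (b s) - F (b t)) < eps).
Proof.
intros [HL HF] Hb eps He. destruct (Hb (eps / (Lam + 1))) as [d [Hd H]]; [apply Rdiv_lt_0_compat; lra|].
exists d. split; auto. intros s t Hst. specialize (H s t Hst). apply Rle_lt_trans with (1 := HF _ _).
apply Rmult_lt_compat_l with (r := Lam + 1) in H; [|lra].
replace ((Lam + 1) * (eps / (Lam + 1))) with eps in H by (field; lra).
generalize (Rabs_pos (b s - b t)). lra.
Qed.

Lemma limit_zero_of_F (Lam : R) (F : R -> R) (L : R) : lip Lam F ->
  (forall eps, 0 < eps -> exists v, Rabs (v - L) < eps /\ Rabs (F v) < eps) -> F L = 0.
Proof.
intros [HL HF] H. apply Rabs_eq_0. apply Rle_antisym; [|apply Rabs_pos].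
apply Rnot_lt_le. intros Hlt.
destruct (H (Rabs (F L) / (Lam + 2))) as [v [H1 H2]]; [apply Rdiv_lt_0_compat; lra|].
specialize (HF L v). rewrite (Rabs_minus_sym L v) in HF.
generalize (Rabs_triang_inv (F L) (F v)). intros H3.
assert (E : Rabs (F L) / (Lam + 2) * (Lam + 2) = Rabs (F L)) by (field; lra).
assert (Lam * Rabs (v - L) <= Lam * (Rabs (F L) / (Lam + 2))) by (apply Rmult_le_compat_l; lra).
set (y := Rabs (F L) / (Lam + 2)) in *. assert (0 < y) by (unfold y; apply Rdiv_lt_0_compat; lra).
nra.
Qed.

Definition tends_plus (f : R -> R) (L : R) : Prop :=
  forall eps, 0 < eps -> exists T, 0 <= T /\ forall t, T <= t -> Rabs (f t - L) < eps.
Definition tends_minus (f : R -> R) (L : R) : Prop :=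
  forall eps, 0 < eps -> exists T, T <= 0 /\ forall t, t <= T -> Rabs (f t - L) < eps.

(** The mass decreases and is bounded below, so the flux is integrable and, being uniformly
    continuous, tends to 0. Then J tends to 0 as well, and b has the limit of the mass. *)
Lemma end_plus_gen (M : R) (b g : R -> R) : bsol c b g ->
  (forall eps, 0 < eps -> exists d, 0 < d /\ forall s t, Rabs (s - t) < d -> Rabs (g s - g t) < eps) ->
  (forall t, 0 <= t -> M <= mass b g t) ->
  exists L, tends_plus b L /\ tends_plus (mass b g) L /\ tends_plus g 0.
Proof.
intros H Huc HM.
destruct (integrable_unif_cont_to_0 g ((mass b g 0 - M) / c)) as [l [Hl Hg0]].
- apply H.
- intros t _. apply H.
- exact Huc.
- intros T HT. specialize (HM T HT). rewrite (mass_eq b g 0 T H) in HM.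
  apply Rmult_le_reg_r with c; [auto|]. unfold Rdiv. rewrite Rmult_assoc, Rinv_l by lra. lra.
- assert (HJ := J_to_0_plus g (bs_g _ _ _ H) (bs_pos _ _ _ H) Hg0).
  pose (L := mass b g 0 - c * l).
  assert (Tm : tends_plus (mass b g) L).
  { intros eps He. destruct (Hl (eps / c)) as [A [HA HA']]; [now apply Rdiv_lt_0_compat|].
    exists A. split; auto. intros t Ht. rewrite (mass_eq b g 0 t H). unfold L.
    replace (mass b g 0 - c * RInt g 0 t - (mass b g 0 - c * l)) with (- (c * (RInt g 0 t - l))) by ring.
    rewrite Rabs_Ropp, Rabs_mult, (Rabs_right c) by lra. specialize (HA' t Ht).
    apply Rmult_lt_compat_l with (r := c) in HA'; [|auto]. replace (c * (eps / c)) with eps in HA' by (field; lra). exact HA'. }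
  assert (Tb : tends_plus b L).
  { intros eps He. destruct (Tm (eps / 2)) as [T1 [HT1 H1]]; [lra|]. destruct (HJ (eps / 2)) as [T2 [HT2 H2]]; [lra|].
    exists (T1 + T2). split; [lra|]. intros t Ht. specialize (H1 t ltac:(lra)). specialize (H2 t ltac:(lra)).
    assert (J0 := J_bs b g t H). unfold mass in H1. rabs_lra. }
  assert (Tg : tends_plus g 0).
  { intros eps He. destruct (Hg0 eps He) as [T [HT HT']]. exists T. split; auto. intros t Ht. specialize (HT' t Ht).
    rewrite Rminus_0_r, Rabs_right; [auto|apply Rle_ge, H]. }
  exists L. split; [exact Tb|split; [exact Tm|exact Tg]].
Qed.

Lemma end_plus (Lam M : R) (F b : R -> R) : bsol c b (fun t => F (b t)) -> lip Lam F ->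
  (forall t, 0 <= t -> M <= mass b (fun t => F (b t)) t) ->
  exists L, F L = 0 /\ tends_plus b L /\ tends_plus (mass b (fun t => F (b t))) L /\ tends_plus (fun t => F (b t)) 0.
Proof.
intros H HF HM.
destruct (end_plus_gen M b (fun t => F (b t)) H) as [L [Tb [Tm Tg]]]; auto.
{ apply (lip_unif_cont Lam F b HF). intros eps He. now apply (bsol_unif_cont b (fun t => F (b t))). }
exists L. split; [|split; [exact Tb|split; [exact Tm|exact Tg]]].
apply (limit_zero_of_F Lam F L HF). intros eps He.
destruct (Tb eps He) as [T1 [HT1 H1]]. destruct (Tg eps He) as [T2 [HT2 H2]].
exists (b (T1 + T2)). split; [apply H1; lra|]. specialize (H2 (T1 + T2) ltac:(lra)). now rewrite Rminus_0_r in H2.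
Qed.

Lemma RInt_reflect (g : R -> R) (T : R) : cont g -> RInt (fun s => g (- s)) 0 T = RInt g (- T) 0.
Proof.
intros Hg.
assert (Hr : cont (fun s => g (- s))).
{ apply (cont_comp (fun s => - s) g); auto. apply (cont_derive _ (fun _ => -1)). intros s. auto_derive; [auto|ring]. }
assert (K : RInt (fun s => g (- s)) 0 T - (- RInt g 0 (- T)) = RInt (fun s => g (- s)) 0 0 - (- RInt g 0 (- 0))).
{ apply (const_of_derive0 (fun T => RInt (fun s => g (- s)) 0 T - (- RInt g 0 (- T)))). intros z _.
  eapply is_derive_R_eq.
  - apply is_derive_R_minus; [now apply is_derive_RInt_cont|].
    apply (is_derive_ext (fun T => -1 * RInt g 0 (- T))); [intros y; eqR; ring|].
    apply is_derive_R_scal. apply (is_derive_R_comp (fun y => RInt g 0 y) (fun T => - T) z (g (- z)) (-1)).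
    + now apply is_derive_RInt_cont.
    + auto_derive; [auto|ring].
  - ring. }
rewrite Ropp_0, !RInt_point in K. unfold zero in K; simpl in K.
rewrite (RInt_swap_cont g 0 (- T)) by auto. lra.
Qed.

(** The argument of [end_plus] reflected in time. J is simpler here: at a very negative time the
    flux is already small on the whole past. *)
Lemma end_minus (Lam M : R) (F b : R -> R) : bsol c b (fun t => F (b t)) -> lip Lam F ->
  (forall t, t <= 0 -> mass b (fun t => F (b t)) t <= M) ->
  exists L, F L = 0 /\ tends_minus b L /\ tends_minus (mass b (fun t => F (b t))) L.
Proof.
intros H HF HM. set (g := fun t => F (b t)) in *.
assert (Cg : cont g) by apply H.
destruct (integrable_unif_cont_to_0 (fun s => g (- s)) ((M - mass b g 0) / c)) as [l [Hl Hg0]].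
- apply (cont_comp (fun s => - s) g); auto. apply (cont_derive _ (fun _ => -1)). intros s. auto_derive; [auto|ring].
- intros t _. apply H.
- intros eps He. destruct (lip_unif_cont Lam F b HF) with (eps := eps) as [d [Hd Hud]]; auto.
  + intros e Hee. now apply (bsol_unif_cont b g).
  + exists d. split; auto. intros s t Hst. apply Hud. replace (- s - - t) with (- (s - t)) by ring. now rewrite Rabs_Ropp.
- intros T HT. rewrite RInt_reflect by auto. specialize (HM (- T) ltac:(lra)).
  assert (K := mass_eq b g (- T) 0 H).
  apply Rmult_le_reg_r with c; [auto|]. unfold Rdiv. rewrite Rmult_assoc, Rinv_l by lra. lra.
- pose (L := mass b g 0 + c * l).
  assert (Tm : tends_minus (mass b g) L).
  { intros eps He. destruct (Hl (eps / c)) as [A [HA HA']]; [now apply Rdiv_lt_0_compat|].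
    exists (- A). split; [lra|]. intros t Ht. assert (K := mass_eq b g t 0 H). unfold L.
    specialize (HA' (- t) ltac:(lra)). rewrite RInt_reflect, Ropp_involutive in HA' by auto.
    replace (mass b g t - (mass b g 0 + c * l)) with (c * (RInt g t 0 - l)) by lra.
    rewrite Rabs_mult, (Rabs_right c) by lra.
    apply Rmult_lt_compat_l with (r := c) in HA'; [|auto]. replace (c * (eps / c)) with eps in HA' by (field; lra). exact HA'. }
  assert (Tg : forall eps, 0 < eps -> exists T, T <= 0 /\ forall t, t <= T -> Rabs (g t) <= eps).
  { intros eps He. destruct (Hg0 eps He) as [T [HT HT']]. exists (- T). split; [lra|]. intros t Ht.
    specialize (HT' (- t) ltac:(lra)). rewrite Ropp_involutive in HT'.
    rewrite Rabs_right; [lra|apply Rle_ge, H]. }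
  assert (Tb : tends_minus b L).
  { intros eps He. destruct (Tm (eps / 2)) as [T1 [HT1 H1]]; [lra|].
    destruct (Tg (eps / 4 / (4 / (3 * c)))) as [T2 [HT2 H2]]; [repeat apply Rdiv_lt_0_compat; lra|].
    exists (T1 + T2). split; [lra|]. intros t Ht. specialize (H1 t ltac:(lra)).
    assert (J1 := J_to_0_minus g t (eps / 4 / (4 / (3 * c))) (bs_g _ _ _ H) (fun s Hs => H2 s ltac:(lra))).
    replace (eps / 4 / (4 / (3 * c)) * (4 / (3 * c))) with (eps / 4) in J1 by (field; lra).
    assert (J0 := J_bs b g t H). unfold mass in H1. rabs_lra. }
  exists L. split; [|split; [exact Tb|exact Tm]].
  apply (limit_zero_of_F Lam F L HF). intros eps He.
  destruct (Tb eps He) as [T1 [HT1 H1]]. destruct (Tg (eps / 2)) as [T2 [HT2 H2]]; [lra|].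
  exists (b (T1 + T2)). split; [apply H1; lra|]. specialize (H2 (T1 + T2) ltac:(lra)). unfold g in H2. lra.
Qed.
End Theory.

(** * Uniqueness of the heteroclinic trace *)

Lemma lip_cont (Lam : R) (F : R -> R) : lip Lam F -> cont F.
Proof.
intros [HL HF] x. apply continuous_eps. intros eps He. exists (eps / (Lam + 1)).
split; [apply Rdiv_lt_0_compat; lra|]. intros y Hy. apply Rle_lt_trans with (1 := HF y x).
apply Rmult_lt_compat_l with (r := Lam + 1) in Hy; [|lra].
replace ((Lam + 1) * (eps / (Lam + 1))) with eps in Hy by (field; lra).
generalize (Rabs_pos (y - x)). lra.
Qed.

Lemma IVT_decr (f : R -> R) (a b l : R) : cont f -> a <= b -> f b <= l <= f a -> exists t, a <= t <= b /\ f t = l.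
Proof.
intros Hf Hab Hl.
destruct (IVT_gen f a b l) as [t [Ht E]].
- intros x. apply continuity_pt_filterlim, Hf.
- rewrite Rmin_right, Rmax_left by lra. lra.
- rewrite Rmin_left, Rmax_right in Ht by lra. now exists t.
Qed.

Lemma loc_lip (f : R -> R) (a b eta : R) : (forall x, a <= x <= b -> ex_derive f x) ->
  (forall x, a <= x <= b -> Rabs (Derive f x) <= eta) ->
  forall x y, a <= x <= b -> a <= y <= b -> Rabs (f x - f y) <= eta * Rabs (x - y).
Proof.
intros Hd Hb x y Hx Hy.
assert (Hin : forall z, Rmin y x <= z <= Rmax y x -> a <= z <= b).
{ intros z Hz. unfold Rmin, Rmax in Hz. destruct (Rle_dec y x); lra. }
destruct (MVT_gen f y x (Derive f)) as [z [Hz Hz']].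
- intros z Hz. apply Derive_correct, Hd, Hin. lra.
- intros z Hz. apply continuity_pt_filterlim. apply (ex_derive_continuous f). now apply Hd, Hin.
- rewrite Hz', Rabs_mult. apply Rmult_le_compat_r; [apply Rabs_pos|]. now apply Hb, Hin.
Qed.

(** h' is bounded on compact sets, and periodicity brings the first point into [0, 2 pi]; the second
    then stays in a fixed interval if the distance is below 2 pi. For larger distances |h| <= 1
    suffices. *)
Lemma h_lip (h : R -> R) : h_hyp h -> exists Lam, lip Lam h.
Proof.
intros [[H1 [H2 H3]] [Hper [Hle [_ [Hpi Hge]]]]].
generalize PI_RGT_0; intros HPI.
destruct (cont_bounded (Derive h) (-2 * PI) (4 * PI)) as [M [HM0 HM]].
{ intros x. apply (ex_derive_continuous (Derive h)), H2. }
assert (Hz : forall (k : nat) u, h (u + 2 * INR k * PI) = h u).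
{ induction k as [|k IH]; intros u.
  - simpl. f_equal. ring.
  - rewrite S_INR. replace (u + 2 * (INR k + 1) * PI) with ((u + 2 * INR k * PI) + 2 * PI) by ring.
    rewrite Hper. apply IH. }
assert (Hk : forall (k : Z) u, h (u + 2 * IZR k * PI) = h u).
{ intros k u. destruct (Z_le_gt_dec 0 k) as [Hk|Hk].
  - rewrite <- (Hz (Z.to_nat k) u), INR_IZR_INZ, Z2Nat.id by lia. reflexivity.
  - rewrite <- (Hz (Z.to_nat (- k)) (u + 2 * IZR k * PI)), INR_IZR_INZ, Z2Nat.id, opp_IZR by lia. f_equal. ring. }
exists (M + 1). split; [lra|]. intros a b.
assert (H0 : Rabs (h a - h b) <= 2).
{ assert (A1 := Hle a). assert (A2 := Hle b). assert (A3 := Hge a). assert (A4 := Hge b). apply Rabs_le_between. lra. }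
destruct (Rle_dec (2 * PI) (Rabs (a - b))) as [Hfar|Hnear].
{ generalize PI2_3_2. intros. assert (Rabs (a - b) <= (M + 1) * Rabs (a - b)); [|lra]. generalize (Rabs_pos (a - b)). nra. }
destruct (archimed (a / (2 * PI))) as [A1 A2]. set (k := (up (a / (2 * PI)) - 1)%Z).
assert (Ek : IZR k = IZR (up (a / (2 * PI))) - 1) by (unfold k; now rewrite minus_IZR).
assert (Ea : a = a / (2 * PI) * (2 * PI)) by (field; lra).
pose (a' := a + 2 * IZR (- k) * PI). pose (b' := b + 2 * IZR (- k) * PI).
assert (Ha' : 0 <= a' <= 2 * PI).
{ unfold a'. rewrite opp_IZR, Ek. set (r := a / (2 * PI)) in *. nra. }
apply Rnot_le_lt in Hnear. apply Rabs_def2 in Hnear.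
assert (Hb' : -2 * PI <= b' <= 4 * PI) by (unfold a', b' in *; lra).
rewrite <- (Hk (- k)%Z a), <- (Hk (- k)%Z b). fold a' b'.
replace (a - b) with (a' - b') by (unfold a', b'; ring).
apply Rle_trans with (M * Rabs (a' - b')); [|generalize (Rabs_pos (a' - b')); nra].
apply (loc_lip h (-2 * PI) (4 * PI) M); auto; lra.
Qed.

(** h is minimal at pi, hence h'(pi) = 0. This degeneracy provides the Lipschitz constant demanded
    by [small_slope]. *)
Lemma h_small_slope (h : R -> R) (eta : R) : h_hyp h -> 0 < eta -> exists rho, 0 < rho /\
  forall a b, Rabs (a - PI) <= rho -> Rabs (b - PI) <= rho -> Rabs (h a - h b) <= eta * Rabs (a - b).
Proof.
intros [[H1 [H2 H3]] [Hper [Hle [_ [Hpi Hge]]]]] He.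
assert (H0 : Derive h PI = 0).
{ apply (deriv_at_interior_min h PI (Derive h PI) 1); [lra|apply Derive_correct, H1|].
  intros y _. rewrite Hpi. apply Hge. }
assert (HC : cont (Derive h)) by (intros x; apply (ex_derive_continuous (Derive h)), H2).
destruct (proj1 (continuous_eps (Derive h) PI) (HC PI) eta He) as [d [Hd Hd']].
exists (d / 2). split; [lra|]. intros a b Ha Hb.
apply Rabs_le_between in Ha, Hb.
apply (loc_lip h (PI - d / 2) (PI + d / 2) eta); auto; try lra.
intros x Hx. left. replace (Derive h x) with (Derive h x - Derive h PI) by (rewrite H0; ring).
apply Hd'. apply Rabs_def1; lra.
Qed.

Definition flux1 (h : R -> R) (v : R) : R := 1 + 1 * h v.

Lemma flux1_range (h : R -> R) (v : R) : h_hyp h -> 0 <= flux1 h v <= 2.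
Proof. intros [_ [_ [H1 [_ [_ H2]]]]]. unfold flux1. specialize (H1 v). specialize (H2 v). lra. Qed.

Lemma flux1_PI (h : R -> R) : h_hyp h -> flux1 h PI = 0.
Proof. intros [_ [_ [_ [_ [H _]]]]]. unfold flux1. rewrite H. ring. Qed.

Lemma flux1_mPI (h : R -> R) : h_hyp h -> flux1 h (- PI) = 0.
Proof.
intros [_ [Hper [_ [_ [H _]]]]]. unfold flux1. rewrite <- Hper.
replace (- PI + 2 * PI) with PI by ring. rewrite H. ring.
Qed.

Lemma flux1_lip (h : R -> R) (Lam : R) : lip Lam h -> lip Lam (flux1 h).
Proof.
intros [H0 H]. split; auto. intros a b. unfold flux1.
replace (1 + 1 * h a - (1 + 1 * h b)) with (h a - h b) by ring. apply H.
Qed.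

Lemma flux1_zero (h : R -> R) (v : R) :
  (forall v, (forall k : Z, v <> PI + 2 * IZR k * PI) -> -1 < h v) ->
  -PI <= v <= PI -> flux1 h v = 0 -> v = - PI \/ v = PI.
Proof.
intros Hh Hv E. unfold flux1 in E.
destruct (classic (exists k : Z, v = PI + 2 * IZR k * PI)) as [[k Hk]|Hn].
- generalize PI_RGT_0; intros HPI.
  assert (Hk1 : -1 <= IZR k <= 0).
  { split; apply Rmult_le_reg_r with (2 * PI); lra. }
  assert (Ek : (k = 0 \/ k = -1)%Z) by (destruct Hk1 as [A1 A2]; apply le_IZR in A1, A2; lia).
  destruct Ek as [Ek|Ek]; rewrite Hk, Ek; [right|left]; ring.
- assert (-1 < h v); [|lra]. apply Hh. intros k Hk. apply Hn. now exists k.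
Qed.

Section Uniq.
Context (c : R) (Hc : 0 < c).

(** The integral of g vanishes over every interval of the past, so g does; then J vanishes too and b
    is the mass. *)
Lemma mass_const_past (b g : R -> R) (t k : R) : bsol c b g -> (forall s, s <= t -> mass c b g s = k) ->
  forall s, s <= t -> g s = 0 /\ b s = k.
Proof.
intros H Hm.
assert (Cg : cont g) by apply H.
assert (Hlt : forall s, s < t -> g s = 0).
{ intros s Hs.
  assert (D : is_derive (fun r => RInt g s r) s (g s)) by now apply is_derive_RInt_cont.
  assert (D0 : is_derive (fun r => RInt g s r) s 0).
  { apply (is_derive_ext_loc (fun _ => 0)); [|apply is_derive_R_const].
    exists (mkposreal (t - s) ltac:(lra)). intros y Hy. assert (Hy' : Rabs (y - s) < t - s) by exact Hy.
    apply Rabs_def2 in Hy'. assert (K := mass_eq c b g s y H). rewrite !Hm in K by lra.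
    assert (E : c * RInt g s y = 0) by lra. apply Rmult_integral in E. destruct E as [E|E]; [lra|]. eqR. symmetry. exact E. }
  apply is_derive_unique in D. apply is_derive_unique in D0. rewrite <- D. exact D0. }
assert (Hg : forall s, s <= t -> g s = 0).
{ intros s Hs; destruct (Rle_lt_or_eq_dec _ _ Hs) as [Hs1|Hs1]; [now apply Hlt|]. subst s.
  apply Rabs_eq_0. apply Rle_antisym; [|apply Rabs_pos]. apply Rnot_lt_le. intros He.
  destruct (proj1 (continuous_eps g t) (Cg t) _ He) as [d [Hd Hd']].
  specialize (Hd' (t - d / 2)). rewrite (Hlt (t - d / 2)) in Hd' by lra.
  assert (K : Rabs (t - d / 2 - t) < d) by (apply Rabs_def1; lra). specialize (Hd' K).
  rewrite Rminus_0_l, Rabs_Ropp in Hd'. lra. }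
intros s Hs. split; [now apply Hg|]. rewrite <- (Hm s Hs). unfold mass.
rewrite (J_past c g (fun _ => 0)) by (intros r Hr; apply Hg; lra). rewrite J_0 by auto. ring.
Qed.

Lemma mass_shift (b g : R -> R) (h t : R) : mass c (fun t => b (t + h)) (fun t => g (t + h)) t = mass c b g (t + h).
Proof. unfold mass. now rewrite J_shift. Qed.

Lemma tends_minus_decr_le (f : R -> R) (L t : R) : (forall s t, s <= t -> f t <= f s) -> tends_minus f L -> f t <= L.
Proof.
intros Hd HL. apply Rnot_lt_le. intros Hlt.
destruct (HL (f t - L)) as [T [HT H]]; [lra|].
specialize (H (Rmin T t) (Rmin_l _ _)). specialize (Hd (Rmin T t) t (Rmin_r _ _)). rabs_lra.
Qed.

Context (h : R -> R) (Hh : h_hyp h).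
Let F := flux1 h.

Lemma small_slope_ex : exists eta, 0 < eta /\ small_slope c eta.
Proof.
assert (Hl := lam_pos c Hc).
assert (H1 : 0 < c / lam c + 4 / (3 * c)).
{ assert (0 < c / lam c) by now apply Rdiv_lt_0_compat. assert (0 < 4 / (3 * c)) by (apply Rdiv_lt_0_compat; lra). lra. }
exists (1 / 4 / (c / lam c + 4 / (3 * c))).
assert (H2 : 0 < 1 / 4 / (c / lam c + 4 / (3 * c))) by (apply Rdiv_lt_0_compat; lra).
split; [auto|]. split; [lra|]. right. field. split; [lra|]. split; [lra|].
intros E. assert (E2 : c / lam c + 4 / (3 * c) = (4 * lam c + 3 * c * c) / (3 * c * lam c)) by (field; lra).
assert (0 < 4 * lam c + 3 * c * c) by nra. lra.
Qed.

Lemma heteroclinic_unique (b1 b2 : R -> R) :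
  bsol c b1 (fun t => F (b1 t)) -> bsol c b2 (fun t => F (b2 t)) ->
  tends_minus b1 PI -> tends_minus b2 PI ->
  tends_minus (mass c b1 (fun t => F (b1 t))) PI -> tends_minus (mass c b2 (fun t => F (b2 t))) PI ->
  (forall t, t <= 0 -> mass c b1 (fun t => F (b1 t)) t < PI) ->
  (forall t, t <= 0 -> mass c b2 (fun t => F (b2 t)) t < PI) ->
  exists s, forall t, b1 t = b2 (t + s).
Proof.
intros H1 H2 T1 T2 TM1 TM2 M1 M2.
destruct small_slope_ex as [eta [Heta Hss]].
destruct (h_small_slope h eta Hh Heta) as [rho [Hrho Hslope]].
destruct (h_lip h Hh) as [Lam HLam]. assert (HF := flux1_lip h Lam HLam). fold F in HF.
destruct (T1 rho Hrho) as [S1 [HS1 HS1']]. destruct (T2 rho Hrho) as [S2 [HS2 HS2']].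
pose (T := Rmin S1 S2).
assert (HT : T <= S1 /\ T <= S2 /\ T <= 0) by (unfold T; generalize (Rmin_l S1 S2) (Rmin_r S1 S2); lra).
set (g1 := fun t => F (b1 t)) in *. set (g2 := fun t => F (b2 t)) in *.
(* The larger of the two masses at T: a level below pi that both masses attain no later than T, that
   is while both traces are still rho-close to pi. *)
set (l := Rmax (mass c b1 g1 T) (mass c b2 g2 T)).
assert (Hl : l < PI) by (apply Rmax_lub_lt; [apply M1|apply M2]; lra).
assert (find : forall m, cont m -> tends_minus m PI -> m T <= l -> exists t, t <= T /\ m t = l).
{ intros m Cm Tm Hm. destruct (Tm (PI - l)) as [R1 [HR1 HR1']]; [lra|].
  specialize (HR1' (Rmin R1 T) (Rmin_l _ _)). apply Rabs_def2 in HR1'.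
  destruct (IVT_decr m (Rmin R1 T) T l Cm (Rmin_r _ _)) as [t [Ht E]]; [lra|]. exists t. split; [lra|exact E]. }
destruct (find (mass c b1 g1)) as [t1 [Ht1 E1]]; [now apply mass_cont|exact TM1|apply Rmax_l|].
destruct (find (mass c b2 g2)) as [t2 [Ht2 E2]]; [now apply mass_cont|exact TM2|apply Rmax_r|].
exists (t2 - t1).
assert (H2s := bsol_shift c b2 g2 (t2 - t1) H2).
assert (HD : mass c b1 g1 t1 - mass c (fun t => b2 (t + (t2 - t1))) (fun t => g2 (t + (t2 - t1))) t1 = 0).
{ rewrite mass_shift. replace (t1 + (t2 - t1)) with t2 by ring. lra. }
destruct (backward_estimate c Hc b1 g1 _ _ t1 eta (2 * rho) H1 H2s Hss) as [K _].
{ intros s Hs. unfold g1, g2, F, flux1.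
  replace (1 + 1 * h (b1 s) - (1 + 1 * h (b2 (s + (t2 - t1))))) with (h (b1 s) - h (b2 (s + (t2 - t1)))) by ring.
  apply Hslope; left; [apply HS1'|apply HS2']; lra. }
{ intros s Hs. assert (A1 := HS1' s ltac:(lra)). assert (A2 := HS2' (s + (t2 - t1)) ltac:(lra)).
  rabs_lra. }
rewrite HD, Rabs_R0 in K.
assert (Hpast : forall t, t <= t1 -> b1 t = b2 (t + (t2 - t1))).
{ intros t Ht. specialize (K (t1 - t) ltac:(lra)). replace (t1 - (t1 - t)) with t in K by ring.
  rewrite Rmult_0_r, Rmult_0_l in K. generalize (Rabs_pos (b1 t - b2 (t + (t2 - t1)))). intros Hp.
  apply Rminus_diag_uniq, Rabs_eq_0. lra. }
apply (bsol_unique_forward c Hc b1 g1 _ _ t1 Lam H1 H2s (proj1 HF)).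
- intros t _. apply HF.
- intros t Ht. split; [now apply Hpast|]. unfold g1, g2. now rewrite Hpast.
Qed.

(** A zero k of the flux is a constant solution, and U lies above its trace since slopes are
    nonnegative; hence ordering the traces at a single time is enough. *)
Lemma compare_with_zero (b : R -> R) (k t0 t : R) : F k = 0 -> bsol c b (fun t => F (b t)) ->
  k <= b t0 -> t0 <= t -> k <= b t.
Proof.
intros HFk H Hk Ht. destruct (h_lip h Hh) as [Lam HLam]. assert (HF := flux1_lip h Lam HLam). fold F in HF.
rewrite <- (U_0 c b (fun t => F (b t)) t), <- (U_const c Hc k 0 t).
apply (bsol_compare c Hc b (fun t => F (b t)) (fun _ => k) (fun _ => 0) t0 t Lam); auto; try lra.
- now apply bsol_const.
- apply HF.
- intros s _. rewrite <- HFk. apply HF.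
- intros x Hx. rewrite U_const by auto. apply Rle_trans with (1 := Hk). now apply (U_bounds c Hc).
Qed.

(** Equality at t would make the decreasing mass constant, equal to k, on the whole past, and then
    [b t = k]. *)
Lemma mass_lt_of_b_lt (b : R -> R) (t k : R) : bsol c b (fun t => F (b t)) ->
  (forall s, mass c b (fun t => F (b t)) s <= k) -> b t < k -> mass c b (fun t => F (b t)) t < k.
Proof.
intros H Hm Hb. destruct (Rle_lt_or_eq_dec _ _ (Hm t)) as [Hlt|E]; [exact Hlt|exfalso].
assert (K : forall s, s <= t -> mass c b (fun t => F (b t)) s = k).
{ intros s Hs. apply Rle_antisym; [apply Hm|]. rewrite <- E. now apply mass_decr. }
destruct (mass_const_past b _ t k H K t (Rle_refl t)) as [_ E2]. lra.
Qed.
End Uniq.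

(** * Limits along an ultrafilter *)

Record ultra (U : (nat -> Prop) -> Prop) : Prop := {
  ultra_false : ~ U (fun _ => False);
  ultra_and : forall P Q, U P -> U Q -> U (fun n => P n /\ Q n);
  ultra_imp : forall P Q : nat -> Prop, (forall n, P n -> Q n) -> U P -> U Q;
  ultra_dec : forall P, U P \/ U (fun n => ~ P n);
  ultra_ge : forall N, U (fun n => (N <= n)%nat) }.

(** An ultrafilter refining the filter of cofinite sets. *)
Lemma ex_ultra : exists U, ultra U.
Proof.
pose (F := fun P : nat -> Prop => exists N, forall n, (N <= n)%nat -> P n).
assert (PF : filter.ProperFilter F).
{ split.
  - intros [N HN]. exact (HN N (Nat.le_refl N)).
  - split.
    + exists 0%nat. intros n _. exact Logic.I.
    + intros P Q [N1 H1] [N2 H2]. exists (max N1 N2). intros n Hn.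
      split; [apply H1 | apply H2]; lia.
    + intros P Q HPQ [N HN]. exists N. intros n Hn. apply HPQ. now apply HN. }
destruct (filter.ultraFilterLemma PF) as [U [HU HF]].
pose proof (@filter.ultra_proper _ _ HU) as HP.
pose proof (@filter.filter_filter _ U HP) as HFil.
exists U. split.
- exact (@filter.filter_not_empty _ U HP).
- intros P Q HPp HQ. exact (@filter.filterI _ U HFil _ _ HPp HQ).
- intros P Q HPQ H. exact (@filter.filterS _ U HFil P Q HPQ H).
- intros P. exact (@filter.in_ultra_setVsetC _ U P HU).
- intros N. apply HF. now exists N.
Qed.

Definition ulim (U : (nat -> Prop) -> Prop) (a : nat -> R) (l : R) : Prop :=
  forall eps, 0 < eps -> U (fun n => Rabs (a n - l) < eps).

Section Ultra.
Context (U : (nat -> Prop) -> Prop) (HU : ultra U).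

Lemma ultra_all (P : nat -> Prop) : (forall n, P n) -> U P.
Proof.
intros H. apply (ultra_imp U HU (fun n => (0 <= n)%nat)).
- intros n _; apply H.
- apply ultra_ge, HU.
Qed.

Lemma ultra_ex (P : nat -> Prop) : U P -> exists n, P n.
Proof.
intros H. apply NNPP. intros Hn. apply (ultra_false U HU).
apply (ultra_imp U HU P); [|exact H]. intros n Hp. apply Hn. now exists n.
Qed.

(** The limit is the supremum of the levels x that lie below the sequence on a large set. *)
Lemma ulim_bounded (a : nat -> R) (M : R) :
  (forall n, Rabs (a n) <= M) -> exists l, Rabs l <= M /\ ulim U a l.
Proof.
intros HM.
pose (E := fun x => U (fun n => x <= a n)).
assert (HMn : forall n, -M <= a n <= M) by (intros n; apply Rabs_le_between, HM).
assert (HEM : forall x, E x -> x <= M).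
{ intros x Hx. destruct (ultra_ex _ Hx) as [n Hn]. specialize (HMn n). lra. }
assert (HE0 : E (-M)) by (apply ultra_all; intros n; apply HMn).
destruct (completeness E) as [l [Hub Hlub]].
- exists M. intros x Hx. now apply HEM.
- now exists (-M).
- assert (Hl : -M <= l <= M).
  { split; [now apply Hub | apply Hlub; intros x Hx; now apply HEM]. }
  exists l. split; [now apply Rabs_le_between|].
  intros eps He.
  assert (H1 : ~ E (l + eps)) by (intros H; apply Hub in H; lra).
  assert (H2 : exists x, l - eps < x /\ E x).
  { apply NNPP. intros Hn. assert (l <= l - eps); [|lra].
    apply Hlub. intros x Hx. apply Rnot_lt_le. intros Hlt. apply Hn. now exists x. }
  destruct H2 as [x [Hx HEx]].
  destruct (ultra_dec U HU (fun n => l + eps <= a n)) as [H|H]; [contradiction|].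
  generalize (ultra_and U HU _ _ HEx H). apply (ultra_imp U HU).
  intros n [Ha Hb]. apply Rabs_def1; lra.
Qed.

Lemma ulim_le (a b : nat -> R) (l l' : R) :
  ulim U a l -> ulim U b l' -> U (fun n => a n <= b n) -> l <= l'.
Proof.
intros Ha Hb Hab. apply Rnot_lt_le. intros Hlt.
assert (He : 0 < (l - l') / 2) by lra.
destruct (ultra_ex _ (ultra_and U HU _ _ Hab
   (ultra_and U HU _ _ (Ha _ He) (Hb _ He)))) as [n [H [H1 H2]]].
apply Rabs_def2 in H1. apply Rabs_def2 in H2. lra.
Qed.

Lemma ulim_const (l : R) : ulim U (fun _ => l) l.
Proof.
intros eps He. apply ultra_all. intros n. now rewrite Rminus_diag, Rabs_R0.
Qed.

Lemma ulim_unique (a : nat -> R) (l l' : R) : ulim U a l -> ulim U a l' -> l = l'.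
Proof.
intros H1 H2. apply Rle_antisym; apply (ulim_le a a); auto; apply ultra_all; intros; lra.
Qed.

Lemma ultra_forall_list (P : nat -> nat -> Prop) (N : nat) :
  (forall k, (k <= N)%nat -> U (fun n => P k n)) ->
  U (fun n => forall k, (k <= N)%nat -> P k n).
Proof.
induction N as [|N IH]; intros H.
- apply (ultra_imp U HU (P 0%nat)); [|now apply H].
  intros n Hn k Hk. replace k with 0%nat by lia. exact Hn.
- generalize (ultra_and U HU _ _ (IH (fun k Hk => H k ltac:(lia))) (H (S N) (Nat.le_refl _))).
  apply (ultra_imp U HU). intros n [Ha Hb] k Hk.
  destruct (Nat.eq_dec k (S N)) as [->|]; [exact Hb | apply Ha; lia].
Qed.

End Ultra.

(** The Arzela-Ascoli argument: by equicontinuity, inherited by the limit, it suffices to control a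
    grid of mesh d/2, and an ultrafilter is closed under finite intersections. *)
Lemma ulim_loc_unif (U : (nat -> Prop) -> Prop) (HU : ultra U)
    (f : nat -> R -> R) (l : R -> R) :
  (forall eps, 0 < eps -> exists d, 0 < d /\ forall n x y, Rabs (x - y) < d ->
     Rabs (f n x - f n y) < eps) ->
  (forall x, ulim U (fun n => f n x) (l x)) ->
  forall A B eps, 0 < eps -> U (fun n => forall x, A <= x <= B -> Rabs (f n x - l x) < eps).
Proof.
intros Heq Hl A B eps He.
destruct (Heq (eps / 4)) as [d [Hd Hf]]; [lra|].
assert (Hld : forall x y, Rabs (x - y) < d -> Rabs (l x - l y) <= eps / 4).
{ intros x y Hxy. apply Rabs_le_between.
  assert (E : forall k, 0 < k -> - (eps/4) - k <= l x - l y <= eps/4 + k).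
  { intros k Hk.
    destruct (ultra_ex U HU _ (ultra_and U HU _ _ (Hl x (k/2) ltac:(lra)) (Hl y (k/2) ltac:(lra))))
      as [n [H1 H2]].
    specialize (Hf n x y Hxy). apply Rabs_def2 in Hf, H1, H2. lra. }
  split; apply Rnot_lt_le; intros Hlt.
  - specialize (E ((- (eps/4) - (l x - l y))/2) ltac:(lra)). lra.
  - specialize (E ((l x - l y - eps/4)/2) ltac:(lra)). lra. }
destruct (Rlt_dec B A) as [HBA|HBA].
{ apply (ultra_all U HU). intros n x Hx. lra. }
destruct (archimed ((B - A) / (d/2))) as [Har _].
assert (Hq : 0 <= (B - A) / (d/2)) by (apply Rdiv_le_0_compat; lra).
assert (HN : exists N : nat, (B - A) <= INR N * (d/2)).
{ exists (Z.to_nat (up ((B-A)/(d/2)))). rewrite INR_IZR_INZ, Z2Nat.id.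
  - apply Rmult_le_reg_r with (/ (d/2)); [apply Rinv_0_lt_compat; lra|].
    replace (IZR (up ((B - A) / (d / 2))) * (d / 2) * / (d / 2)) with (IZR (up ((B - A) / (d / 2))))
      by (field; lra). unfold Rdiv in *. lra.
  - apply le_IZR. lra. }
destruct HN as [N HN].
generalize (ultra_forall_list U HU
  (fun k n => Rabs (f n (A + INR k * (d/2)) - l (A + INR k * (d/2))) < eps/4) N
  (fun k _ => Hl _ (eps/4) ltac:(lra))).
apply (ultra_imp U HU). intros n Hn x Hx.
assert (Hk : exists k, (k <= N)%nat /\ Rabs (x - (A + INR k * (d/2))) < d).
{ assert (G : forall N', x - A <= INR N' * (d/2) -> exists k, (k <= N')%nat /\ Rabs (x - (A + INR k * (d/2))) < d).
  { induction N' as [|N' IH]; intros HN'.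
    - exists 0%nat. split; [lia|]. simpl in *. apply Rabs_def1; lra.
    - destruct (Rle_dec (x - A) (INR N' * (d/2))) as [Hle|Hle].
      + destruct (IH Hle) as [k [Hk1 Hk2]]. exists k. split; [lia|exact Hk2].
      + exists (S N'). split; [lia|]. rewrite S_INR in *. apply Rabs_def1; lra. }
  apply G. lra. }
destruct Hk as [k [HkN Hk]].
specialize (Hn k HkN). specialize (Hf n _ _ Hk). specialize (Hld _ _ Hk).
apply Rabs_def2 in Hf, Hn. apply Rabs_le_between in Hld. apply Rabs_def1; lra.
Qed.

Section Limit.
Context (c : R) (Hc : 0 < c).

Lemma weight_tail (phi : R -> R) (B eta S t : R) : 0 <= eta -> 0 <= B ->
  (forall s, 0 <= s -> Rabs (phi (t - s)) <= B) -> (forall s, 0 <= s <= S -> Rabs (phi (t - s)) <= eta) ->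
  forall s, 0 <= s -> Rabs (phi (t - s)) <= (eta + B * exp (- lam c * S)) * exp (lam c * s).
Proof.
intros He HB H1 H2 s Hs. assert (Hl := lam_pos c Hc).
assert (Hex : 1 <= exp (lam c * s)) by (apply exp_ge_1; nra).
generalize (exp_pos (- lam c * S)). intros Hp.
destruct (Rle_dec s S) as [HsS|HsS].
- specialize (H2 s ltac:(lra)). assert (0 <= B * exp (- lam c * S)) by (apply Rmult_le_pos; lra). nra.
- specialize (H1 s Hs).
  assert (E : 1 <= exp (- lam c * S) * exp (lam c * s)) by (rewrite <- exp_plus, <- exp_0; apply exp_le; nra).
  assert (B <= B * (exp (- lam c * S) * exp (lam c * s))) by nra.
  assert (0 <= eta * exp (lam c * s)) by (apply Rmult_le_pos; lra). lra.
Qed.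

Lemma diff_weighted (g g' : R -> R) (t Z X : R) : bdd 2 g -> bdd 2 g' -> 0 <= Z ->
  (forall s, 0 <= s -> Rabs (g (t - s) - g' (t - s)) <= Z * exp (lam c * s)) ->
  Rabs (J c g t - J c g' t) <= Z * (4 / (3 * c)) /\
  forall x, 0 <= x <= X -> Rabs (V c g x t - V c g' x t) <= Z * exp (c * X / 4) * X.
Proof.
intros Hg Hg' HZ H. assert (Hd := bdd_minus _ _ _ _ Hg Hg'). split.
- rewrite <- (J_minus c Hc 2 2 g g' t Hg Hg'). now apply (J_weighted c Hc (2 + 2)).
- intros x Hx. unfold V. rewrite <- RInt_minus_cont by (now apply (q_cont_x c Hc 2)).
  apply Rle_trans with (Z * exp (c * X / 4) * Rabs (x - 0)).
  + apply RInt_abs_le; [apply cont_minus; now apply (q_cont_x c Hc 2)|].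
    intros z Hz. rewrite Rmin_left, Rmax_right in Hz by lra.
    rewrite <- (q_minus c Hc 2 2 g g' z t Hg Hg').
    apply Rle_trans with (Z * exp (c * z / 4)).
    * apply (q_weighted c Hc); [apply Hd|lra|exact H].
    * apply Rmult_le_compat_l; auto. apply exp_le. nra.
  + rewrite Rminus_0_r, Rabs_right by lra. apply Rmult_le_compat_l; [|lra].
    apply Rmult_le_pos; auto. apply Rlt_le, exp_pos.
Qed.

Context (Uf : (nat -> Prop) -> Prop) (HU : ultra Uf).

(** The fluxes only have to approach [F (bn n t)] locally uniformly, which covers both a vanishing
    delay and theta -> 1. Local convergence is enough for J and V, since the weight discounts the
    far past uniformly. *)
Lemma bsol_limit (bn gn : nat -> R -> R) (Lam M : R) (F : R -> R) :
  (forall n, bsol c (bn n) (gn n)) -> lip Lam F -> (forall v, 0 <= F v <= 2) ->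
  (forall n, Rabs (bn n 0) <= M) ->
  (forall K eps, 0 < eps -> Uf (fun n => forall t, Rabs t <= K -> Rabs (gn n t - F (bn n t)) < eps)) ->
  exists b, bsol c b (fun t => F (b t)) /\ (forall t, ulim Uf (fun n => bn n t) (b t)) /\
    (forall t, ulim Uf (fun n => mass c (bn n) (gn n) t) (mass c b (fun t => F (b t)) t)) /\
    (forall K eps, 0 < eps -> Uf (fun n => forall x t, 0 <= x <= K -> Rabs t <= K ->
        Rabs (U c (bn n) (gn n) x t - U c b (fun t => F (b t)) x t) < eps)).
Proof.
intros Hs HF HF2 HM Herr.
(* From the mass law between 0 and t: the flux contributes 2 c |t| and the two values of J at most
   8/(3c) each. *)
assert (Hbound : forall t n, Rabs (bn n t) <= M + 2 * c * Rabs t + 16 / (3 * c)).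
{ intros t n. assert (E := bs_eq _ _ _ (Hs n) 0 t).
  assert (I := RInt_abs_le (gn n) 0 t 2 (proj1 (bs_g _ _ _ (Hs n))) (fun s _ => proj2 (bs_g _ _ _ (Hs n)) s)).
  assert (J1 := J_bs c Hc (bn n) (gn n) t (Hs n)). assert (J2 := J_bs c Hc (bn n) (gn n) 0 (Hs n)).
  rewrite Rminus_0_r in I. apply Rabs_le_between in I. specialize (HM n). apply Rabs_le_between in HM.
  replace (16 / (3 * c)) with (2 * (8 / (3 * c))) by (field; lra).
  set (k := 8 / (3 * c)) in *. set (r := Rabs t) in *. set (I0 := RInt (gn n) 0 t) in *.
  assert (- (2 * c * r) <= c * I0 <= 2 * c * r) by (split; nra).
  apply Rabs_le_between. lra. }
assert (Hex : forall t, exists l, ulim Uf (fun n => bn n t) l).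
{ intros t. destruct (ulim_bounded Uf HU (fun n => bn n t) _ (Hbound t)) as [l [_ Hl]]. now exists l. }
pose (b := fun t => epsilon (inhabits 0) (fun l => ulim Uf (fun n => bn n t) l)).
assert (Hb : forall t, ulim Uf (fun n => bn n t) (b t)) by (intros t; unfold b; apply epsilon_spec, Hex).
assert (Heq : forall eps, 0 < eps -> exists d, 0 < d /\ forall n s t, Rabs (s - t) < d -> Rabs (bn n s - bn n t) < eps).
{ intros eps He. destruct (equicont c Hc 2 (eps / 2)) as [d [Hd Hd']]; [lra|lra|].
  exists d. split; auto. intros n s t Hst. destruct (Hd' (gn n) t (s - t) (bs_g _ _ _ (Hs n)) Hst) as [E _].
  unfold window in E. replace (t + (s - t)) with s in E by ring.
  assert (K := bs_eq _ _ _ (Hs n) t s). rabs_lra. }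
assert (Cb : cont b).
{ intros t. apply continuous_eps. intros eps He. destruct (Heq (eps / 2)) as [d [Hd Hd']]; [lra|].
  exists d. split; auto. intros s Hst.
  destruct (ultra_ex Uf HU _ (ultra_and Uf HU _ _ (Hb s (eps / 4) ltac:(lra)) (Hb t (eps / 4) ltac:(lra)))) as [n [A1 A2]].
  specialize (Hd' n s t Hst). rabs_lra. }
pose (g := fun t => F (b t)).
assert (Cg : cont g) by (apply (cont_comp b F); auto; now apply (lip_cont Lam)).
assert (Bg : bdd 2 g).
{ split; auto. intros t. specialize (HF2 (b t)). unfold g. apply Rabs_le_between. lra. }
assert (Lb : forall K eps, 0 < eps -> Uf (fun n => forall t, Rabs t <= K -> Rabs (bn n t - b t) < eps)).
{ intros K eps He. apply (ultra_imp Uf HU (fun n => forall t, - K <= t <= K -> Rabs (bn n t - b t) < eps)).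
  - intros n H t Ht. apply H. now apply Rabs_le_between.
  - now apply (ulim_loc_unif Uf HU bn b Heq Hb). }
assert (Lg : forall K eps, 0 < eps -> Uf (fun n => forall t, Rabs t <= K -> Rabs (gn n t - g t) < eps)).
{ intros K eps He. assert (HL := proj1 HF).
  generalize (ultra_and Uf HU _ _ (Herr K (eps / 2) ltac:(lra)) (Lb K (eps / 2 / (Lam + 1)) ltac:(repeat apply Rdiv_lt_0_compat; lra))).
  apply (ultra_imp Uf HU). intros n [A1 A2] t Ht. specialize (A1 t Ht). specialize (A2 t Ht).
  replace (gn n t - g t) with ((gn n t - F (bn n t)) + (F (bn n t) - F (b t))) by (unfold g; ring).
  apply Rle_lt_trans with (1 := Rabs_triang _ _). assert (K2 := proj2 HF (bn n t) (b t)).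
  apply Rmult_lt_compat_l with (r := Lam + 1) in A2; [|lra].
  replace ((Lam + 1) * (eps / 2 / (Lam + 1))) with (eps / 2) in A2 by (field; lra).
  generalize (Rabs_pos (bn n t - b t)). lra. }
(* Closeness for |t| <= K + S, with S so large that the weight absorbs the older flux difference,
   which is at most 4. *)
assert (Lw : forall K eta, 0 < eta -> Uf (fun n => forall t, Rabs t <= K -> forall s, 0 <= s ->
    Rabs (gn n (t - s) - g (t - s)) <= eta * exp (lam c * s))).
{ intros K eta He. assert (Hl := lam_pos c Hc).
  destruct (exp_neg_small 4 (lam c) Hl (eta / 2)) as [S [HS HS']]; [lra|].
  specialize (HS' S (Rle_refl S)). rewrite Rabs_right in HS' by (generalize (exp_pos (- lam c * S)); lra).
  generalize (Lg (K + S) (eta / 2) ltac:(lra)). apply (ultra_imp Uf HU). intros n A t Ht s Hs0.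
  assert (Hd := bdd_minus _ _ _ _ (bs_g _ _ _ (Hs n)) Bg).
  assert (T := weight_tail (fun r => gn n r - g r) 4 (eta / 2) S t ltac:(lra) ltac:(lra)).
  eapply Rle_trans; [apply T; auto|].
  - intros r Hr. apply Rle_trans with (1 := proj2 Hd (t - r)). lra.
  - intros r Hr. left. apply A. rabs_lra.
  - apply Rmult_le_compat_r; [apply Rlt_le, exp_pos|lra]. }
assert (LJ : forall t, ulim Uf (fun n => J c (gn n) t) (J c g t)).
{ intros t eps He. assert (Hk : 0 < 4 / (3 * c)) by (apply Rdiv_lt_0_compat; lra).
  generalize (Lw (Rabs t) (eps / 2 / (4 / (3 * c))) ltac:(repeat apply Rdiv_lt_0_compat; lra)).
  apply (ultra_imp Uf HU). intros n A.
  assert (Hz : 0 < eps / 2 / (4 / (3 * c))) by (repeat apply Rdiv_lt_0_compat; lra).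
  destruct (diff_weighted (gn n) g t _ 0 (bs_g _ _ _ (Hs n)) Bg (Rlt_le _ _ Hz) (A t (Rle_refl _))) as [E _].
  replace (eps / 2 / (4 / (3 * c)) * (4 / (3 * c))) with (eps / 2) in E by (field; lra). lra. }
assert (LI : forall t1 t2 eps, 0 < eps -> Uf (fun n => Rabs (RInt (gn n) t1 t2 - RInt g t1 t2) < eps)).
{ intros t1 t2 eps He.
  pose (w := Rabs (t2 - t1) + 1). assert (Hw : 0 < w) by (unfold w; generalize (Rabs_pos (t2 - t1)); lra).
  generalize (Lg (Rabs t1 + Rabs t2) (eps / 2 / w) ltac:(repeat apply Rdiv_lt_0_compat; lra)).
  apply (ultra_imp Uf HU). intros n A.
  rewrite <- RInt_minus_cont by (apply (Hs n) || apply Bg).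
  apply Rle_lt_trans with (eps / 2 / w * Rabs (t2 - t1)).
  - apply RInt_abs_le; [apply cont_minus; [apply (Hs n)|apply Bg]|]. intros s Hss. left. apply A.
    generalize (Rle_abs t1) (Rle_abs t2) (Rle_abs (- t1)) (Rle_abs (- t2)) (Rabs_pos t1) (Rabs_pos t2). rewrite !Rabs_Ropp. intros.
    apply Rabs_le_between. unfold Rmin, Rmax in Hss. destruct (Rle_dec t1 t2); lra.
  - assert (E : eps / 2 / w * w = eps / 2) by (field; lra).
    assert (0 < eps / 2 / w) by (repeat apply Rdiv_lt_0_compat; lra).
    assert (Rabs (t2 - t1) <= w) by (unfold w; lra). nra. }
exists b. fold g.
assert (Hbs : bsol c b g).
{ split; auto.
  - intros t. apply HF2.
  - intros t1 t2. apply Rminus_diag_uniq, Rabs_eq_0, Rle_antisym; [|apply Rabs_pos].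
    apply Rnot_lt_le. intros He.
    set (X := b t2 + J c g t2 - (b t1 + J c g t1 - c * RInt g t1 t2)) in *. set (eps := Rabs X) in *.
    pose (e := eps / (8 * (1 + c))). assert (Hee : 0 < e) by (apply Rdiv_lt_0_compat; lra).
    destruct (ultra_ex Uf HU _ (ultra_and Uf HU _ _ (ultra_and Uf HU _ _ (Hb t1 e Hee) (Hb t2 e Hee))
       (ultra_and Uf HU _ _ (ultra_and Uf HU _ _ (LJ t1 e Hee) (LJ t2 e Hee)) (LI t1 t2 e Hee)))) as [n [[A1 A2] [[A3 A4] A5]]].
    assert (E := bs_eq _ _ _ (Hs n) t1 t2).
    apply Rabs_def2 in A1, A2, A3, A4, A5.
    assert (He8 : e * (8 * (1 + c)) = eps) by (unfold e; field; lra).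
    assert (HX : Rabs X <= 4 * e + c * e).
    { unfold X. apply Rabs_le_between. set (I1 := RInt (gn n) t1 t2) in *. set (I2 := RInt g t1 t2) in *.
      assert (- (c * e) <= c * (I1 - I2) <= c * e) by (split; nra). lra. }
    fold eps in HX. nra. }
split; [exact Hbs|]. split; [exact Hb|]. split.
- intros t eps He. generalize (ultra_and Uf HU _ _ (Hb t (eps / 2) ltac:(lra)) (LJ t (eps / 2) ltac:(lra))).
  apply (ultra_imp Uf HU). intros n [A1 A2]. unfold mass. rabs_lra.
- intros K eps He.
  destruct (Rlt_dec K 0) as [HK|HK].
  { apply (ultra_all Uf HU). intros n x t Hx. lra. }
  pose (w := exp (c * K / 4) * (K + 1)).
  assert (Hw : 0 < w) by (apply Rmult_lt_0_compat; [apply exp_pos|lra]).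
  assert (Hz : 0 < eps / 2 / w) by (repeat apply Rdiv_lt_0_compat; lra).
  generalize (ultra_and Uf HU _ _ (Lb K (eps / 2) ltac:(lra)) (Lw K (eps / 2 / w) Hz)).
  apply (ultra_imp Uf HU). intros n [A1 A2] x t Hx Ht. specialize (A1 t Ht).
  destruct (diff_weighted (gn n) g t _ K (bs_g _ _ _ (Hs n)) Bg (Rlt_le _ _ Hz) (A2 t Ht)) as [_ E].
  specialize (E x Hx).
  assert (E2 : eps / 2 / w * exp (c * K / 4) * K <= eps / 2).
  { apply Rle_trans with (eps / 2 / w * exp (c * K / 4) * (K + 1)).
    - apply Rmult_le_compat_l; [|lra]. apply Rmult_le_pos; [lra|apply Rlt_le, exp_pos].
    - rewrite Rmult_assoc. fold w. right. field. lra. }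
  unfold U. rabs_lra.
Qed.
End Limit.

(** * Existence of the heteroclinic trace *)

Definition clamp (a b v : R) : R := Rmax a (Rmin b v).

Lemma clamp_lip (a b u v : R) : Rabs (clamp a b u - clamp a b v) <= Rabs (u - v).
Proof.
unfold clamp, Rmin, Rmax. destruct (Rle_dec b u), (Rle_dec b v); repeat destruct (Rle_dec a _);
unfold Rabs; repeat destruct (Rcase_abs _); lra.
Qed.

Lemma clamp_id (a b v : R) : a <= v <= b -> clamp a b v = v.
Proof. intros H. unfold clamp. rewrite Rmin_right by lra. apply Rmax_right; lra. Qed.

Lemma clamp_range (a b v : R) : a <= b -> a <= clamp a b v <= b.
Proof. intros H. unfold clamp, Rmin, Rmax. destruct (Rle_dec b v); destruct (Rle_dec a _); lra. Qed.

Definition ramp (r : R) : R := clamp 0 1 r.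

Lemma ramp_lip (Lam : R) : 0 <= Lam -> forall s t, Rabs (ramp (Lam * s) - ramp (Lam * t)) <= Lam * Rabs (s - t).
Proof.
intros HL s t. apply Rle_trans with (1 := clamp_lip 0 1 (Lam * s) (Lam * t)).
rewrite <- Rmult_minus_distr_l, Rabs_mult, (Rabs_right Lam); lra.
Qed.

Section Delay.
Context (c : R) (Hc : 0 < c) (F : R -> R) (Lam : R) (HF : lip Lam F) (HF2 : forall v, 0 <= F v <= 2).
Context (beta eps : R) (Heps : 0 < eps).

(** The mass law solved for b, with mass [beta] at time 0: any flux determines its trace. *)
Definition trace (g : R -> R) (t : R) : R := beta - c * RInt g 0 t - J c g t.

(* The delay eps makes the boundary condition explicit, so that k iterations give the solution up to
   time k eps; the ramp keeps the flux continuous at its start. *)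
Fixpoint delay_iter (k : nat) : R -> R :=
  match k with
  | O => fun _ => 0
  | S k => fun t => ramp (/ eps * t) * F (trace (delay_iter k) (t - eps))
  end.

Lemma trace_cont (g : R -> R) : bdd 2 g -> cont (trace g).
Proof.
intros Hg. apply cont_minus; [apply cont_minus; [apply cont_const|]|].
- apply cont_scal, cont_RInt, Hg.
- now apply (J_cont c Hc 2).
Qed.

Lemma ramp_cont : cont (fun t => ramp (/ eps * t)).
Proof.
apply (lip_cont (/ eps)). split; [left; now apply Rinv_0_lt_compat|]. apply ramp_lip.
left; now apply Rinv_0_lt_compat.
Qed.

Lemma ramp_range (r : R) : 0 <= ramp r <= 1.
Proof. apply clamp_range. lra. Qed.

Lemma delay_step (g : R -> R) : bdd 2 g ->
  bdd 2 (fun t => ramp (/ eps * t) * F (trace g (t - eps))) /\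
  forall t, 0 <= ramp (/ eps * t) * F (trace g (t - eps)).
Proof.
intros Hg. assert (Hr : forall t, 0 <= ramp (/ eps * t) * F (trace g (t - eps)) <= 2).
{ intros t. assert (A := ramp_range (/ eps * t)). assert (B := HF2 (trace g (t - eps))). nra. }
split; [|intros t; apply Hr]. split.
- apply cont_mult; [apply ramp_cont|].
  apply (cont_comp (fun t => trace g (t - eps)) F); [|now apply (lip_cont Lam)].
  apply (cont_shift_add (trace g) (- eps)). now apply trace_cont.
- intros t. specialize (Hr t). apply Rabs_le_between. lra.
Qed.

Lemma delay_bdd (k : nat) : bdd 2 (delay_iter k) /\ forall t, 0 <= delay_iter k t.
Proof.
induction k as [|k IH].
- split; [|intros; simpl; lra]. split; [apply cont_const|]. intros t. simpl. rewrite Rabs_R0. lra.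
- simpl. now apply delay_step.
Qed.

Lemma trace_past (g g' : R -> R) (t : R) : (forall s, s <= Rmax 0 t -> g s = g' s) -> trace g t = trace g' t.
Proof.
intros H. unfold trace.
assert (E1 : RInt g 0 t = RInt g' 0 t) by (apply RInt_ext; intros s Hs; apply H, Rlt_le, Hs).
assert (E2 : J c g t = J c g' t).
{ apply J_past. intros s Hs. apply H. apply Rle_trans with (1 := Hs), Rmax_r. }
now rewrite E1, E2.
Qed.

Lemma delay_zero (k : nat) (t : R) : t <= 0 -> delay_iter k t = 0.
Proof.
intros Ht. destruct k; [reflexivity|]. simpl.
assert (E : ramp (/ eps * t) = 0).
{ unfold ramp, clamp. assert (/ eps * t <= 0).
  { assert (0 < / eps) by now apply Rinv_0_lt_compat. nra. }
  rewrite Rmin_right by lra. apply Rmax_left. lra. }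
rewrite E. ring.
Qed.

(** An iterate at time t sees the previous one only up to t - eps, or up to 0 where all iterates
    vanish; so one more interval of length eps is settled at each step. *)
Lemma delay_stable (k : nat) : forall t, t <= INR k * eps -> delay_iter (S k) t = delay_iter k t.
Proof.
induction k as [|k IH]; intros t Ht.
- simpl in Ht. rewrite Rmult_0_l in Ht. rewrite !delay_zero; auto.
- change (delay_iter (S (S k)) t) with (ramp (/ eps * t) * F (trace (delay_iter (S k)) (t - eps))).
  change (delay_iter (S k) t) with (ramp (/ eps * t) * F (trace (delay_iter k) (t - eps))).
  f_equal. f_equal. apply trace_past. intros s Hs. rewrite S_INR in Ht.
  apply IH. apply Rle_trans with (1 := Hs). apply Rmax_lub; [|lra].
  apply Rmult_le_pos; [apply pos_INR|lra].
Qed.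

Lemma delay_stable_le (j k : nat) (t : R) : (k <= j)%nat -> t <= INR k * eps -> delay_iter j t = delay_iter k t.
Proof.
intros Hkj Ht. induction Hkj as [|j Hkj IH]; [reflexivity|].
rewrite delay_stable; [exact IH|]. apply Rle_trans with (1 := Ht). apply Rmult_le_compat_r; [lra|]. now apply le_INR.
Qed.

Definition delay_level (t : R) : nat := Z.to_nat (up (t / eps)).

Lemma delay_level_spec (t : R) : t < INR (delay_level t) * eps \/ t < 0.
Proof.
destruct (Rlt_dec t 0) as [Ht|Ht]; [now right|left]. unfold delay_level.
destruct (archimed (t / eps)) as [H _].
assert (0 <= t / eps) by (apply Rdiv_le_0_compat; lra).
rewrite INR_IZR_INZ, Z2Nat.id by (apply le_IZR; lra).
apply Rmult_lt_compat_r with (r := eps) in H; [|lra].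
replace (t / eps * eps) with t in H by (field; lra). exact H.
Qed.

(** At each time the iterates are eventually constant; this reads off their final value. *)
Definition delay_flux (t : R) : R := delay_iter (delay_level t) t.

Lemma delay_flux_eq (k : nat) (t : R) : t <= INR k * eps -> delay_flux t = delay_iter k t.
Proof.
intros Ht. unfold delay_flux. destruct (delay_level_spec t) as [H|H].
- destruct (Nat.le_ge_cases k (delay_level t)) as [Hle|Hle].
  + now apply delay_stable_le.
  + symmetry. apply delay_stable_le; auto. lra.
- rewrite !delay_zero; lra.
Qed.

Lemma delay_solution : exists b g, bsol c b g /\ (forall t, b t + J c g t = beta - c * RInt g 0 t) /\
  (forall t, t <= 0 -> g t = 0) /\ (forall t, g t = ramp (/ eps * t) * F (b (t - eps))).
Proof.
assert (Hlev : forall t, exists k, t + 1 < INR k * eps).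
{ intros t. destruct (delay_level_spec (Rabs t + 1)) as [H|H].
  - exists (delay_level (Rabs t + 1)). generalize (Rle_abs t). lra.
  - generalize (Rabs_pos t). lra. }
assert (Hg : bdd 2 delay_flux).
{ split.
  - intros t. destruct (Hlev t) as [k Hk].
    apply (continuous_ext_near (delay_iter k) _ t 1); [lra| |apply delay_bdd].
    intros y Hy. apply Rabs_def2 in Hy. symmetry. apply delay_flux_eq. lra.
  - intros t. apply delay_bdd. }
exists (trace delay_flux), delay_flux.
split; [|split; [|split]].
- split.
  + now apply trace_cont.
  + exact Hg.
  + intros t. apply delay_bdd.
  + intros t1 t2. unfold trace. rewrite <- (RInt_Chasles_cont delay_flux 0 t1 t2) by apply Hg. ring.
- intros t. unfold trace. ring.
- intros t Ht. unfold delay_flux. now apply delay_zero.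
- intros t. destruct (Hlev (Rabs t)) as [k Hk]. generalize (Rle_abs t) (Rabs_pos t). intros.
  rewrite (delay_flux_eq (S k) t) by (rewrite S_INR; lra). simpl. f_equal. f_equal.
  apply trace_past. intros s Hs. symmetry. apply delay_flux_eq.
  apply Rle_trans with (1 := Hs). apply Rmax_lub; lra.
Qed.

Context (Hbeta : 0 <= beta) (HFpos : forall v, 0 <= v <= beta -> 0 < F v).

(** If the mass stayed positive, the trace would converge to a zero of F in [0, beta], where there
    is none. *)
Lemma delay_hits_zero (b g : R -> R) : bsol c b g -> (forall t, b t + J c g t = beta - c * RInt g 0 t) ->
  (forall t, g t = ramp (/ eps * t) * F (b (t - eps))) -> exists T, 0 <= T /\ mass c b g T = 0.
Proof.
intros H Hm Hgb.
assert (Hm0 : mass c b g 0 = beta). { unfold mass. rewrite Hm, RInt_point. unfold zero; simpl. ring. }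
destruct (classic (exists t, 0 <= t /\ mass c b g t <= 0)) as [[t [Ht Hmt]]|Hn].
{ destruct (IVT_decr (mass c b g) 0 t 0) as [T [HT E]]; [now apply mass_cont|lra|lra|]. exists T. split; [lra|exact E]. }
exfalso.
assert (Hpos : forall t, 0 <= t -> 0 < mass c b g t).
{ intros t Ht. apply Rnot_le_lt. intros Hle. apply Hn. now exists t. }
assert (HL := proj1 HF).
assert (Huc : forall e, 0 < e -> exists d, 0 < d /\ forall s t, Rabs (s - t) < d -> Rabs (g s - g t) < e).
{ intros e He. destruct (lip_unif_cont Lam F b HF) with (eps := e / 2) as [d [Hd Hud]]; [|lra|].
  { intros e' He'. now apply (bsol_unif_cont c Hc b g). }
  assert (Hie : 0 < / eps) by now apply Rinv_0_lt_compat.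
  exists (Rmin d (e / (8 * / eps))). split; [apply Rmin_pos; [auto|apply Rdiv_lt_0_compat; lra]|].
  intros s t Hst. assert (M1 := Rmin_l d (e / (8 * / eps))). assert (M2 := Rmin_r d (e / (8 * / eps))).
  specialize (Hud (s - eps) (t - eps)). replace (s - eps - (t - eps)) with (s - t) in Hud by ring. specialize (Hud ltac:(lra)).
  rewrite !Hgb.
  assert (A1 := ramp_lip (/ eps) (Rlt_le _ _ Hie) s t). assert (A2 := ramp_range (/ eps * s)).
  assert (A3 := HF2 (b (t - eps))).
  assert (A4 : / eps * Rabs (s - t) <= e / 8).
  { apply Rle_trans with (/ eps * (e / (8 * / eps))); [apply Rmult_le_compat_l; lra|]. right. field. lra. }
  set (r1 := ramp (/ eps * s)) in *. set (r2 := ramp (/ eps * t)) in *. set (f1 := F (b (s - eps))) in *. set (f2 := F (b (t - eps))) in *.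
  replace (r1 * f1 - r2 * f2) with (r1 * (f1 - f2) + (r1 - r2) * f2) by ring.
  apply Rle_lt_trans with (1 := Rabs_triang _ _). rewrite !Rabs_mult, (Rabs_right r1), (Rabs_right f2) by lra.
  generalize (Rabs_pos (f1 - f2)) (Rabs_pos (r1 - r2)). nra. }
destruct (end_plus_gen c Hc 0 b g H Huc) as [L [Tb [Tm Tg]]].
{ intros t Ht. left. now apply Hpos. }
assert (HLr : 0 <= L <= beta).
{ split; apply Rnot_lt_le; intros Hlt.
  - destruct (Tm (- L)) as [T [HT HT']]; [lra|]. specialize (HT' T (Rle_refl T)). specialize (Hpos T HT).
    rabs_lra.
  - destruct (Tm (L - beta)) as [T [HT HT']]; [lra|]. specialize (HT' T (Rle_refl T)).
    assert (K := mass_decr c Hc b g 0 T H HT). rabs_lra. }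
assert (E : F L = 0).
{ apply (limit_zero_of_F Lam F L HF). intros e He.
  destruct (Tb e He) as [T1 [HT1 H1]]. destruct (Tg e He) as [T2 [HT2 H2]].
  (* At time T1 + T2 + eps the ramp has reached 1 and the delayed argument is [b (T1 + T2)]. *)
  exists (b (T1 + T2)). split; [apply H1; lra|]. specialize (H2 (T1 + T2 + eps) ltac:(lra)).
  rewrite Hgb, Rminus_0_r in H2. replace (T1 + T2 + eps - eps) with (T1 + T2) in H2 by ring.
  replace (ramp (/ eps * (T1 + T2 + eps))) with 1 in H2; [now rewrite Rmult_1_l in H2|].
  unfold ramp, clamp. assert (0 < / eps) by now apply Rinv_0_lt_compat.
  assert (1 <= / eps * (T1 + T2 + eps)).
  { rewrite Rmult_plus_distr_l, Rinv_l by lra. assert (0 <= / eps * (T1 + T2)) by (apply Rmult_le_pos; lra). lra. }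
  rewrite Rmin_left by lra. rewrite Rmax_right; lra. }
specialize (HFpos L HLr). lra.
Qed.

(** Moving a zero of the mass to time 0 keeps the solutions away from the equilibria -pi and pi when
    eps -> 0. On the initial ramp the flux error is at most [F beta], hence at most eps by [Hb1]. *)
Lemma delay_normalized (Hb1 : F beta <= eps) : exists b g, bsol c b g /\ mass c b g 0 = 0 /\
  (forall t, mass c b g t <= beta) /\ (forall t, Rabs (g t - F (b (t - eps))) <= eps).
Proof.
destruct delay_solution as [b [g [H [Hm [Hg0 Hgb]]]]].
destruct (delay_hits_zero b g H Hm Hgb) as [T [HT E]].
assert (Hm0 : mass c b g 0 = beta). { unfold mass. rewrite Hm, RInt_point. unfold zero; simpl. ring. }
assert (Hb0 : forall t, t <= 0 -> b t = beta).
{ intros t Ht. assert (K := Hm t). rewrite (J_past c g (fun _ => 0)) in K by (intros s Hs; apply Hg0; lra).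
  rewrite J_0 in K by auto. rewrite (RInt_ext g (fun _ => 0)) in K.
  - rewrite RInt_const_R in K. lra.
  - intros s Hs. apply Hg0. rewrite Rmax_left in Hs by lra. lra. }
exists (fun t => b (t + T)), (fun t => g (t + T)). split; [now apply bsol_shift|]. split; [|split].
- rewrite mass_shift, Rplus_0_l. exact E.
- intros t. rewrite mass_shift. destruct (Rle_dec 0 (t + T)) as [Ht|Ht].
  + rewrite <- Hm0. now apply mass_decr.
  + unfold mass. rewrite (Hb0 (t + T)) by lra.
    rewrite (J_past c g (fun _ => 0)) by (intros s Hs; apply Hg0; lra). rewrite J_0 by auto. lra.
- intros t. rewrite Hgb. replace (t - eps + T) with (t + T - eps) by ring.
  assert (Hie : 0 < / eps) by now apply Rinv_0_lt_compat.
  destruct (Rle_dec (t + T) eps) as [Ht|Ht].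
  + rewrite (Hb0 (t + T - eps)) by lra. assert (A := ramp_range (/ eps * (t + T))). assert (B := HF2 beta).
    apply Rabs_le_between. nra.
  + replace (ramp (/ eps * (t + T))) with 1; [rewrite Rmult_1_l, Rminus_diag, Rabs_R0; lra|].
    unfold ramp, clamp. assert (1 <= / eps * (t + T)).
    { apply Rle_trans with (/ eps * eps); [rewrite Rinv_l; lra|]. apply Rmult_le_compat_l; lra. }
    rewrite Rmin_left by lra. rewrite Rmax_right; lra.
Qed.
End Delay.

Lemma inv_INR_small (e : R) : 0 < e -> exists N, forall n, (N <= n)%nat -> / INR (S n) < e.
Proof.
intros He. destruct (archimed_cor1 e He) as [N [HN HN0]]. exists N. intros n Hn.
apply Rle_lt_trans with (2 := HN). apply Rinv_le_contravar; [now apply lt_0_INR|]. apply le_INR. lia.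
Qed.

Section Existence.
Context (c : R) (Hc : 0 < c) (h : R -> R) (Hh : h_hyp h)
  (Hz : forall v, (forall k : Z, v <> PI + 2 * IZR k * PI) -> -1 < h v).
Context (Uf : (nat -> Prop) -> Prop) (HU : ultra Uf).
Let F := flux1 h.

Record heteroclinic (b : R -> R) : Prop := {
  het_sol : bsol c b (fun t => F (b t));
  het_minus : tends_minus b PI;
  het_mass : tends_minus (mass c b (fun t => F (b t))) PI;
  het_mass_lt : forall t, mass c b (fun t => F (b t)) t < PI;
  het_range : forall t, - PI < b t < PI;
  het_strict : forall s t, s < t -> b t < b s;
  het_plus : tends_plus b (- PI);
  het_flux : tends_plus (fun t => F (b t)) 0 }.

Lemma heteroclinic_limit : exists b, bsol c b (fun t => F (b t)) /\
  mass c b (fun t => F (b t)) 0 = 0 /\ tends_minus b PI /\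
  tends_minus (mass c b (fun t => F (b t))) PI /\ (forall t, - PI <= b t) /\
  (forall t, mass c b (fun t => F (b t)) t < PI).
Proof.
generalize PI_RGT_0 PI2_3_2; intros HPI HPI3.
destruct (h_lip h Hh) as [Lam HLam]. assert (HF := flux1_lip h Lam HLam). fold F in HF.
assert (HL := proj1 HF).
(* An approximating trace might leave [-pi, pi], where F need not vanish; the clamped flux is 0
   there. The bounds proved below show that the clamp is inactive on the limit. *)
pose (Fc := fun v => F (clamp (- PI) PI v)).
assert (HFc : lip Lam Fc).
{ split; auto. intros a b. unfold Fc. apply Rle_trans with (1 := proj2 HF _ _). apply Rmult_le_compat_l; auto. apply clamp_lip. }
assert (HFc2 : forall v, 0 <= Fc v <= 2) by (intros v; exact (flux1_range h _ Hh)).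
assert (FcPI : Fc PI = 0) by (unfold Fc; rewrite clamp_id by lra; now apply flux1_PI).
assert (FcmPI : Fc (- PI) = 0) by (unfold Fc; rewrite clamp_id by lra; now apply flux1_mPI).
assert (Fczero : forall v, - PI < v < PI -> 0 < Fc v).
{ intros v Hv. destruct (HFc2 v) as [[Hp|E] _]; [exact Hp|exfalso]. unfold Fc in E. rewrite clamp_id in E by lra.
  symmetry in E. apply flux1_zero in E; auto; lra. }
pose (en := fun n => / INR (S n)). 
assert (Hen : forall n, 0 < en n <= 1).
{ intros n. unfold en. assert (1 <= INR (S n)) by (rewrite S_INR; generalize (pos_INR n); lra).
  split; [apply Rinv_0_lt_compat; lra|]. rewrite <- Rinv_1. apply Rinv_le_contravar; lra. }
(* F pi = 0 and the Lipschitz bound give [Fc (bet n) <= en n], the price of the ramp; [en n <= 1]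
   keeps [bet n] nonnegative. *)
pose (bet := fun n => PI - en n / (Lam + 1)).
assert (Hbet : forall n, 0 <= bet n < PI /\ Fc (bet n) <= en n).
{ intros n. specialize (Hen n). unfold bet.
  assert (E : en n / (Lam + 1) * (Lam + 1) = en n) by (field; lra).
  assert (0 < en n / (Lam + 1)) by (apply Rdiv_lt_0_compat; lra).
  split; [nra|]. assert (K := proj2 HFc (PI - en n / (Lam + 1)) PI). rewrite FcPI in K.
  replace (PI - en n / (Lam + 1) - PI) with (- (en n / (Lam + 1))) in K by ring.
  rewrite Rabs_Ropp, (Rabs_right (en n / (Lam + 1))), Rminus_0_r in K by lra.
  apply Rabs_le_between in K. nra. }
assert (Hex : forall n, exists bg : (R -> R) * (R -> R), bsol c (fst bg) (snd bg) /\ mass c (fst bg) (snd bg) 0 = 0 /\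
  (forall t, mass c (fst bg) (snd bg) t <= PI) /\ (forall t, Rabs (snd bg t - Fc (fst bg (t - en n))) <= en n)).
{ intros n. destruct (Hbet n) as [B1 B2].
  destruct (delay_normalized c Hc Fc Lam HFc HFc2 (bet n) (en n) (proj1 (Hen n)) (proj1 B1)) as [b [g [A1 [A2 [A3 A4]]]]]; auto.
  { intros v Hv. apply Fczero. lra. }
  exists (b, g). simpl. split; [auto|split; [auto|split; [|auto]]]. intros t. specialize (A3 t). lra. }
pose (bg := fun n => epsilon (inhabits ((fun _ : R => 0), (fun _ : R => 0))) (fun bg : (R -> R) * (R -> R) => bsol c (fst bg) (snd bg) /\ mass c (fst bg) (snd bg) 0 = 0 /\
  (forall t, mass c (fst bg) (snd bg) t <= PI) /\ (forall t, Rabs (snd bg t - Fc (fst bg (t - en n))) <= en n))).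
assert (Hbg : forall n, bsol c (fst (bg n)) (snd (bg n)) /\ mass c (fst (bg n)) (snd (bg n)) 0 = 0 /\
  (forall t, mass c (fst (bg n)) (snd (bg n)) t <= PI) /\ (forall t, Rabs (snd (bg n) t - Fc (fst (bg n) (t - en n))) <= en n)).
{ intros n. unfold bg. apply epsilon_spec, Hex. }
destruct (bsol_limit c Hc Uf HU (fun n => fst (bg n)) (fun n => snd (bg n)) Lam (8 / (3 * c)) Fc) as [b [Hb [_ [Hbm _]]]]; auto.
- intros n. apply Hbg.
- intros n. destruct (Hbg n) as [A1 [A2 _]]. assert (K := J_bs c Hc _ _ 0 A1). unfold mass in A2.
  apply Rabs_le_between. lra.
(* The delay disappears in the limit: the traces are equicontinuous uniformly in n, so the value at
   t - [en n] may be replaced by the value at t. *)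
- intros K e He.
  destruct (equicont c Hc 2 (e / 4 / (Lam + 1))) as [d [Hd Heq]]; [lra|repeat apply Rdiv_lt_0_compat; lra|].
  destruct (inv_INR_small (Rmin d (e / 2))) as [N HN]; [apply Rmin_pos; lra|].
  apply (ultra_imp Uf HU (fun n => (N <= n)%nat)); [|now apply ultra_ge].
  intros n Hn t _. specialize (HN n Hn). fold (en n) in HN. specialize (Hen n).
  assert (M1 := Rmin_l d (e / 2)). assert (M2 := Rmin_r d (e / 2)).
  destruct (Hbg n) as [A1 [_ [_ A4]]]. specialize (A4 t).
  destruct (Heq (snd (bg n)) t (- en n) (bs_g _ _ _ A1)) as [E1 _].
  { rewrite Rabs_Ropp, Rabs_right; lra. }
  assert (E2 := bs_eq _ _ _ A1 t (t + - en n)). unfold window in E1.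
  assert (E3 : Rabs (fst (bg n) (t - en n) - fst (bg n) t) <= e / 4 / (Lam + 1)).
  { replace (t - en n) with (t + - en n) by ring. rabs_lra. }
  assert (E4 := proj2 HFc (fst (bg n) (t - en n)) (fst (bg n) t)).
  assert (E5 : Lam * Rabs (fst (bg n) (t - en n) - fst (bg n) t) <= e / 4).
  { apply Rle_trans with ((Lam + 1) * (e / 4 / (Lam + 1))); [|right; field; lra].
    apply Rmult_le_compat; try lra. apply Rabs_pos. }
  replace (snd (bg n) t - Fc (fst (bg n) t)) with
    ((snd (bg n) t - Fc (fst (bg n) (t - en n))) + (Fc (fst (bg n) (t - en n)) - Fc (fst (bg n) t))) by ring.
  apply Rle_lt_trans with (1 := Rabs_triang _ _). lra.
- set (g := fun t => Fc (b t)) in *.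
  assert (Hm0 : mass c b g 0 = 0).
  { apply (ulim_unique Uf HU (fun n => mass c (fst (bg n)) (snd (bg n)) 0)); [apply Hbm|].
    intros e He. apply (ultra_all Uf HU). intros n. destruct (Hbg n) as [_ [A2 _]]. rewrite A2, Rminus_0_r, Rabs_R0. exact He. }
  assert (HmPI : forall t, mass c b g t <= PI).
  { intros t. apply (ulim_le Uf HU (fun n => mass c (fst (bg n)) (snd (bg n)) t) (fun _ => PI)); [apply Hbm|apply (ulim_const Uf HU)|].
    apply (ultra_all Uf HU). intros n. apply Hbg. }
  destruct (end_minus c Hc Lam PI Fc b Hb HFc) as [L [FL [Tb Tm]]]; [intros t _; apply HmPI|].
  fold g in Tm.
  (* Mass 0 at time 0 puts the limit at -oo into [0, pi], where pi is the only zero of the clamped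
     flux. *)
  assert (HLr : 0 <= L <= PI).
  { split.
    - rewrite <- Hm0. apply (tends_minus_decr_le (mass c b g) L 0); [|exact Tm].
      intros s t Hst. now apply mass_decr.
    - apply Rnot_lt_le. intros Hlt. destruct (Tm (L - PI)) as [T [HT HT']]; [lra|].
      specialize (HT' T (Rle_refl T)). specialize (HmPI T). rabs_lra. }
  assert (EL : L = PI).
  { destruct (Rle_lt_or_eq_dec _ _ (proj2 HLr)) as [Hlt|E]; [|exact E]. specialize (Fczero L ltac:(lra)). lra. }
  rewrite EL in *.
  (* At t0 the trace is positive and U lies above it, so the equilibrium -pi of the clamped flux
     stays below from then on. *)
  assert (Hlow : forall t, - PI <= b t).
  { intros t. destruct (Tb PI HPI) as [T [HT HT']].
    pose (t0 := Rmin T t). specialize (HT' t0 (Rmin_l _ _)). apply Rabs_def2 in HT'.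
    rewrite <- (U_0 c b g t), <- (U_const c Hc (- PI) 0 t).
    apply (bsol_compare c Hc b g (fun _ => - PI) (fun _ => 0) t0 t Lam); auto; try lra.
    - now apply bsol_const.
    - apply Rmin_r.
    - intros s _. rewrite <- FcmPI. apply HFc.
    - intros x Hx. rewrite U_const by auto. apply Rle_trans with (b t0); [lra|]. now apply (U_bounds c Hc).
    - split; [apply Rmin_r|lra]. }
  assert (Hup : forall t, b t <= PI).
  { intros t. specialize (HmPI t). assert (K := J_bs c Hc b g t Hb). unfold mass in HmPI. lra. }
  assert (Eg : g = fun t => F (b t)).
  { apply functional_extensionality. intros t. unfold g, Fc. rewrite clamp_id; auto. }
  (* Mass pi at one time forces b = pi on the past and, by forward uniqueness, at all times, against
     mass 0 at time 0. *)
  assert (HmLt : forall t, mass c b g t < PI).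
  { intros t. destruct (Rle_lt_or_eq_dec _ _ (HmPI t)) as [Hlt|E]; [exact Hlt|exfalso].
    assert (K : forall s, s <= t -> mass c b g s = PI).
    { intros s Hs. apply Rle_antisym; [apply HmPI|]. rewrite <- E. now apply mass_decr. }
    assert (K2 := mass_const_past c Hc b g t PI Hb K).
    assert (K3 : forall s, b s = PI).
    { apply (bsol_unique_forward c Hc b g (fun _ => PI) (fun _ => 0) t Lam); auto.
      - now apply bsol_const.
      - intros s _. rewrite <- FcPI. apply HFc.
      - intros s Hs. destruct (K2 s Hs). auto. }
    unfold mass in Hm0. rewrite K3, (J_past c g (fun _ => 0)), J_0 in Hm0; auto; [lra|].
    intros s _. unfold g. rewrite K3. exact FcPI. }
  rewrite Eg in *. exists b. split; [exact Hb|]. split; [exact Hm0|]. split; [exact Tb|]. split; [exact Tm|]. split; auto.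
Qed.

Lemma heteroclinic_exists : exists b, heteroclinic b.
Proof.
generalize PI_RGT_0; intros HPI.
destruct heteroclinic_limit as [b [Hb [Hm0 [Tb [Tm [Hlow HmLt]]]]]].
destruct (h_lip h Hh) as [Lam HLam]. assert (HF := flux1_lip h Lam HLam). fold F in HF.
set (g := fun t => F (b t)) in *.
assert (Hup : forall t, b t < PI).
{ intros t. specialize (HmLt t). assert (K := J_bs c Hc b g t Hb). unfold mass in HmLt. lra. }
assert (Hmono : forall s t, s <= t -> b t <= b s).
{ destruct (small_slope_ex c Hc) as [eta [Heta Hss]].
  destruct (h_small_slope h eta Hh Heta) as [rho [Hrho Hslope]].
  destruct (Tb rho Hrho) as [T [HT HT']].
  (* The mass difference D of b and its translate is nonnegative, and [backward_estimate] gives b t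
     - b (t + k) >= D - D/3. *)
  assert (Hearly : forall k t, 0 <= k -> t + k <= T -> b (t + k) <= b t).
  { intros k t Hk Ht. assert (Hs := bsol_shift c b g k Hb).
    destruct (backward_estimate c Hc b g _ _ t eta (2 * rho) Hb Hs Hss) as [_ K].
    { intros s Hs'. unfold g, F, flux1. replace (1 + 1 * h (b s) - (1 + 1 * h (b (s + k)))) with (h (b s) - h (b (s + k))) by ring.
      apply Hslope; left; apply HT'; lra. }
    { intros s Hs'. assert (A1 := HT' s ltac:(lra)). assert (A2 := HT' (s + k) ltac:(lra)).
      rabs_lra. }
    rewrite mass_shift in K. assert (A := mass_decr c Hc b g t (t + k) Hb ltac:(lra)).
    rewrite (Rabs_right (mass c b g t - mass c b g (t + k))) in K by lra.
    rabs_lra. }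
  (* From early times on, monotonicity is a comparison of b with its translate; the ordering of the
     profiles at t0 comes from that of the boundary values on the whole past. *)
  intros s t Hst. pose (k := t - s). pose (t0 := Rmin (T - k) s).
  assert (Hk : 0 <= k) by (unfold k; lra).
  assert (Ht0 : t0 <= s /\ t0 + k <= T) by (unfold t0; generalize (Rmin_l (T - k) s) (Rmin_r (T - k) s); lra).
  assert (Hs := bsol_shift c b g k Hb).
  replace t with (s + k) by (unfold k; ring).
  rewrite <- (U_0 c (fun t => b (t + k)) (fun t => g (t + k)) s), <- (U_0 c b g s).
  apply (bsol_compare c Hc b g (fun t => b (t + k)) (fun t => g (t + k)) t0 s Lam); auto; try lra; try apply HF.
  { intros r _. apply HF. }
  intros x Hx. rewrite U_shift by auto.
  assert (K : 0 <= 1 * U c b g x t0 + -1 * U c b g x (t0 + k)); [|lra].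
  apply (dirichlet_past c Hc (fun y r => 1 * U c b g y r + -1 * U c b g y (r + k)) (4 / c) t0); auto; try lra.
  - apply jcont_comb; [apply (U_jcont c Hc 2); apply Hb|].
    apply (jcont_shift k (U c b g)). apply (U_jcont c Hc 2); apply Hb.
  - apply heat_comb; [apply U_heat; auto|]. apply (heat_shift c k (U c b g)). apply U_heat; auto.
  - intros r Hr. rewrite !U_0. assert (K := Hearly k r Hk ltac:(lra)). lra.
  - intros y r Hy Hr. assert (K := Hearly k r Hk ltac:(lra)).
    assert (B1 := U_bounds c Hc b g y r Hb Hy). assert (B2 := U_bounds c Hc b g y (r + k) Hb Hy).
    assert (E := x_le_exp c y Hc Hy). replace (4 / c) with (2 * (2 / c)) by (field; lra). nra. }
(* A coincidence propagates to the past by [monotone_strict], so the value [b t] recurs at all t - n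
   k; this contradicts b -> pi at -oo, since b t < pi. *)
assert (Hne : forall t k, 0 < k -> b (t + k) <> b t).
{ intros t k Hk E.
  assert (P : forall t0, t0 <= t -> b (t0 + k) = b t0).
  { intros t0 Ht0. apply (monotone_strict c Hc b g k t t0 Hb Hmono Hk E); auto. unfold g. now rewrite E. }
  assert (Pn : forall n, b (t - INR n * k) = b t).
  { induction n as [|n IH]; [simpl; f_equal; ring|]. rewrite <- IH, S_INR.
    rewrite <- (P (t - (INR n + 1) * k)); [f_equal; ring|]. generalize (pos_INR n). intros. nra. }
  destruct (Tb (PI - b t)) as [T [HT HT']]; [specialize (Hup t); lra|].
  destruct (archimed ((Rabs t + - T) / k)) as [A _].
  set (n := Z.to_nat (up ((Rabs t + - T) / k))).
  assert (0 <= (Rabs t + - T) / k) by (apply Rdiv_le_0_compat; [generalize (Rabs_pos t); lra|lra]).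
  assert (En : INR n = IZR (up ((Rabs t + - T) / k))) by (unfold n; rewrite INR_IZR_INZ, Z2Nat.id; [reflexivity|apply le_IZR; lra]).
  rewrite <- En in A. apply Rmult_lt_compat_r with (r := k) in A; [|lra].
  replace ((Rabs t + - T) / k * k) with (Rabs t - T) in A by (field; lra).
  specialize (HT' (t - INR n * k)). generalize (Rle_abs t). intros.
  specialize (HT' ltac:(lra)). rewrite Pn in HT'. specialize (Hup t). rabs_lra. }
assert (Hstrict : forall s t, s < t -> b t < b s).
{ intros s t Hst. destruct (Rle_lt_or_eq_dec _ _ (Hmono s t ltac:(lra))) as [Hlt|E]; [exact Hlt|exfalso].
  apply (Hne s (t - s)); [lra|]. replace (s + (t - s)) with t by ring. exact E. }
assert (Hlow' : forall t, - PI < b t).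
{ intros t. specialize (Hlow (t + 1)). specialize (Hstrict t (t + 1) ltac:(lra)). lra. }
destruct (end_plus c Hc Lam (- PI) F b Hb HF) as [L [FL [Tp [_ Tg]]]].
{ intros t _. fold g. unfold mass. assert (K := J_bs c Hc b g t Hb). specialize (Hlow t). lra. }
assert (HLr : - PI <= L <= b 0).
{ split; apply Rnot_lt_le; intros Hlt.
  - destruct (Tp (- PI - L)) as [T [HT HT']]; [lra|]. specialize (HT' T (Rle_refl T)). specialize (Hlow T). rabs_lra.
  - destruct (Tp (L - b 0)) as [T [HT HT']]; [lra|]. specialize (HT' T (Rle_refl T)). specialize (Hmono 0 T HT). rabs_lra. }
assert (EL : L = - PI).
{ assert (K := Hup 0). destruct (flux1_zero h L Hz ltac:(lra) FL) as [E|E]; [exact E|lra]. }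
rewrite EL in Tp.
exists b. split; auto.
Qed.
End Existence.

(** * The main theorem *)

Definition fluxth (th : R) (h : R -> R) (v : R) : R := 1 + th * h v.

Section Final.
Context (c : R) (Hc : 0 < c) (h : R -> R) (Hh : h_hyp h)
  (Hz : forall v, (forall k : Z, v <> PI + 2 * IZR k * PI) -> -1 < h v).
Let F := flux1 h.

(** Monotonicity and the relative period T bound every increment over a time at most T by 2 pi, and
    they turn the Y_c bound at one time into a bound over a whole period. These are the growth
    hypotheses of [classical_bsol]. *)
Lemma rpm_bsol (th y : R) (u : R -> R -> R) : -1 < th < 1 -> rpm_solution c th h y u ->
  bsol c (fun t => u 0 t) (fun t => fluxth th h (u 0 t)) /\
  (forall x t, 0 <= x -> u x t = U c (fun t => u 0 t) (fun t => fluxth th h (u 0 t)) x t) /\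
  (forall s t, s <= t -> u 0 t <= u 0 s) /\ u 0 0 = y.
Proof.
intros Hth [Hent [[T [HT [Hper _]]] [_ [Hdt Hy]]]].
assert (Hent' := Hent).
destruct Hent' as [ux [uxx [ut [C0 [C1 [C2 [C3 [D1 [D2 [D3 [PDE [BC HY]]]]]]]]]]]].
assert (Hdec : forall x s t, 0 < x -> s <= t -> u x t <= u x s).
{ intros x s t Hx Hst. apply Ropp_le_cancel.
  apply (incr_of_derive (fun t => - u x t) (fun t => - ut x t)); auto.
  - intros r _. apply (is_derive_opp (V:=R_NormedModule) (fun t => u x t)). now apply D3.
  - intros r _. assert (K := Hdt x r Hx).
    assert (E : Derive (fun s : R => u x s) r = ut x r) by (now apply is_derive_unique, D3). rewrite E in K. lra. }
assert (Hrange : forall t, 0 <= fluxth th h (u 0 t) <= 2).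
{ intros t. destruct Hh as [_ [_ [H1 [_ [_ H2]]]]]. specialize (H1 (u 0 t)). specialize (H2 (u 0 t)). unfold fluxth. split; nra. }
generalize PI_RGT_0; intros HPI.
destruct (classical_bsol c Hc th T (2 * PI) h u Hent HT Hrange) as [A1 A2].
- intros x t tau Hx Htau. assert (K1 := Hdec x t (t + tau) Hx ltac:(lra)).
  assert (K2 := Hdec x (t + tau) (t + T) Hx ltac:(lra)). rewrite (Hper x t) in K2 by lra.
  apply Rabs_le_between. lra.
- intros t. destruct (HY t) as [[M HM] _]. exists (M + 2 * PI). intros x s Hx Hs.
  assert (K1 := Hdec x t s Hx ltac:(lra)). assert (K2 := Hdec x s (t + T) Hx ltac:(lra)). rewrite (Hper x t) in K2 by lra.
  specialize (HM x ltac:(lra)). 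
  rewrite Rabs_mult, (Rabs_right (exp _)) in HM by (apply Rle_ge, Rlt_le, exp_pos).
  assert (E1 : exp (c * x / 2) * exp (- c * x / 2) = 1).
  { rewrite <- exp_plus. replace (c * x / 2 + - c * x / 2) with 0 by field. apply exp_0. }
  assert (E2 : 1 <= exp (c * x / 2)) by (apply exp_ge_1; nra).
  assert (E3 : Rabs (u x t) <= M * exp (c * x / 2)).
  { apply Rmult_le_compat_l with (r := exp (c * x / 2)) in HM; [|lra]. rewrite <- Rmult_assoc, E1 in HM. lra. }
  apply Rabs_le_between in E3. apply Rabs_le_between. nra.
- split; [exact A1|split; [exact A2|split; [|exact Hy]]].
  (* The sign of u_t is assumed for x > 0; at x = 0 monotonicity follows by continuity of u. *)
  intros s t Hst. apply Rnot_lt_le. intros Hlt.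
  destruct (C0 0 s (Rle_refl 0) ((u 0 t - u 0 s) / 2)) as [d1 [Hd1 H1]]; [lra|].
  destruct (C0 0 t (Rle_refl 0) ((u 0 t - u 0 s) / 2)) as [d2 [Hd2 H2]]; [lra|].
  pose (x := Rmin d1 d2 / 2).
  assert (Hx : 0 < x /\ x < d1 /\ x < d2).
  { unfold x. assert (0 < Rmin d1 d2) by now apply Rmin_pos. generalize (Rmin_l d1 d2) (Rmin_r d1 d2). lra. }
  specialize (H1 x s ltac:(lra)). specialize (H2 x t ltac:(lra)).
  rewrite Rminus_0_r, (Rabs_right x), Rminus_diag, Rabs_R0 in H1, H2 by lra.
  specialize (H1 ltac:(lra) Hd1). specialize (H2 ltac:(lra) Hd2). specialize (Hdec x s t ltac:(lra) Hst).
  rabs_lra.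
Qed.

Lemma trapped_bsol (u : R -> R -> R) : entire_solution c 1 h u -> (forall x t, 0 <= x -> -PI < u x t < PI) ->
  bsol c (fun t => u 0 t) (fun t => F (u 0 t)) /\
  forall x t, 0 <= x -> u x t = U c (fun t => u 0 t) (fun t => F (u 0 t)) x t.
Proof.
intros Hent Hr. generalize PI_RGT_0; intros HPI.
apply (classical_bsol c Hc 1 1 (2 * PI) h u Hent Rlt_0_1).
- intros t. apply (flux1_range h (u 0 t) Hh).
- intros x t tau Hx _. assert (A1 := Hr x (t + tau) ltac:(lra)). assert (A2 := Hr x t ltac:(lra)).
  apply Rabs_le_between. lra.
- intros t. exists PI. intros x s Hx _. assert (A1 := Hr x s ltac:(lra)).
  assert (E2 : 1 <= exp (c * x / 2)) by (apply exp_ge_1; nra).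
  apply Rle_trans with PI; [apply Rabs_le_between; lra|]. nra.
Qed.

Lemma tends_minus_ge (f : R -> R) (L k : R) : (forall t, t <= 0 -> k <= f t) -> tends_minus f L -> k <= L.
Proof.
intros Hk HL. apply Rnot_lt_le. intros Hlt. destruct (HL (k - L)) as [T [HT H]]; [lra|].
specialize (H T (Rle_refl T)). specialize (Hk T HT). rabs_lra.
Qed.

Lemma tends_minus_le (f : R -> R) (L k : R) : (forall t, t <= 0 -> f t <= k) -> tends_minus f L -> L <= k.
Proof.
intros Hk HL. apply Rnot_lt_le. intros Hlt. destruct (HL (L - k)) as [T [HT H]]; [lra|].
specialize (H T (Rle_refl T)). specialize (Hk T HT). rabs_lra.
Qed.

Context (b1 : R -> R) (Hhet : heteroclinic c h b1).
Let g1 := fun t => F (b1 t).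

(** The limit at -oo is a zero of the flux, that is -pi or pi. The exclusion of -pi is stated with
    both the mass and the trace, because one application refutes it through the former and the other
    through the latter. *)
Lemma translate_of_heteroclinic (b : R -> R) : bsol c b (fun t => F (b t)) ->
  (forall t, t <= 0 -> - PI <= b t < PI) ->
  (forall L, tends_minus (mass c b (fun t => F (b t))) L -> tends_minus b L -> L <> - PI) ->
  exists s, forall t, b t = b1 (t + s).
Proof.
intros Hb Hr HL.
destruct (h_lip h Hh) as [Lam HLam]. assert (HF := flux1_lip h Lam HLam). fold F in HF.
set (g := fun t => F (b t)) in *.
destruct (end_minus c Hc Lam (PI + 8 / (3 * c)) F b Hb HF) as [L [FL [Tb Tm]]].
{ intros t Ht. fold g. unfold mass. assert (K := J_bs c Hc b g t Hb). specialize (Hr t Ht). lra. }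
fold g in Tm.
assert (HLr : - PI <= L <= PI).
{ split; [apply (tends_minus_ge b L (- PI)); auto; intros t Ht; apply Hr; auto|].
  apply (tends_minus_le b L PI); auto. intros t Ht. specialize (Hr t Ht). lra. }
assert (EL : L = PI).
{ destruct (flux1_zero h L Hz HLr FL) as [E|E]; [exfalso; now apply (HL L Tm Tb)|exact E]. }
rewrite EL in Tb, Tm.
assert (HmPI : forall s, mass c b g s <= PI).
{ intros s. apply (tends_minus_decr_le (mass c b g) PI s); [|exact Tm]. intros r t Hrt. now apply mass_decr. }
destruct Hhet as [H1 H2 H3 H4 H5 H6 H7 H8].
apply (heteroclinic_unique c Hc h Hh b b1); auto.
intros t Ht. apply (mass_lt_of_b_lt c Hc h b t PI Hb HmPI). apply (Hr t Ht).
Qed.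

Lemma b1_injective (s t : R) : b1 s = b1 t -> s = t.
Proof.
intros E. destruct (Rtotal_order s t) as [Hlt|[Heq|Hgt]]; auto.
- assert (K := het_strict c h b1 Hhet s t Hlt). lra.
- assert (K := het_strict c h b1 Hhet t s Hgt). lra.
Qed.

Lemma b1_onto (y : R) : - PI < y < PI -> exists t, b1 t = y.
Proof.
intros Hy.
destruct (het_minus c h b1 Hhet (PI - y)) as [S [HS HS']]; [lra|].
destruct (het_plus c h b1 Hhet (y + PI)) as [T [HT HT']]; [lra|].
specialize (HS' S (Rle_refl S)). specialize (HT' T (Rle_refl T)). apply Rabs_def2 in HS', HT'.
destruct (IVT_decr b1 S T y) as [t [_ E]]; [apply (het_sol c h b1 Hhet)|lra|lra|]. now exists t.
Qed.

(** Together with b <= U this squeezes U as t -> -oo, which is why that limit is uniform in x. *)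
Lemma U_le_PI (x t : R) : 0 <= x -> U c b1 g1 x t <= PI.
Proof.
intros Hx. assert (Hb := het_sol c h b1 Hhet). fold F in Hb. fold g1 in Hb.
generalize PI_RGT_0; intros HPI.
assert (K : 0 <= PI * 1 + -1 * U c b1 g1 x t); [|lra].
apply (dirichlet_entire c Hc (fun x t => PI * 1 + -1 * U c b1 g1 x t) (4 / c)); auto.
- apply (jcont_comb PI (-1) (fun _ _ => 1) (U c b1 g1)); [|apply (U_jcont c Hc 2); apply Hb].
  intros y s _ e He. exists 1. split; [lra|]. intros. now rewrite Rminus_diag, Rabs_R0.
- apply (heat_comb c PI (-1) (fun _ _ => 1) (U c b1 g1)); [apply heat_const|now apply U_heat].
- intros s. rewrite U_0. assert (K := het_range c h b1 Hhet s). lra.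
- intros y s Hy. assert (B := U_bounds c Hc b1 g1 y s Hb Hy). assert (K := het_range c h b1 Hhet s).
  assert (E := x_le_exp c y Hc Hy). replace (4 / c) with (2 * (2 / c)) by (field; lra). nra.
Qed.

Lemma U_to_PI (eps : R) : 0 < eps -> exists T, forall t x, t <= T -> 0 <= x -> Rabs (U c b1 g1 x t - PI) < eps.
Proof.
intros He. destruct (het_minus c h b1 Hhet eps He) as [T [HT HT']]. exists T. intros t x Ht Hx.
specialize (HT' t Ht). assert (K := U_le_PI x t Hx). assert (Hb := het_sol c h b1 Hhet). fold F in Hb. fold g1 in Hb.
assert (B := U_bounds c Hc b1 g1 x t Hb Hx). rabs_lra.
Qed.

Lemma U_to_mPI (K eps : R) : 0 < K -> 0 < eps ->
  exists T, forall t x, T <= t -> 0 <= x <= K -> Rabs (U c b1 g1 x t + PI) < eps.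
Proof.
intros HK He. assert (Hb := het_sol c h b1 Hhet). fold F in Hb. fold g1 in Hb.
assert (Hl := lam_pos c Hc).
pose (w := exp (c * K / 4) * K). assert (Hw : 0 < w) by (apply Rmult_lt_0_compat; [apply exp_pos|lra]).
pose (eta := eps / 8 / w). assert (Heta : 0 < eta) by (repeat apply Rdiv_lt_0_compat; lra).
destruct (exp_neg_small 4 (lam c) Hl eta Heta) as [S [HS HS']]. specialize (HS' S (Rle_refl S)).
rewrite Rabs_right in HS' by (generalize (exp_pos (- lam c * S)); lra).
destruct (het_plus c h b1 Hhet (eps / 2)) as [T1 [HT1 H1]]; [lra|].
destruct (het_flux c h b1 Hhet eta Heta) as [T2 [HT2 H2]].
(* After T2 + S the flux has been below eta for a time S, and the older flux is discounted by the
   weight. *)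
exists (T1 + T2 + S). intros t x Ht Hx. specialize (H1 t ltac:(lra)).
assert (Bz : bdd 2 (fun _ : R => 0)) by apply (bsol_const c Hc 0).
assert (Bd := bdd_minus _ _ _ _ (bs_g c _ _ Hb) Bz).
destruct (diff_weighted c Hc g1 (fun _ => 0) t (eta + 4 * exp (- lam c * S)) K (bs_g _ _ _ Hb) Bz) as [_ E].
{ generalize (exp_pos (- lam c * S)). lra. }
{ intros s Hs. apply (weight_tail c Hc (fun r => g1 r - 0) 4 eta S t); auto; try lra.
  - intros r Hr. apply Rle_trans with (1 := proj2 Bd (t - r)). lra.
  - intros r Hr. left. apply H2. lra. }
specialize (E x Hx). rewrite V_const0, Rminus_0_r in E by auto.
assert (E2 : (eta + 4 * exp (- lam c * S)) * exp (c * K / 4) * K <= eps / 4).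
{ rewrite Rmult_assoc. fold w. apply Rle_trans with ((eta + eta) * w); [apply Rmult_le_compat_r; lra|].
  right. unfold eta. field. lra. }
unfold U. rabs_lra.
Qed.

Context (Uf : (nat -> Prop) -> Prop) (HU : ultra Uf).

(** A failure gives, for every n, a bad point for some theta in (1 - 1/(n+1), 1). The limit trace
    along the ultrafilter is identified by the uniqueness hypothesis, and locally uniform
    convergence contradicts the badness. Arguing from a failure yields convergence as theta -> 1,
    not merely along a sequence. *)
Lemma family_converges (y : R) (b : R -> R) (ufam : R -> R -> R -> R) (w : R -> R -> R) :
  (forall th, -1 < th < 1 -> rpm_solution c th h y (ufam th)) ->
  (forall b', bsol c b' (fun t => F (b' t)) -> b' 0 = y -> (forall s t, s <= t -> b' t <= b' s) -> b' = b) ->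
  (forall x t, 0 <= x -> U c b (fun t => F (b t)) x t = w x t) ->
  loc_unif_cvg_to_1 ufam w.
Proof.
intros Hfam Huniq Hw K eps HK He. apply NNPP. intros Hno.
destruct (h_lip h Hh) as [Lam HLam]. assert (HF := flux1_lip h Lam HLam). fold F in HF.
assert (Hbad : forall n : nat, exists p : R * (R * R), 1 - / INR (S n) < fst p < 1 /\ 0 <= fst (snd p) <= K /\
   - K <= snd (snd p) <= K /\ eps <= Rabs (ufam (fst p) (fst (snd p)) (snd (snd p)) - w (fst (snd p)) (snd (snd p)))).
{ intros n. apply NNPP. intros Hn. apply Hno. exists (/ INR (S n)). split; [apply Rinv_0_lt_compat, lt_0_INR; lia|].
  intros th x t Hth Hx Ht. apply Rnot_le_lt. intros Hle. apply Hn. exists (th, (x, t)). simpl. auto. }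
pose (p := fun n => epsilon (inhabits (0, (0, 0))) (fun p : R * (R * R) => 1 - / INR (S n) < fst p < 1 /\ 0 <= fst (snd p) <= K /\
   - K <= snd (snd p) <= K /\ eps <= Rabs (ufam (fst p) (fst (snd p)) (snd (snd p)) - w (fst (snd p)) (snd (snd p))))).
assert (Hp : forall n, 1 - / INR (S n) < fst (p n) < 1 /\ 0 <= fst (snd (p n)) <= K /\
   - K <= snd (snd (p n)) <= K /\ eps <= Rabs (ufam (fst (p n)) (fst (snd (p n))) (snd (snd (p n))) - w (fst (snd (p n))) (snd (snd (p n))))).
{ intros n. unfold p. apply epsilon_spec, Hbad. }
pose (th := fun n => fst (p n)).
assert (Hinv : forall n, 0 < / INR (S n) <= 1).
{ intros n. assert (1 <= INR (S n)) by (rewrite S_INR; generalize (pos_INR n); lra).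
  split; [apply Rinv_0_lt_compat; lra|]. rewrite <- Rinv_1. apply Rinv_le_contravar; lra. }
assert (Hth : forall n, -1 < th n < 1) by (intros n; specialize (Hp n); specialize (Hinv n); unfold th; lra).
assert (Hr := fun n => rpm_bsol (th n) y (ufam (th n)) (Hth n) (Hfam (th n) (Hth n))).
pose (bn := fun n t => ufam (th n) 0 t). pose (gn := fun n t => fluxth (th n) h (ufam (th n) 0 t)).
destruct (bsol_limit c Hc Uf HU bn gn Lam (Rabs y) F) as [b' [Hb' [Hlim [_ HUlim]]]].
- intros n. apply Hr.
- exact HF.
- intros v. now apply flux1_range.
- intros n. destruct (Hr n) as [_ [_ [_ E]]]. unfold bn. rewrite E. apply Rle_refl.
- intros K' e He'. destruct (inv_INR_small e He') as [N HN].
  apply (ultra_imp Uf HU (fun n => (N <= n)%nat)); [|now apply ultra_ge].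
  intros n Hn t _. specialize (HN n Hn). destruct (Hp n) as [A _]. fold (th n) in A.
  unfold gn, bn, fluxth, F, flux1.
  replace (1 + th n * h (ufam (th n) 0 t) - (1 + 1 * h (ufam (th n) 0 t))) with ((th n - 1) * h (ufam (th n) 0 t)) by ring.
  destruct Hh as [_ [_ [H1 [_ [_ H2]]]]]. specialize (H1 (ufam (th n) 0 t)). specialize (H2 (ufam (th n) 0 t)).
  rewrite Rabs_mult, (Rabs_left (th n - 1)) by lra.
  assert (Rabs (h (ufam (th n) 0 t)) <= 1) by (apply Rabs_le_between; lra).
  generalize (Rabs_pos (h (ufam (th n) 0 t))). nra.
- assert (Eb : b' = b).
  { apply Huniq; auto.
    - apply (ulim_unique Uf HU (fun n => bn n 0)); [apply Hlim|].
      intros e He'. apply (ultra_all Uf HU). intros n. destruct (Hr n) as [_ [_ [_ E]]]. unfold bn.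
      now rewrite E, Rminus_diag, Rabs_R0.
    - intros s t Hst. apply (ulim_le Uf HU (fun n => bn n t) (fun n => bn n s)); auto.
      apply (ultra_all Uf HU). intros n. now apply Hr. }
  destruct (ultra_ex Uf HU _ (HUlim K eps He)) as [n Hn].
  destruct (Hp n) as [_ [Hx [Ht Hbd]]]. fold (th n) in Hbd.
  specialize (Hn (fst (snd (p n))) (snd (snd (p n))) Hx ltac:(apply Rabs_le_between; exact Ht)).
  rewrite Eb, Hw in Hn by lra.
  destruct (Hr n) as [_ [E _]]. rewrite E in Hbd by lra. fold (bn n) (gn n) in Hbd.
  change (fun t => ufam (th n) 0 t) with (bn n) in Hbd. lra.
Qed.

(** A past value >= pi would stay >= pi by [compare_with_zero], against y < pi; the limit -pi is
    excluded since b >= y on the past. *)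
Lemma limit_below (y : R) (b : R -> R) : - PI < y < PI -> bsol c b (fun t => F (b t)) -> b 0 = y ->
  (forall s t, s <= t -> b t <= b s) -> exists s, forall t, b t = b1 (t + s).
Proof.
intros Hy Hb H0 Hmono. apply (translate_of_heteroclinic b Hb).
- intros t Ht. specialize (Hmono t 0 Ht). split; [lra|]. apply Rnot_le_lt. intros Hle.
  assert (K := compare_with_zero c Hc h Hh b PI t 0 (flux1_PI h Hh) Hb Hle Ht). lra.
- intros L _ Tb E. rewrite E in Tb.
  assert (K : y <= - PI); [|lra]. apply (tends_minus_ge b (- PI) y); auto. intros t Ht. rewrite <- H0. now apply Hmono.
Qed.

(** Comparison keeps b at pi for t >= 0. The coincidence of two values on that half-line is then
    carried to the past by [monotone_strict]. *)
Lemma limit_at_PI (b : R -> R) : bsol c b (fun t => F (b t)) -> b 0 = PI ->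
  (forall s t, s <= t -> b t <= b s) -> b = fun _ => PI.
Proof.
intros Hb H0 Hmono.
assert (Hplus : forall t, 0 <= t -> b t = PI).
{ intros t Ht. apply Rle_antisym; [rewrite <- H0; now apply Hmono|].
  apply (compare_with_zero c Hc h Hh b PI 0 t (flux1_PI h Hh) Hb); auto. lra. }
apply functional_extensionality. intros t. destruct (Rle_dec 0 t) as [Ht|Ht]; [now apply Hplus|].
assert (E : b (0 + - t) = b 0) by (rewrite (Hplus (0 + - t)), H0; lra).
assert (K := monotone_strict c Hc b (fun t => F (b t)) (- t) 0 t Hb Hmono ltac:(lra) E).
specialize (K (f_equal F E) ltac:(lra)). replace (t + - t) with 0 in K by ring. lra.
Qed.
End Final.

Theorem theorem2 (c : R) (h : R -> R) :
  0 < c -> h_hyp h ->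
  (forall v, (forall k : Z, v <> PI + 2 * IZR k * PI) -> -1 < h v) ->
  exists u1 : R -> R -> R,
    entire_solution c 1 h u1 /\
    (* (i) *)
    (forall eps, 0 < eps -> exists T, forall t x, t <= T -> 0 <= x ->
        Rabs (u1 x t - PI) < eps) /\
    (forall K eps, 0 < K -> 0 < eps -> exists T, forall t x, T <= t -> 0 <= x <= K ->
        Rabs (u1 x t + PI) < eps) /\
    (* (ii) *)
    (forall U : R -> R -> R, entire_solution c 1 h U ->
        (forall x t, 0 <= x -> -PI < U x t < PI) ->
        exists s, forall x t, 0 <= x -> U x t = u1 x (t + s)) /\
    (* (iii) and (iv), for the family u(.,.;theta,y) *)
    (forall ufam : R -> R -> R -> R -> R,
        (forall theta y, -1 < theta < 1 -> -PI < y <= PI ->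
           rpm_solution c theta h y (ufam theta y)) ->
        (exists ty : R -> R,
            (forall y, -PI < y < PI ->
               loc_unif_cvg_to_1 (fun theta => ufam theta y)
                                 (fun x t => u1 x (t + ty y))) /\
            (forall y1 y2, -PI < y1 < PI -> -PI < y2 < PI -> y1 < y2 -> ty y2 < ty y1) /\
            (forall s, exists y, -PI < y < PI /\ ty y = s)) /\
        loc_unif_cvg_to_1 (fun theta => ufam theta PI) (fun _ _ => PI)).
Proof.
intros Hc Hh Hz. generalize PI_RGT_0; intros HPI.
destruct ex_ultra as [Uf HU].
destruct (heteroclinic_exists c Hc h Hh Hz Uf HU) as [b1 Hhet].
assert (Hb1 := het_sol c h b1 Hhet).
pose (g1 := fun t => flux1 h (b1 t)).
exists (U c b1 g1).
split; [|split; [|split; [|split]]].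
- apply (U_entire c Hc 1 h b1 g1 Hb1). reflexivity.
- intros eps He. exact (U_to_PI c Hc h b1 Hhet eps He).
- intros K eps HK He. exact (U_to_mPI c Hc h b1 Hhet K eps HK He).
- intros W HW Hr. destruct (trapped_bsol c Hc h Hh W HW Hr) as [HWb HWU].
  destruct (translate_of_heteroclinic c Hc h Hh Hz b1 Hhet (fun t => W 0 t) HWb) as [s Hs].
  + intros t _. assert (K := Hr 0 t (Rle_refl 0)). lra.
  (* The decreasing mass would be at most -pi at time 0, whereas J >= 0 and W > -pi. *)
  + intros L Tm _ E. rewrite E in Tm.
    assert (K : mass c (fun t => W 0 t) (fun t => flux1 h (W 0 t)) 0 <= - PI).
    { apply tends_minus_decr_le; [|exact Tm]. intros r t Hrt. now apply mass_decr. }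
    unfold mass in K. assert (K2 := J_bs c Hc _ _ 0 HWb). assert (K3 := Hr 0 0 (Rle_refl 0)). lra.
  + exists s. intros x t Hx. rewrite HWU by auto. rewrite <- U_shift by auto. unfold g1.
    f_equal; apply functional_extensionality; intros r; now rewrite Hs.
- intros ufam Hfam. split.
  (* The inverse of the strictly decreasing trace [b1], from which its monotonicity and surjectivity
     are read off. *)
  + pose (ty := fun y => epsilon (inhabits 0) (fun t => b1 t = y)).
    assert (Hty : forall y, - PI < y < PI -> b1 (ty y) = y).
    { intros y Hy. unfold ty. apply (epsilon_spec (inhabits 0) (fun t => b1 t = y)). now apply (b1_onto c h b1 Hhet). }
    exists ty. split; [|split].
    * intros y Hy.
      apply (family_converges c Hc h Hh Uf HU y (fun t => b1 (t + ty y)) (fun th => ufam th y)).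
      -- intros th Hth. apply Hfam; auto. lra.
      -- intros b' Hb' H0 Hmono. destruct (limit_below c Hc h Hh Hz b1 Hhet y b' Hy Hb' H0 Hmono) as [s Hs].
         assert (E : s = ty y).
         { apply (b1_injective c h b1 Hhet). rewrite Hty by auto. rewrite <- H0, Hs. f_equal. ring. }
         apply functional_extensionality. intros t. now rewrite Hs, E.
      -- intros x t Hx. rewrite <- U_shift by auto. reflexivity.
    * intros y1 y2 Hy1 Hy2 Hlt. apply Rnot_le_lt. intros Hle.
      destruct (Rle_lt_or_eq_dec _ _ Hle) as [Hl|E].
      -- assert (K := het_strict c h b1 Hhet _ _ Hl). rewrite !Hty in K by auto. lra.
      -- assert (K := f_equal b1 E). rewrite !Hty in K by auto. lra.
    * intros s. exists (b1 s). assert (K := het_range c h b1 Hhet s). split; [exact K|].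
      apply (b1_injective c h b1 Hhet). now apply Hty.
  + apply (family_converges c Hc h Hh Uf HU PI (fun _ => PI) (fun th => ufam th PI)).
    * intros th Hth. apply Hfam; auto. lra.
    * intros b' Hb' H0 Hmono. now apply (limit_at_PI c Hc h Hh).
    * intros x t Hx. rewrite (flux1_PI h Hh). now apply U_const.
Qed.
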